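(* Let $M$ be a connected Frobenius manifold of dimension $3$, with unity $e$ and Euler vector field $E$ satisfying $\mathcal L_E(e)\ne0$, such that the algebra $T_qM$ is semi-simple for all $q$ in some non-empty open set. Let $S\subset M$ be a surface transverse to $e$. Then the booklet 3-web on $S$ has at least one infinitesimal symmetry at each point: for every $p\in S$ (including singular points of the web) there is a holomorphic vector field $X$, not identically zero, defined on a neighbourhood of $p$ in $S$, whose local flow maps the web leaves to web leaves.
   Context: A Frobenius manifold is a complex analytic manifold $M$ equipped with the following analytic objects: a commutative and associative multiplication $\cdot$ on each $T_pM$; a flat non-degenerate symmetric bilinear inner product $\langle\ ,\ \rangle$ on $TM$ with $\langle u\cdot v,w\rangle=\langle u,v\cdot w\rangle$; a unity vector field $e$ ($e\cdot v=v$) with $\nabla e=0$; an Euler vector field $E$ with $\nabla(\nabla E)=0$; such that (1) the one-parameter group generated by $E$ rescales the multiplication and the inner product (the Lie derivatives along $E$ of the multiplication and of the inner product are constant multiples of them), and (2) with $c(u,v,w):=\langle u\cdot v,w\rangle$, the 4-tensor $(\nabla_z c)(u,v,w)$ is symmetric in $u,v,w,z$. Here $\nabla$ is the Levi-Civita connection of $\langle\ ,\ \rangle$. Booklet 3-web. At points where the algebra is semi-simple there is locally a frame of idempotents $e_1,e_2,e_3$, $e_i\cdot e_j=\delta_{ij}e_i$, $e=e_1+e_2+e_3$. For a surface $S$ transverse to $e$, the three planes spanned by $\{e,e_i\}$ cut three pairwise transverse directions on $T_pS$ at each such $p\in S$; the integral curves of these direction fields are the leaves of the booklet 3-web. The points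 of $S$ where the algebra is not semi-simple are singular points of the web (at least two web directions coincide there); near such a point, the leaves are understood as the leaves on the set of regular points. *)

(* Defs.v *)
From HB Require Import structures.
From mathcomp Require Import all_boot all_order all_algebra.
From mathcomp Require Import all_classical all_reals all_analysis.
From mathcomp Require Import complex.

Set Implicit Arguments.
Unset Strict Implicit.
Unset Printing Implicit Defensive.

Import Order.TTheory GRing.Theory Num.Theory.
Import numFieldNormedType.Exports.

Local Open Scope classical_set_scope.
Local Open Scope ring_scope.

(* The complex numbers over R.  Stated at type numClosedFieldType so that the
   normed-module structure of a numFieldType is found on it; then
   [differentiable], ['d] and ['D_u] are C-linear notions, and a map that is
   [differentiable] at every point of an open set is holomorphic there. *)
Definition C (R : realType) : numClosedFieldType := R[i].

(* [point_of i] is the inverse of the chart [coord i : chart_dom i -> C^n]; the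
   values of [coord i] off [chart_dom i], and of [point_of i] off the image of
   the chart, are irrelevant. *)
Record complex_manifold (R : realType) (n : nat) := ComplexManifold {
  space :> topologicalType;
  chart : Type;
  chart_dom : chart -> set space;
  coord : chart -> space -> 'rV[C R]_n;
  point_of : chart -> 'rV[C R]_n -> space;
  space_hausdorff : hausdorff_space space;
  space_second_countable : @second_countable space;
  chart_dom_open : forall i, open (chart_dom i);
  chart_cover : forall x, exists i, chart_dom i x;
  chart_image_open : forall i, open (coord i @` chart_dom i);
  coordK : forall i x, chart_dom i x -> point_of i (coord i x) = x;
  coord_continuous : forall i x, chart_dom i x ->
    {for x, continuous (coord i)};
  point_of_continuous : forall i x, chart_dom i x ->
    {for coord i x, continuous (point_of i)};
  transition_holomorphic : forall i j x, chart_dom i x -> chart_dom j x ->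
    differentiable (coord j \o point_of i) (coord i x) }.

Section Manifolds.
Variable R : realType.

(* The map N -> M read in the charts i of N and j of M. *)
Definition local_map n m (N : complex_manifold R n) (M : complex_manifold R m)
    (f : N -> M) (i : chart N) (j : chart M) : 'rV[C R]_n -> 'rV[C R]_m :=
  coord j \o f \o point_of i.

(* The tangent map T_xN -> T_(f x)M, tangent vectors being given by their
   components in the charts i and j. *)
Definition tangent_map n m (N : complex_manifold R n) (M : complex_manifold R m)
    (f : N -> M) (i : chart N) (j : chart M) (x : N) :
    'rV[C R]_n -> 'rV[C R]_m :=
  'd (local_map f i j) (coord i x).

Definition holomorphic_map n m (N : complex_manifold R n)
    (M : complex_manifold R m) (f : N -> M) : Prop :=
  continuous f /\
  forall i j x, chart_dom i x -> chart_dom j (f x) ->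
    differentiable (local_map f i j) (coord i x).

Section OneManifold.
Variables (n : nat) (M : complex_manifold R n).

Local Notation V := 'rV[C R]_n.

Definition change_chart (i j : chart M) (x : M) : V -> V :=
  tangent_map (@id M) i j x.

(* A tensor field is a family of components, one for each chart: [X i x] is the
   component of X at x in the chart i, meaningful when [chart_dom i x]. *)
Definition holomorphic_at (W : normedModType (C R)) (i : chart M) (f : M -> W)
    (x : M) : Prop :=
  differentiable (f \o point_of i) (coord i x).

Definition partial (W : normedModType (C R)) (i : chart M) (u : V)
    (f : M -> W) (x : M) : W :=
  'D_u (f \o point_of i) (coord i x).

Definition holomorphic_vector_field (U : set M) (X : chart M -> M -> V) : Prop :=
  (forall i x, U x -> chart_dom i x -> holomorphic_at i (X i) x) /\
  (forall i j x, U x -> chart_dom i x -> chart_dom j x ->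
     X j x = change_chart i j x (X i x)).

Definition lie_bracket (X Y : chart M -> M -> V) (i : chart M) (x : M) : V :=
  partial i (X i x) (Y i) x - partial i (Y i x) (X i) x.

(* In the formulas below u, v, w, z are vector fields with constant components
   in the chart i, so that [u, v] = 0 and [E, u] = - D_u E. *)

Definition lie_mul (E : chart M -> M -> V) (mul : chart M -> M -> V -> V -> V)
    (i : chart M) (x : M) (u v : V) : V :=
  partial i (E i x) (fun y => mul i y u v) x
  - partial i (mul i x u v) (E i) x
  + mul i x (partial i u (E i) x) v + mul i x u (partial i v (E i) x).

Definition lie_metric (E : chart M -> M -> V)
    (g : chart M -> M -> V -> V -> C R) (i : chart M) (x : M) (u v : V) : C R :=
  partial i (E i x) (fun y => g i y u v) x
  + g i x (partial i u (E i) x) v + g i x u (partial i v (E i) x).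

(* [G i x u v] is nabla_u v, i.e. the Christoffel symbols. *)

Definition nabla (G : chart M -> M -> V -> V -> V) (i : chart M) (u : V)
    (Y : M -> V) (x : M) : V :=
  partial i u Y x + G i x u (Y x).

Definition curvature (G : chart M -> M -> V -> V -> V) (i : chart M) (x : M)
    (u v w : V) : V :=
  nabla G i u (fun y => G i y v w) x - nabla G i v (fun y => G i y u w) x.

(* (nabla_u (nabla Y)) v = nabla_u (nabla_v Y) - nabla_(nabla_u v) Y. *)
Definition nabla_nabla (G : chart M -> M -> V -> V -> V) (i : chart M)
    (u v : V) (Y : M -> V) (x : M) : V :=
  nabla G i u (nabla G i v Y) x - nabla G i (G i x u v) Y x.

Definition nabla_c (G : chart M -> M -> V -> V -> V)
    (c : chart M -> M -> V -> V -> V -> C R) (i : chart M) (x : M)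
    (z u v w : V) : C R :=
  partial i z (fun y => c i y u v w) x
  - c i x (G i x z u) v w - c i x u (G i x z v) w - c i x u v (G i x z w).

(* The Levi-Civita connection is the unique torsion-free metric connection. *)
Record levi_civita (g : chart M -> M -> V -> V -> C R)
    (G : chart M -> M -> V -> V -> V) : Prop := LeviCivita {
  lc_linear : forall i x u, chart_dom i x -> linear (G i x u);
  lc_holomorphic : forall i x u v, chart_dom i x ->
    holomorphic_at i (fun y => G i y u v) x;
  lc_torsion_free : forall i x u v, chart_dom i x -> G i x u v = G i x v u;
  lc_metric : forall i x u v w, chart_dom i x ->
    partial i u (fun y => g i y v w) x = g i x (G i x u v) w + g i x v (G i x u w) }.

End OneManifold.
End Manifolds.

Record frobenius_structure (R : realType) (n : nat) (M : complex_manifold R n) :=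
    FrobeniusStructure {
  mul : chart M -> M -> 'rV[C R]_n -> 'rV[C R]_n -> 'rV[C R]_n;
  metric : chart M -> M -> 'rV[C R]_n -> 'rV[C R]_n -> C R;
  unity : chart M -> M -> 'rV[C R]_n;
  euler : chart M -> M -> 'rV[C R]_n;
  conn : chart M -> M -> 'rV[C R]_n -> 'rV[C R]_n -> 'rV[C R]_n;

  mul_holomorphic : forall i x u v, chart_dom i x ->
    holomorphic_at i (fun y => mul i y u v) x;
  mul_tensor : forall i j x u v, chart_dom i x -> chart_dom j x ->
    mul j x (change_chart i j x u) (change_chart i j x v)
    = change_chart i j x (mul i x u v);
  mul_linear : forall i x u, chart_dom i x -> linear (mul i x u);
  mul_comm : forall i x u v, chart_dom i x -> mul i x u v = mul i x v u;
  mul_assoc : forall i x u v w, chart_dom i x ->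
    mul i x u (mul i x v w) = mul i x (mul i x u v) w;

  metric_holomorphic : forall i x u v, chart_dom i x ->
    holomorphic_at i (fun y => metric i y u v) x;
  metric_tensor : forall i j x u v, chart_dom i x -> chart_dom j x ->
    metric j x (change_chart i j x u) (change_chart i j x v) = metric i x u v;
  metric_linear : forall i x u, chart_dom i x -> scalar (metric i x u);
  metric_sym : forall i x u v, chart_dom i x -> metric i x u v = metric i x v u;
  metric_nondegenerate : forall i x u, chart_dom i x ->
    (forall v, metric i x u v = 0) -> u = 0;
  metric_mul : forall i x u v w, chart_dom i x ->
    metric i x (mul i x u v) w = metric i x u (mul i x v w);

  conn_levi_civita : levi_civita metric conn;
  metric_flat : forall i x u v w, chart_dom i x ->
    curvature conn i x u v w = 0;

  unity_holomorphic : holomorphic_vector_field [set: M] unity;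
  unity_mul : forall i x u, chart_dom i x -> mul i x (unity i x) u = u;
  unity_parallel : forall i x u, chart_dom i x ->
    nabla conn i u (unity i) x = 0;

  euler_holomorphic : holomorphic_vector_field [set: M] euler;
  euler_affine : forall i x u v, chart_dom i x ->
    nabla_nabla conn i u v (euler i) x = 0;
  euler_mul : exists k : C R, forall i x u v, chart_dom i x ->
    lie_mul euler mul i x u v = k *: mul i x u v;
  euler_metric : exists k : C R, forall i x u v, chart_dom i x ->
    lie_metric euler metric i x u v = k * metric i x u v;

  (* Invariance under the three adjacent transpositions of (z, u, v, w). *)
  nabla_c_sym : forall i x z u v w, chart_dom i x ->
    let c := fun i x u v w => metric i x (mul i x u v) w in
    [/\ nabla_c conn c i x z u v w = nabla_c conn c i x u z v w,
        nabla_c conn c i x z u v w = nabla_c conn c i x z v u w &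
        nabla_c conn c i x z u v w = nabla_c conn c i x z u w v] }.

Section SemiSimple.
Variables (K : fieldType) (n : nat) (m : 'rV[K]_n -> 'rV[K]_n -> 'rV[K]_n).

Definition ideal_of_algebra (I : {vspace 'rV[K]_n}) : Prop :=
  forall a v, v \in I -> m a v \in I.

(* The commutative algebra (K^n, m) is a semi-simple module over itself: every
   ideal has a complementary ideal. *)
Definition semisimple_algebra : Prop :=
  forall I, ideal_of_algebra I ->
  exists J, [/\ ideal_of_algebra J, (I + J)%VS = fullv & (I :&: J)%VS = 0%VS].

(* The rows of F are a basis e_1, ..., e_n with e_i e_j = delta_ij e_i. *)
Definition idempotent_frame (F : 'M[K]_n) : Prop :=
  F \in unitmx /\
  forall i j, m (row i F) (row j F) = if i == j then row i F else 0.

End SemiSimple.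

Section Web.
Variables (R : realType) (n : nat) (M : complex_manifold R n).
Variable Fr : frobenius_structure M.

Definition semisimple_at (x : M) : Prop :=
  forall i, chart_dom i x -> semisimple_algebra (mul Fr i x).

Variables (d : nat) (S : complex_manifold R d) (f : S -> M).

(* f identifies S with an embedded complex submanifold of M. *)
Definition embedded_submanifold : Prop :=
  [/\ holomorphic_map f,
      injective f,
      (forall i j s, chart_dom i s -> chart_dom j (f s) ->
         injective (tangent_map f i j s)) &
      (forall A : set S, open A -> exists2 B : set M, open B & A = f @^-1` B)].

(* Transversality to the line field spanned by e, for a hypersurface S:
   e is nowhere tangent to S. *)
Definition transverse_to_unity : Prop :=
  forall i j s, chart_dom i s -> chart_dom j (f s) ->
  forall u, tangent_map f i j s u <> unity Fr j (f s).

(* u in T_sS lies on one of the lines cut on T_sS by the planes {e, e_k}. *)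
Definition web_direction (i : chart S) (s : S) (u : 'rV[C R]_d) : Prop :=
  forall j, chart_dom j (f s) ->
  exists (F : 'M[C R]_n) (k : 'I_n) (a b : C R),
    [/\ idempotent_frame (mul Fr j (f s)) F,
        unity Fr j (f s) = \sum_l row l F &
        tangent_map f i j s u = a *: unity Fr j (f s) + b *: row k F].

(* The curve g : D -> S parametrizes an (arc of a) leaf: it is a holomorphic
   immersed curve in the set of regular points, tangent to a web direction at
   each of its points.  At a regular point the web directions are distinct, so,
   D being connected, g stays tangent to one of the direction fields. *)
Definition web_leaf (D : set (C R)) (g : C R -> S) : Prop :=
  [/\ open D, D !=set0 & connected D] /\
  forall t, D t ->
    [/\ semisimple_at (f (g t)),
        {for t, continuous g} &
        forall i, chart_dom i (g t) ->
          [/\ derivable (coord i \o g) t 1,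
              derive1 (coord i \o g) t != 0 &
              web_direction i (g t) (derive1 (coord i \o g) t)]].

(* phi : {|t| < r} x W -> U is a local flow of the vector field X on U. *)
Record local_flow (U : set S) (X : chart S -> S -> 'rV[C R]_d) (W : set S)
    (r : R) (phi : C R -> S -> S) : Prop := LocalFlow {
  flow_open : open W;
  flow_sub : W `<=` U;
  flow_init : forall s, W s -> phi 0 s = s;
  flow_stays : forall t s, `|t| < (r%:C)%C -> W s -> U (phi t s);
  flow_continuous : forall t s, `|t| < (r%:C)%C -> W s ->
    {for (t, s), continuous (fun p : C R * S => phi p.1 p.2)};
  flow_holomorphic : forall t s i j, `|t| < (r%:C)%C -> W s ->
    chart_dom i s -> chart_dom j (phi t s) ->
    differentiable
      (fun p : C R * 'rV[C R]_d => coord j (phi p.1 (point_of i p.2)))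
      (t, coord i s);
  flow_ode : forall t s j, `|t| < (r%:C)%C -> W s -> chart_dom j (phi t s) ->
    derive1 (fun t' => coord j (phi t' s)) t = X j (phi t s) }.

(* A holomorphic vector field has a local flow around each point, and any two
   of them agree where both are defined, so "the local flow maps leaves to
   leaves" is quantified over all local flows of X. *)
Definition web_symmetry (U : set S) (X : chart S -> S -> 'rV[C R]_d) : Prop :=
  forall W r phi, 0 < r -> local_flow U X W r phi ->
  forall D g, web_leaf D g -> g @` D `<=` W ->
  forall t, `|t| < (r%:C)%C -> web_leaf D (phi t \o g).

End Web.

(* Main.v *)
From HB Require Import structures.
Require Import Defs.
From mathcomp Require Import all_boot all_order all_algebra.
From mathcomp Require Import all_classical all_reals all_analysis.
From mathcomp Require Import complex.
From mathcomp Require Import ring lra.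
(** The symmetry is the shadow of the Euler field: X is the projection of E
    to TS along e, so that df(X) = E - h e for a function h on S.

    Why X is a symmetry.  The booklet web is unchanged when S is moved along
    e, because multiplication and metric are invariant under the flow of e,
    and the flow of E rescales multiplication and metric.  Infinitesimally:
    write k and k' for the two rescaling weights and B for the
    endomorphism w |-> D_w E - h D_w e.  Along an integral curve of X the
    multiplication, the metric, e and the variations Z = df(dphi_t v) all
    evolve by B up to constant multiples and up to multiples of e
    ([flow_mul], [flow_metric], [flow_unity], [variation_derive]); the
    invariance under e that enters here comes from the symmetry of nabla c
    ([lie_unity_mul]) and from the flatness of e.  Hence the following
    determinants are densities, with logarithmic derivative tr B + constant:
    det(e, Z, Z.Z), whose vanishing says that Z is a web direction
    ([web_cubicP]), and det(e, Z1, Z2), whose vanishing says that dphi_t is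
    not injective.  The Gram determinants of the metric and of the trace form
    tr(u.v), whose non-vanishing is semi-simplicity, have logarithmic
    derivatives constant - 2 tr B.  Multiplying out tr B against the Gram
    determinant of the metric, which never vanishes, leaves scalars that
    satisfy nu' = c nu with c constant.  Such a scalar vanishes at time t
    exactly if it vanishes at time 0 ([ode_zero]).  So the flow preserves
    regular points, immersed curves and web directions; at singular points
    nothing special happens, since X is holomorphic there as well.

    Why X is not identically zero.  If it were zero near a point, then
    E = h e along S, and differentiating this identity shows that B maps the
    tangent space of M into the line of e.  Invariance of the metric up to
    scale then forces e to be isotropic and orthogonal to everything, provided
    that [E, e] = - k e is non-zero ([euler_not_parallel]).

    Differentiating df(X) = E - h e in the direction of S uses that the
    derivative of a holomorphic map is holomorphic and that its second
    derivatives commute.  Holomorphic means complex differentiable on an open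
    set, so this is Cauchy's theory: Goursat's theorem for triangles gives
    f'(0) = (1 / 2 pi i) times the integral of (f(z) - f(0)) / z^2 over a
    diamond around 0 ([cauchy_funE]).  This presents f'(0) as a linear
    functional of f that is bounded in the supremum norm, and linearity and
    boundedness of that functional carry all estimates in several variables. *)

Import Order.TTheory GRing.Theory Num.Theory.
Import numFieldNormedType.Exports.
Local Open Scope classical_set_scope.
Local Open Scope ring_scope.

Set Implicit Arguments.
Unset Strict Implicit.
Unset Printing Implicit Defensive.

(** * Real-valued norms on complex normed spaces *)

Section Nrm.
Variable R : realType.
Local Notation K := (C R).

Definition toC (x : R) : K := (x%:C)%C.
(** The norm of a normed space over C R has values in C R, whose order is
    partial; its real part gives access to the totally ordered field of reals. *)
Definition nrm (V : normedModType K) (v : V) : R := complex.Re (`|v| : R[i]).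

Lemma toCD x y : toC (x + y) = toC x + toC y.
Proof. exact: (rmorphD (real_complex R)). Qed.
Lemma toCM x y : toC (x * y) = toC x * toC y.
Proof. exact: (rmorphM (real_complex R)). Qed.
Lemma toCN x : toC (- x) = - toC x.
Proof. exact: (rmorphN (real_complex R)). Qed.
Lemma toC0 : toC 0 = 0. Proof. by []. Qed.
Lemma toC1 : toC 1 = 1. Proof. by []. Qed.
Lemma toC_le x y : (toC x <= toC y) = (x <= y).
Proof. exact: lecR. Qed.
Lemma toC_lt x y : (toC x < toC y) = (x < y).
Proof. exact: ltcR. Qed.
Lemma toC_inj : injective toC.
Proof. by move=> x y []. Qed.

Lemma toC_pos (e : K) : 0 < e -> exists2 d : R, 0 < d & e = toC d.
Proof.
case: e => a b; rewrite ltcE /= => /andP[/eqP -> a0]; exists a => //.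
Qed.

Lemma nrmE (V : normedModType K) (v : V) : `|v| = toC (nrm v).
Proof.
rewrite /nrm /toC; have := normr_ge0 v; case: (`|v|) => a b.
by rewrite lecE /= => /andP[/eqP -> _].
Qed.

Lemma nrm_ge0 (V : normedModType K) (v : V) : 0 <= nrm v.
Proof. by rewrite -toC_le -nrmE toC0. Qed.
Lemma nrm_eq0 (V : normedModType K) (v : V) : (nrm v == 0) = (v == 0).
Proof.
by rewrite -(inj_eq toC_inj) -nrmE toC0 normr_eq0.
Qed.
Lemma nrm0 (V : normedModType K) : nrm (0 : V) = 0.
Proof. by apply/eqP; rewrite nrm_eq0. Qed.
Lemma nrmD (V : normedModType K) (v w : V) : nrm (v + w) <= nrm v + nrm w.
Proof. by rewrite -toC_le toCD -!nrmE ler_normD. Qed.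
Lemma nrmN (V : normedModType K) (v : V) : nrm (- v) = nrm v.
Proof. by apply: toC_inj; rewrite -!nrmE normrN. Qed.
Lemma nrmB (V : normedModType K) (v w : V) : nrm (v - w) = nrm (w - v).
Proof. by rewrite -opprB nrmN. Qed.
Lemma nrmZ (V : normedModType K) (a : K) (v : V) : nrm (a *: v) = nrm a * nrm v.
Proof. by apply: toC_inj; rewrite toCM -!nrmE normrZ. Qed.
Lemma nrmM (a b : K) : nrm (a * b) = nrm a * nrm b.
Proof. exact: (nrmZ a (b : K^o)). Qed.
Lemma nrmV (a : K) : nrm (a^-1) = (nrm a)^-1.
Proof.
have [->|a0] := eqVneq a 0; first by rewrite invr0 nrm0 invr0.
have na0 : nrm a != 0 by rewrite nrm_eq0.
apply: (mulfI na0); rewrite -nrmM divff // divff //.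
by apply: toC_inj; rewrite -nrmE normr1.
Qed.
Lemma nrm_toC x : nrm (toC x) = `|x|.
Proof. by apply: toC_inj; rewrite -nrmE [LHS]normc_def /= expr0n addr0 sqrtr_sqr. Qed.
Lemma nrm1 : nrm (1 : K) = 1.
Proof. by rewrite -toC1 nrm_toC normr1. Qed.

Lemma nrm_sub (V : normedModType K) (u v w : V) : nrm (u - w) <= nrm (u - v) + nrm (v - w).
Proof. by apply: le_trans (nrmD _ _); rewrite addrA subrK. Qed.

Lemma Re_le_nrm (z : K) : `|complex.Re z| <= nrm z.
Proof. by rewrite -toC_le -nrmE; exact: normc_ge_Re. Qed.

Lemma Im_le_nrm (z : K) : `|complex.Im z| <= nrm z.
Proof.
have -> : complex.Im z = complex.Re ((- 'i%C : K) * z).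
  by case: z => a b; rewrite /= ; ring.
apply: le_trans (Re_le_nrm _) _; rewrite nrmM nrmN.
suff -> : nrm ('i%C : K) = 1 by rewrite mul1r.
by apply: toC_inj; rewrite -nrmE [LHS]normc_def /= expr0n add0r expr1n sqrtr1.
Qed.

Lemma nrm_le_ReIm (z : K) : nrm z <= `|complex.Re z| + `|complex.Im z|.
Proof.
rewrite {1}(complexE (z : R[i])) -!/(toC _); apply: le_trans (nrmD _ _) _.
rewrite nrm_toC lerD2l nrmM nrm_toC.
suff -> : nrm ('i%C : K) = 1 by rewrite mul1r.
by apply: toC_inj; rewrite -nrmE [LHS]normc_def /= expr0n add0r expr1n sqrtr1.
Qed.

Lemma nbhs_nrm (V : normedModType K) (x : V) (P : set V) :
  nbhs x P <-> exists2 e : R, 0 < e & forall y, nrm (y - x) < e -> P y.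
Proof.
split.
  move=> /nbhs_ballP[e /= /toC_pos[d d0 ->] sub]; exists d => // y yx; apply: sub.
  by rewrite -ball_normE /= distrC nrmE toC_lt.
case=> d d0 sub; apply/nbhs_ballP; exists (toC d); first by rewrite /= -toC0 toC_lt.
move=> y; rewrite -ball_normE /= distrC nrmE toC_lt; exact: sub.
Qed.

Lemma continuous_nrm (V W : normedModType K) (f : V -> W) (x : V) :
  {for x, continuous f} <->
  forall e : R, 0 < e -> exists2 d : R, 0 < d &
    forall y, nrm (y - x) < d -> nrm (f y - f x) < e.
Proof.
split.
  move=> cf e e0.
  have : nbhs (f x) [set w | nrm (w - f x) < e] by apply/nbhs_nrm; exists e.
  by move=> /cf /nbhs_nrm[d d0 H]; exists d.
move=> H A /nbhs_nrm[e e0 sub]; have [d d0 Hd] := H e e0.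
by apply/nbhs_nrm; exists d => // y /Hd /sub.
Qed.

(** Division-free form of the difference quotient; it serves both real and
    complex functions. *)
Lemma is_derive_epsP (F : numFieldType) (f : F -> F) (x l : F) :
  is_derive x 1 f l <->
  forall e, 0 < e -> \forall h \near (0 : F), `|f (x + h) - f x - h * l| <= e * `|h|.
Proof.
have E : is_derive x 1 f l <-> (fun h => h^-1 *: ((f \o shift x) (h *: (1:F)) - f x)) @ 0^' --> l.
  split.
    move=> [df <-]; exact: df.
  move=> c; split; first by apply/cvg_ex; exists l.
  by apply/cvg_lim.
apply: (iff_trans E); split.
  move=> /cvgrPdist_le H e e0; have := H e e0; rewrite near_withinE.
  apply: filterS => h Hh.
  have [->|h0] := eqVneq h 0; first by rewrite addr0 subrr mul0r subrr !normr0 mulr0.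
  have := Hh h0; rewrite /= [h *: 1]mulr1 => /(ler_wpM2r (normr_ge0 h)).
  rewrite -normrM mulrBl distrC; apply: le_trans; rewrite [_ *: _]mulrC mulfVK //.
  by rewrite [h + x]addrC [l * h]mulrC.
move=> H; apply/cvgrPdist_le => e e0; rewrite near_withinE.
apply: filterS (H e e0) => h Hh h0.
rewrite /= [h *: 1]mulr1 distrC -(ler_pM2r (_ : 0 < `|h|)) ?normr_gt0 //.
rewrite -normrM mulrBl [_ *: _]mulrC mulfVK // [h + x]addrC [l * h]mulrC //.
Qed.

Lemma derive_nrmP (f : K -> K) (x l : K) :
  is_derive x 1 f l <->
  forall e : R, 0 < e -> exists2 d : R, 0 < d & forall y, nrm (y - x) < d ->
    nrm (f y - f x - (y - x) * l) <= e * nrm (y - x).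
Proof.
rewrite is_derive_epsP; split.
  move=> H e e0; have : 0 < toC e by rewrite -toC0 toC_lt.
  move=> /H /nbhs_nrm[d d0 Hd]; exists d => // y yx.
  have := Hd (y - x); rewrite subr0 => /(_ yx) /=.
  by rewrite [x + _]addrC subrK !nrmE -toCM toC_le.
move=> H e /toC_pos[d d0 ->]; have [c c0 Hc] := H d d0.
apply/nbhs_nrm; exists c => // h; rewrite subr0 => hc.
have := Hc (x + h); rewrite addrAC subrr add0r => /(_ hc).
by rewrite !nrmE -toCM toC_le.
Qed.

Lemma is_derive_realP (f : R -> R) (x l : R) :
  is_derive x 1 f l <->
  forall e : R, 0 < e -> exists2 d : R, 0 < d & forall y, `|y - x| < d ->
    `|f y - f x - (y - x) * l| <= e * `|y - x|.
Proof.
rewrite is_derive_epsP; split.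
  move=> H e /H /nbhs_ballP[d d0 Hd]; exists d => // y yx.
  have := Hd (y - x); rewrite /ball /= sub0r normrN [x + _]addrC subrK; exact.
move=> H e /H[c c0 Hc]; apply/nbhs_ballP; exists c => // h.
rewrite /ball /= sub0r normrN => hc.
by have := Hc (x + h); rewrite addrAC subrr add0r => /(_ hc).
Qed.

Lemma Re_lin (F G l b : K) (s : R) :
  complex.Re F - complex.Re G - s * complex.Re (l * b) =
  complex.Re (F - G - toC s * b * l).
Proof. by case: F G l b => [? ?] [? ?] [? ?] [? ?] /=; ring. Qed.

(** Restricting a complex differentiable function to a line turns complex
    derivatives into pairs of real ones, to which the mean value theorem
    applies. *)
Lemma derivable_Re (f : K -> K) (a b l : K) (t : R) :
  is_derive (a + toC t * b) 1 f l ->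
  is_derive t 1 (fun t : R => complex.Re (f (a + toC t * b))) (complex.Re (l * b)).
Proof.
move=> /derive_nrmP H; apply/is_derive_realP => e e0.
have nb : 0 < nrm b + 1 by have := nrm_ge0 b; lra.
have [d d0 Hd] := H (e / (nrm b + 1)) (divr_gt0 e0 nb).
exists (d / (nrm b + 1)); first exact: divr_gt0.
move=> s st.
have E : (a + toC s * b) - (a + toC t * b) = toC (s - t) * b.
  by rewrite toCD toCN; ring.
have Enr : nrm (toC (s - t) * b) = `|s - t| * nrm b by rewrite nrmM nrm_toC.
have lt1 : nrm (a + toC s * b - (a + toC t * b)) < d.
  rewrite E Enr; have := nrm_ge0 b; move: st; rewrite ltr_pdivlMr // => st nb0.
  have := normr_ge0 (s - t); nra.
have := Hd _ lt1; rewrite E Enr => H2.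
set F := f (a + toC s * b) in H2 *; set G := f _ in H2 *.
have -> : complex.Re F - complex.Re G - (s - t) * complex.Re (l * b) =
   complex.Re (F - G - toC (s - t) * b * l).
  exact: Re_lin.
apply: le_trans (Re_le_nrm _) _; apply: le_trans H2 _.
have -> : e / (nrm b + 1) * (`|s - t| * nrm b) =
   e * `|s - t| * (nrm b / (nrm b + 1)) by ring.
rewrite -[X in _ <= X]mulr1 ler_wpM2l ?mulr_ge0 ?normr_ge0 ?(ltW e0) //.
by rewrite ler_pdivrMr // mul1r lerDl.
Qed.

Lemma Im_Re (z : K) : complex.Im z = complex.Re ((- 'i%C : K) * z).
Proof. by case: z => a b; rewrite /= ; ring. Qed.

Lemma derivable_Im (f : K -> K) (a b l : K) (t : R) :
  is_derive (a + toC t * b) 1 f l ->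
  is_derive t 1 (fun t : R => complex.Im (f (a + toC t * b))) (complex.Im (l * b)).
Proof.
move=> H.
have H2 : is_derive (a + toC t * b) 1 (fun z => (- 'i%C : K) * f z) ((- 'i%C : K) * l).
  exact: is_deriveZ.
have := derivable_Re H2; rewrite Im_Re mulrA.
by under [X in is_derive _ _ X]eq_fun do rewrite -Im_Re.
Qed.
End Nrm.

(** * Integrals along segments of the complex plane *)

Section Seg.
Variable R : realType.
Local Notation K := (C R).
Local Notation toC := (@toC R).

Lemma mvt01 (F f : R -> R) : (forall t : R, 0 <= t <= 1 -> is_derive t 1 F (f t)) ->
  exists2 c, 0 <= c <= 1 & F 1 - F 0 = f c.
Proof.
move=> H; have [||c c01 ->] := @MVT_segment R F f 0 1 ler01.
- by move=> x; rewrite in_itv /= => /andP[? ?]; apply: H; rewrite !ltW.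
- apply: derivable_within_continuous => x; rewrite in_itv /= => /H [] //.
by exists c; [move: c01; rewrite in_itv | rewrite subr0 mulr1].
Qed.

(** The integral starts at -1 and runs inside [-1, 2], so that 0 and 1 are
    interior points where the fundamental theorem gives two-sided derivatives. *)
Lemma exists_primitive (g : R -> R) : continuous g ->
  exists G : R -> R, forall t : R, 0 <= t <= 1 -> is_derive t 1 G (g t).
Proof.
move=> cg.
exists (fun x => (\int[lebesgue_measure]_(t in [set` `[-1, x]]) (g t))%R) => x /andP[x0 x1].
have xu : x < 2 by lra.
have ax : -1 < x by lra.
have fi : lebesgue_measure.-integrable `[-1, 2] (EFin \o g).
  apply: continuous_compact_integrable; first exact: segment_compact.
  exact: continuous_subspaceT.
have [dG eG] := continuous_FTC1_closed xu fi ax (cg x).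
by apply: DeriveDef; [exact: dG | rewrite -derive1E; exact: eG].
Qed.

(** Derivative of a curve in C R with a real parameter, taken on real and
    imaginary parts because C R is not a normed module over R here. *)
Definition cder (G : R -> K) (t : R) (l : K) : Prop :=
  is_derive t 1 (fun s => complex.Re (G s)) (complex.Re l) /\
  is_derive t 1 (fun s => complex.Im (G s)) (complex.Im l).

Lemma cReD (a b : K) : complex.Re (a + b) = complex.Re a + complex.Re b.
Proof. by case: a b => ? ? [? ?]. Qed.
Lemma cImD (a b : K) : complex.Im (a + b) = complex.Im a + complex.Im b.
Proof. by case: a b => ? ? [? ?]. Qed.
Lemma cReM (a b : K) : complex.Re (a * b) =
  complex.Re a * complex.Re b - complex.Im a * complex.Im b.
Proof. by case: a b => ? ? [? ?]. Qed.
Lemma cImM (a b : K) : complex.Im (a * b) =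
  complex.Re a * complex.Im b + complex.Im a * complex.Re b.
Proof. by case: a b => ? ? [? ?]. Qed.

Lemma cderD G H t l m : cder G t l -> cder H t m ->
  cder (fun s => G s + H s) t (l + m).
Proof.
move=> [G1 G2] [H1 H2]; split.
  have -> : (fun s => complex.Re (G s + H s)) =
    (fun s => complex.Re (G s)) \+ (fun s => complex.Re (H s)).
    by apply/funext => s; rewrite cReD.
  by rewrite cReD; apply: is_deriveD.
have -> : (fun s => complex.Im (G s + H s)) =
  (fun s => complex.Im (G s)) \+ (fun s => complex.Im (H s)).
  by apply/funext => s; rewrite cImD.
by rewrite cImD; apply: is_deriveD.
Qed.

Lemma cderZ G t l (a : K) : cder G t l -> cder (fun s => a * G s) t (a * l).
Proof.
move=> [G1 G2]; split.
  have -> : (fun s => complex.Re (a * G s)) =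
    (fun s => complex.Re a *: complex.Re (G s)) \- (fun s => complex.Im a *: complex.Im (G s)).
    by apply/funext => s; rewrite cReM.
  by rewrite cReM; apply: is_deriveB.
have -> : (fun s => complex.Im (a * G s)) =
  (fun s => complex.Re a *: complex.Im (G s)) \+ (fun s => complex.Im a *: complex.Re (G s)).
  by apply/funext => s; rewrite cImM.
by rewrite cImM; apply: is_deriveD.
Qed.

Lemma is_derive_affine (a b t : R) : is_derive t 1 (fun s => a + b * s) b.
Proof.
have -> : (fun s => a + b * s) = cst a \+ (fun s => b *: s) by [].
by apply: is_derive_eq; rewrite add0r [LHS]mulr1.
Qed.

Lemma cder_affine G (a b t : R) l : cder G (a + b * t) l ->
  cder (fun s => G (a + b * s)) t (toC b * l).
Proof.
move=> [G1 G2]; split.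
  rewrite cReM /= mul0r subr0 mulrC.
  exact: (@is_derive1_comp R _ _ t _ _ G1 (is_derive_affine a b t)).
rewrite cImM /= mul0r addr0 mulrC.
exact: (@is_derive1_comp R _ _ t _ _ G2 (is_derive_affine a b t)).
Qed.

(** The mean value theorem holds for real and imaginary part separately,
    whence the factor 2. *)
Lemma cder_mvt_le (G : R -> K) (g : R -> K) (M : R) :
  (forall t : R, 0 <= t <= 1 -> cder G t (g t)) ->
  (forall t : R, 0 <= t <= 1 -> nrm (g t) <= M) -> nrm (G 1 - G 0) <= 2 * M.
Proof.
move=> dG gM; apply: le_trans (nrm_le_ReIm _) _.
have [c c01 Ec] := mvt01 (fun t ht => (dG t ht).1).
have [d d01 Ed] := mvt01 (fun t ht => (dG t ht).2).
have -> : complex.Re (G 1 - G 0) = complex.Re (G 1) - complex.Re (G 0).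
  by case: (G 1) (G 0) => ? ? [? ?].
have -> : complex.Im (G 1 - G 0) = complex.Im (G 1) - complex.Im (G 0).
  by case: (G 1) (G 0) => ? ? [? ?].
rewrite Ec Ed; have := le_trans (Re_le_nrm _) (gM _ c01).
have := le_trans (Im_le_nrm _) (gM _ d01); lra.
Qed.

(** G is a primitive of the integrand of f along the segment from a to b. *)
Definition sprim (f : K -> K) (a b : K) (G : R -> K) : Prop :=
  forall t : R, 0 <= t <= 1 -> cder G t ((b - a) * f (a + toC t * (b - a))).

(** The integral of f over the segment from a to b, as the increment of any
    primitive; it is well defined by [segE], and total so that no continuity
    proof has to be carried around. *)
Definition seg (f : K -> K) (a b : K) : K :=
  xget 0 [set z | exists G, sprim f a b G /\ z = G 1 - G 0].

Lemma nrm_eq0P (z : K) : nrm z <= 0 -> z = 0.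
Proof. by move=> H; apply/eqP; rewrite -nrm_eq0 eq_le H nrm_ge0. Qed.

Lemma segE f a b G : sprim f a b G -> seg f a b = G 1 - G 0.
Proof.
move=> H; rewrite /seg.
have : [set z | exists G, sprim f a b G /\ z = G 1 - G 0] (G 1 - G 0) by exists G.
move=> /(xgetI 0) /= [G' [H' ->]].
apply/eqP; rewrite -subr_eq0; apply/eqP/nrm_eq0P; apply: (@le_trans _ _ (2 * 0)); last by rewrite mulr0.
have -> : G' 1 - G' 0 - (G 1 - G 0) =
  (fun t => G' t + -1 * G t) 1 - (fun t => G' t + -1 * G t) 0 by ring.
apply: (@cder_mvt_le (fun t => G' t + -1 * G t) (fun t => (b - a) * f (a + toC t * (b - a)) +
   -1 * ((b - a) * f (a + toC t * (b - a)))) 0).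
  by move=> t t01; apply: cderD; [exact: H' | apply: cderZ; exact: H].
by move=> t _; rewrite mulN1r subrr nrm0.
Qed.

Definition on_seg (a b : K) (z : K) := exists2 t : R, 0 <= t <= 1 & z = a + toC t * (b - a).

Definition cont_on (P : K -> Prop) (f : K -> K) := forall z, P z -> {for z, continuous f}.

Lemma continuous_realP (f : R -> R) (x : R) :
  {for x, continuous f} <-> forall e : R, 0 < e -> exists2 d : R, 0 < d &
    forall y, `|y - x| < d -> `|f y - f x| < e.
Proof.
split.
  move=> cf e e0.
  have : nbhs (f x) [set w | `|w - f x| < e].
    by apply/nbhs_ballP; exists e => //= y; rewrite /ball /= distrC.
  move=> /cf /nbhs_ballP[d /= d0 H]; exists d => // y yx; apply: H.
  by rewrite /ball /= distrC.
move=> H A /nbhs_ballP[e /= e0 sub]; have [d d0 Hd] := H e e0.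
apply/nbhs_ballP; exists d => // y; rewrite /ball /= distrC => /Hd h.
by apply: sub; rewrite /ball /= distrC.
Qed.

(** The integrand is extended continuously from [0, 1] to the whole line, by
    clamping the parameter, so that it has a primitive with two-sided
    derivatives at the end points. *)
Lemma exists_sprim f a b : cont_on (on_seg a b) f -> exists G, sprim f a b G.
Proof.
move=> cf.
pose cl (t : R) := if t < 0 then 0 else if 1 < t then 1 else t.
have cl01 t : 0 <= cl t <= 1 by rewrite /cl; case: (ltP t 0); case: (ltP 1 t); lra.
have clid t : 0 <= t <= 1 -> cl t = t.
  by rewrite /cl; case: (ltP t 0); case: (ltP 1 t); lra.
have cllip s t : `|cl s - cl t| <= `|s - t|.
  have : cl s - cl t <= `|s - t|.
    have := ler_norm (s - t); have := normr_ge0 (s - t).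
    rewrite /cl; move: (`|s - t|) => w.
    by case: (ltP t 0) => ?; case: (ltP 1 t) => ?; case: (ltP s 0) => ?; case: (ltP 1 s) => ? ? ?; lra.
  have : cl t - cl s <= `|s - t|.
    have := ler_norm (t - s); rewrite distrC; have := normr_ge0 (s - t).
    rewrite /cl; move: (`|s - t|) => w.
    by case: (ltP t 0) => ?; case: (ltP 1 t) => ?; case: (ltP s 0) => ?; case: (ltP 1 s) => ? ? ?; lra.
  by rewrite ler_norml; lra.
pose h t := (b - a) * f (a + toC (cl t) * (b - a)).
have ch e t : 0 < e -> exists2 d : R, 0 < d & forall s, `|s - t| < d -> nrm (h s - h t) < e.
  move=> e0; have nb : 0 < nrm (b - a) + 1 by have := nrm_ge0 (b - a); lra.
  have /continuous_nrm cft : {for a + toC (cl t) * (b - a), continuous f}.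
    by apply: cf; exists (cl t).
  have [d d0 Hd] := cft _ (divr_gt0 e0 nb).
  exists (d / (nrm (b - a) + 1)); first exact: divr_gt0.
  move=> s st; rewrite /h -mulrBr nrmM.
  have : nrm (f (a + toC (cl s) * (b - a)) - f (a + toC (cl t) * (b - a))) < e / (nrm (b - a) + 1).
    apply: Hd; have -> : a + toC (cl s) * (b - a) - (a + toC (cl t) * (b - a)) =
      toC (cl s - cl t) * (b - a) by rewrite toCD toCN; ring.
    rewrite nrmM nrm_toC; move: st; rewrite ltr_pdivlMr //.
    have := cllip s t; have := nrm_ge0 (b - a); have := normr_ge0 (cl s - cl t).
    nra.
  rewrite ltr_pdivlMr // mulrC; have := nrm_ge0 (b - a).
  set u := nrm (b - a); set v := nrm _ => u0 uv.
  have : 0 <= v by exact: nrm_ge0.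
  nra.
have [|Gr HGr] := exists_primitive (g := fun t => complex.Re (h t)).
  move=> t; apply/continuous_realP => e e0; have [d d0 Hd] := ch e t e0.
  exists d => // s /Hd; apply: le_lt_trans.
  by apply: le_trans (Re_le_nrm _); case: (h s) (h t) => ? ? [? ?].
have [|Gi HGi] := exists_primitive (g := fun t => complex.Im (h t)).
  move=> t; apply/continuous_realP => e e0; have [d d0 Hd] := ch e t e0.
  exists d => // s /Hd; apply: le_lt_trans.
  by apply: le_trans (Im_le_nrm _); case: (h s) (h t) => ? ? [? ?].
exists (fun t => (Gr t +i* Gi t)%C) => t t01; rewrite -{2}(clid t t01).
by split; [exact: HGr | exact: HGi].
Qed.

Lemma seg_lin f g (l : K) a b : cont_on (on_seg a b) f -> cont_on (on_seg a b) g ->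
  seg (fun z => f z + l * g z) a b = seg f a b + l * seg g a b.
Proof.
move=> /exists_sprim[F HF] /exists_sprim[G HG].
rewrite (segE HF) (segE HG) (segE (G := fun t => F t + l * G t)); first by ring.
move=> t t01; have -> : (b - a) * (f (a + toC t * (b - a)) + l * g (a + toC t * (b - a)))
  = (b - a) * f (a + toC t * (b - a)) + l * ((b - a) * g (a + toC t * (b - a))) by ring.
by apply: cderD; [exact: HF | apply: cderZ; exact: HG].
Qed.

Lemma eq_seg f g a b : (forall z, on_seg a b z -> f z = g z) -> seg f a b = seg g a b.
Proof.
move=> fg; rewrite /seg; congr (xget 0 _); apply/seteqP; split => z [G [H ->]];
  by exists G; split => // t t01; have := H t t01; rewrite fg //; exists t.
Qed.

Lemma seg_le f a b M : cont_on (on_seg a b) f ->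
  (forall z, on_seg a b z -> nrm (f z) <= M) -> nrm (seg f a b) <= 2 * (nrm (b - a) * M).
Proof.
move=> /exists_sprim[G HG] fM; rewrite (segE HG); apply: cder_mvt_le HG _ => t t01.
by rewrite nrmM ler_wpM2l ?nrm_ge0 // fM //; exists t.
Qed.

Lemma seg_rev f a b : cont_on (on_seg a b) f -> seg f b a = - seg f a b.
Proof.
move=> /exists_sprim[G HG]; rewrite (segE HG) (segE (G := fun t => G (1 + -1 * t))).
  by rewrite mulr1 mulr0 addr0 subrr opprB.
move=> t t01; have := HG (1 + -1 * t); move=> /(_ ltac:(lra)) /cder_affine.
rewrite toCD toCM toCN toC1.
have -> : a + (1 + -1 * toC t) * (b - a) = b + toC t * (a - b) by ring.
by rewrite mulrA mulN1r opprB.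
Qed.

Lemma seg_split f a b (l : R) : 0 <= l <= 1 -> cont_on (on_seg a b) f ->
  seg f a b = seg f a (a + toC l * (b - a)) + seg f (a + toC l * (b - a)) b.
Proof.
move=> l01 /exists_sprim[G HG]; rewrite (segE HG).
rewrite (segE (G := fun t => G (0 + l * t))); last first.
  move=> t t01; have := HG (0 + l * t); move=> /(_ ltac:(nra)) /cder_affine.
  rewrite toCD toCM toC0.
  have -> : a + (0 + toC l * toC t) * (b - a) = a + toC t * (a + toC l * (b - a) - a) by ring.
  by have -> : forall F, toC l * ((b - a) * F) = (a + toC l * (b - a) - a) * F by move=> F; ring.
rewrite (segE (G := fun t => G (l + (1 - l) * t))); last first.
  move=> t t01; have := HG (l + (1 - l) * t); move=> /(_ ltac:(nra)) /cder_affine.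
  rewrite !(toCD, toCM, toCN, toC1).
  have -> : a + (toC l + (1 - toC l) * toC t) * (b - a) =
     a + toC l * (b - a) + toC t * (b - (a + toC l * (b - a))) by ring.
  by have -> : forall F, (1 - toC l) * ((b - a) * F) = (b - (a + toC l * (b - a))) * F by move=> F; ring.
rewrite !add0r !mulr1 !mulr0 !addr0 (addrC l) subrK; ring.
Qed.

Lemma seg_scale f (m : K) a b :
  seg (fun z => f (m * z)) a b * m = seg f (m * a) (m * b).
Proof.
have [->|m0] := eqVneq m 0.
  rewrite !mul0r mulr0 (segE (G := fun=> 0)) ?subrr // => t t01.
  by rewrite subrr mul0r; split; exact: is_derive_cst.
have E G : sprim f (m * a) (m * b) G <-> sprim (fun z => f (m * z)) a b (fun t => m^-1 * G t).
  split=> H t t01; have := H t t01.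
    move=> /(cderZ (m^-1)); have -> : m^-1 * ((m * b - m * a) * f (m * a + toC t * (m * b - m * a)))
      = (m^-1 * m) * ((b - a) * f (m * (a + toC t * (b - a)))).
      (have -> : m * a + toC t * (m * b - m * a) = m * (a + toC t * (b - a)) by ring); ring.
    by rewrite mulVf // mul1r.
  move=> /(cderZ m).
  under [X in cder X]eq_fun do rewrite mulrA divff // mul1r.
  have -> // : m * ((b - a) * f (m * (a + toC t * (b - a)))) =
   (m * b - m * a) * f (m * a + toC t * (m * b - m * a)).
  (have -> : m * a + toC t * (m * b - m * a) = m * (a + toC t * (b - a)) by ring); ring.
have [[G HG]|no] := pselect (exists G, sprim f (m * a) (m * b) G).
  rewrite (segE HG) (segE ((E G).1 HG)).
  by rewrite -mulrBr mulrAC mulVf // mul1r.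
rewrite /seg !xgetPN ?mul0r //.
  by move=> z [G [H _]]; apply: no; exists G.
move=> z [G [H _]]; apply: no; exists (fun t => m * G t); apply/E.
by under [X in sprim _ _ _ X]eq_fun do rewrite mulrA mulVf // mul1r.
Qed.

(** Affine functions integrate explicitly; in a closed triangle their
    contributions cancel, which is what Goursat's argument needs. *)
Lemma seg_affine (u v : K) a b : seg (fun z => u + v * z) a b =
  (b - a) * u + v * (b ^+ 2 - a ^+ 2) / 2.
Proof.
pose G (t : R) := (u * (b - a) + v * a * (b - a)) * toC t +
   (v * (b - a) ^+ 2 / 2) * (toC t * toC t) : K.
rewrite (segE (G := G)).
  have h : (2 : K) != 0 by rewrite pnatr_eq0.
  by rewrite /G toC0 toC1; field.
move=> t t01; rewrite /G.
have -> : (b - a) * (u + v * (a + toC t * (b - a))) =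
   (u * (b - a) + v * a * (b - a)) * 1 + (v * (b - a) ^+ 2 / 2) * (2 * toC t).
  move: (toC t) => x.
  have h : (2 : K) != 0 by rewrite pnatr_eq0.
  rewrite mulr1 (mulrA _ 2 x) mulfVK //; ring.
apply: cderD; apply: cderZ; split => /=.
- exact: is_derive_id.
- exact: is_derive_cst.
- have -> : (fun s : R => s * s - 0 * 0) = (fun s => s * s).
    by apply/funext => s; rewrite mulr0 subr0.
  apply: is_derive_eq; rewrite /GRing.scale /=; ring.
- have -> : (fun s : R => s * 0 + 0 * s) = cst 0.
    by apply/funext => s /=; ring.
  by apply: is_derive_eq; rewrite /=; ring.
Qed.
End Seg.

(** * Goursat's theorem for triangles *)

Section Goursat.
Variable R : realType.
Local Notation K := (C R).
Local Notation toC := (@toC R).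

(** The intervals [x n - 2 L / 2^n, x n + 2 L / 2^n] are nested; their left
    ends have a supremum. *)
Lemma geometric_limR (x : nat -> R) (L : R) :
  (forall n, `|x n.+1 - x n| <= L / 2 ^+ n) ->
  exists l, forall n, `|x n - l| <= 2 * L / 2 ^+ n.
Proof.
move=> H.
have p2 n : 0 < (2 : R) ^+ n by rewrite exprn_gt0.
have half n : L / 2 ^+ n.+1 = L / 2 ^+ n / 2.
  by rewrite exprS invfM [2^-1 * _]mulrC mulrA.
pose u n := x n - 2 * (L / 2 ^+ n); pose v n := x n + 2 * (L / 2 ^+ n).
have uS n : u n <= u n.+1.
  by rewrite /u half; have := H n; rewrite ler_norml => /andP[? ?]; lra.
have vS n : v n.+1 <= v n.
  by rewrite /v half; have := H n; rewrite ler_norml => /andP[? ?]; lra.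
have um m n : (m <= n)%N -> u m <= u n.
  by move=> /subnK <-; elim: (n - m)%N => // k; rewrite addSn => /le_trans; apply.
have vm m n : (m <= n)%N -> v n <= v m.
  by move=> /subnK <-; elim: (n - m)%N => // k IH; rewrite addSn; apply: le_trans IH.
have uv m n : u m <= v n.
  apply: le_trans (um m (maxn m n) (leq_maxl _ _)) _.
  apply: le_trans (vm n (maxn m n) (leq_maxr _ _)).
  rewrite /u /v; have := le_trans (normr_ge0 _) (H (maxn m n)).
  lra.
have su : has_sup (range u).
  split; first by exists (u 0%N), 0%N.
  by exists (v 0%N) => _ [n _ <-].
exists (sup (range u)) => n.
have h1 : u n <= sup (range u) by apply: ub_le_sup; [case: su | exists n].
have h2 : sup (range u) <= v n.
  by apply: ge_sup; [case: su | move=> _ [m _ <-]].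
by rewrite ler_norml -mulrA; move: h1 h2; rewrite /u /v; lra.
Qed.

Lemma geometric_lim (x : nat -> K) (L : R) :
  (forall n, nrm (x n.+1 - x n) <= L / 2 ^+ n) ->
  exists l, forall n, nrm (x n - l) <= 4 * L / 2 ^+ n.
Proof.
move=> H.
have ReB (a b : K) : complex.Re (a - b) = complex.Re a - complex.Re b.
  by case: a b => ? ? [? ?].
have ImB (a b : K) : complex.Im (a - b) = complex.Im a - complex.Im b.
  by case: a b => ? ? [? ?].
have [|a Ha] := @geometric_limR (fun n => complex.Re (x n)) L.
  by move=> n; rewrite -ReB; apply: le_trans (Re_le_nrm _) (H n).
have [|b Hb] := @geometric_limR (fun n => complex.Im (x n)) L.
  by move=> n; rewrite -ImB; apply: le_trans (Im_le_nrm _) (H n).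
exists (a +i* b)%C => n; apply: le_trans (nrm_le_ReIm _) _.
rewrite ReB ImB /=; have := Ha n; have := Hb n; lra.
Qed.

Definition tri (f : K -> K) a b c := seg f a b + seg f b c + seg f c a.
Definition mid (a b : K) : K := a + toC (1/2) * (b - a).
Definition perim (a b c : K) := nrm (b - a) + nrm (c - b) + nrm (a - c).

Definition seg_convex (D : set K) := forall a b, D a -> D b -> forall z, on_seg a b z -> D z.

Lemma half01 : 0 <= (1/2 : R) <= 1. Proof. lra. Qed.

Lemma toC_half : toC (1/2) = (2 : K)^-1.
Proof.
have h : (2 : K) != 0 by rewrite pnatr_eq0.
apply: (mulIf h); rewrite mulVf //.
have -> : (2 : K) = toC 2 by rewrite [RHS](toCD 1 1).
by rewrite -toCM -toC1; congr toC; lra.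
Qed.

Lemma midC a b : mid a b = mid b a.
Proof.
have h : (2 : K) != 0 by rewrite pnatr_eq0.
by rewrite /mid toC_half; field.
Qed.

Lemma mid_sub a b : mid a b - a = toC (1/2) * (b - a).
Proof. by rewrite /mid addrAC subrr add0r. Qed.

Lemma mid_midB a b c : mid a c - mid a b = toC (1/2) * (c - b).
Proof. by rewrite /mid; ring. Qed.

Lemma on_segE (a b : K) (t : R) : 0 <= t <= 1 -> on_seg a b (a + toC t * (b - a)).
Proof. by exists t. Qed.

Lemma seg_mid f a b : cont_on (on_seg a b) f -> seg f a b = seg f a (mid a b) + seg f (mid a b) b.
Proof. by move=> cf; rewrite (seg_split half01). Qed.

Section Subdivision.
Variables (D : set K) (f : K -> K).
Hypotheses (Dc : seg_convex D) (cf : cont_on D f).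

Lemma cont_on_seg a b : D a -> D b -> cont_on (on_seg a b) f.
Proof. by move=> Da Db z /(Dc Da Db) /cf. Qed.

Lemma mid_in a b : D a -> D b -> D (mid a b).
Proof. by move=> Da Db; apply: Dc Da Db _ (on_segE _ _ half01). Qed.

Lemma tri_subdiv a b c : D a -> D b -> D c ->
  tri f a b c = tri f a (mid a b) (mid a c) + tri f (mid b a) b (mid b c) +
    tri f (mid c a) (mid c b) c + tri f (mid a b) (mid b c) (mid c a).
Proof.
move=> Da Db Dc'.
have cs u v : D u -> D v -> cont_on (on_seg u v) f by exact: cont_on_seg.
have Dab := mid_in Da Db; have Dbc := mid_in Db Dc'; have Dca := mid_in Dc' Da.
rewrite /tri (seg_mid (cs _ _ Da Db)) (seg_mid (cs _ _ Db Dc')) (seg_mid (cs _ _ Dc' Da)).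
rewrite (midC b a) (midC c b) (midC a c).
rewrite (seg_rev (cs _ _ Dab Dbc)) (seg_rev (cs _ _ Dab Dca)) (seg_rev (cs _ _ Dbc Dca)).
by ring.
Qed.
End Subdivision.

Section Descent.
Variables (D : set K) (f : K -> K).
Hypotheses (Dc : seg_convex D) (cf : cont_on D f).

Definition corners : Type := (K * K * K)%type.
Definition triT (p : corners) := tri f p.1.1 p.1.2 p.2.
Definition perimT (p : corners) := perim p.1.1 p.1.2 p.2.
Definition inD (p : corners) := [/\ D p.1.1, D p.1.2 & D p.2].

(** By the triangle inequality one of the four half-size triangles carries at
    least a quarter of the integral. The third estimate controls the first
    corner, whose iterates converge. *)
Lemma descent_step (p : corners) : inD p -> exists q : corners,
  [/\ inD q, perimT q = perimT p / 2, nrm (q.1.1 - p.1.1) <= perimT p &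
     nrm (triT p) <= 4 * nrm (triT q)].
Proof.
case: p => [[a b] c] [/= Da Db Dc']; rewrite /triT /= (tri_subdiv Dc cf Da Db Dc').
have Dm u v : D u -> D v -> D (mid u v) by exact: mid_in.
have nh (z : K) : nrm (toC (1/2) * z) = nrm z / 2.
  by rewrite nrmM nrm_toC ger0_norm ?divr_ge0 // mul1r mulrC.
have n2 (z : K) (u v : K) : nrm (mid z u - mid z v) = nrm (u - v) / 2.
  by rewrite (mid_midB z v u) (nh (u - v)).
have nab := nrm_ge0 (b - a); have nbc := nrm_ge0 (c - b); have nca := nrm_ge0 (a - c).
set t1 := tri f a _ _; set t2 := tri f _ b _; set t3 := tri f _ _ c.
set t4 := tri f _ _ _.
have [h1|h1] := lerP (nrm (t1 + t2 + t3 + t4)) (4 * nrm t1).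
  exists (a, mid a b, mid a c); split => //=; first by split => //; apply: Dm.
  - rewrite /perimT /perim /= mid_sub n2 nh [nrm (a - mid a c)]nrmB mid_sub nh.
    rewrite [nrm (c - a)]nrmB; lra.
  - by rewrite subrr nrm0 /perimT /perim /=; lra.
have [h2|h2] := lerP (nrm (t1 + t2 + t3 + t4)) (4 * nrm t2).
  exists (mid b a, b, mid b c); split => //=; first by split => //; apply: Dm.
  - rewrite /perimT /perim /= mid_sub n2 nh nrmB mid_sub nh nrmB [nrm (a - c)]nrmB; lra.
  - by rewrite midC mid_sub nh /perimT /perim /=; lra.
have [h3|h3] := lerP (nrm (t1 + t2 + t3 + t4)) (4 * nrm t3).
  exists (mid c a, mid c b, c); split => //=; first by split => //; apply: Dm.
  - rewrite /perimT /perim /= mid_sub n2 nh [nrm (c - _)]nrmB mid_sub nh.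
    rewrite [nrm (b - c)]nrmB [nrm (b - a)]nrmB; lra.
  - by rewrite midC mid_sub nh /perimT /perim /= nrmB; lra.
exists (mid a b, mid b c, mid c a); split => //=; first by split => //; apply: Dm.
- have e1 : nrm (mid b c - mid a b) = nrm (a - c) / 2 by rewrite (midC a b) n2 nrmB.
  have e2 : nrm (mid c a - mid b c) = nrm (b - a) / 2 by rewrite (midC b c) n2 nrmB.
  have e3 : nrm (mid a b - mid c a) = nrm (c - b) / 2 by rewrite (midC c a) n2 nrmB.
  by rewrite /perimT /perim /= e1 e2 e3; lra.
- by rewrite mid_sub nh /perimT /perim /=; lra.
have := nrmD (t1 + t2 + t3) t4; have := nrmD (t1 + t2) t3; have := nrmD t1 t2; lra.
Qed.
End Descent.

Lemma derive_cont (f : K -> K) (z l : K) : is_derive z 1 f l -> {for z, continuous f}.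
Proof. by case=> /derivable1_diffP /differentiable_continuous. Qed.

Lemma cont_sub_affine (f : K -> K) (P : K -> Prop) (u v : K) : cont_on P f ->
  cont_on P (fun z => f z - (u + v * z)).
Proof.
move=> cf z Pz; apply: continuousB; first exact: cf.
apply: continuousD; first exact: cst_continuous.
by apply: continuousM; [exact: cst_continuous | move=> A; exact].
Qed.

Lemma cont_affine (P : K -> Prop) (u v : K) : cont_on P (fun z => u + v * z).
Proof.
move=> z Pz; apply: continuousD; first exact: cst_continuous.
by apply: continuousM; [exact: cst_continuous | move=> A; exact].
Qed.

Lemma on_seg_dist (a b z w : K) r : on_seg a b z -> nrm (a - w) <= r ->
  nrm (z - w) <= nrm (b - a) + r.
Proof.
move=> [t t01 ->] h; apply: le_trans (nrm_sub _ a _) _; rewrite addrAC subrr add0r.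
rewrite nrmM nrm_toC ger0_norm ?(andP t01).1 //; have := nrm_ge0 (b - a).
have /andP[? ?] := t01; nra.
Qed.

(** Repeated subdivision shrinks to a point z of D while the integral over the
    n-th triangle stays above 4^-n times the original one. Near z, f differs
    from an affine function by a small multiple of the distance, and affine
    functions do not contribute; the integral over the n-th triangle is thus a
    small multiple of 4^-n. *)
Lemma goursat (D : set K) (f f' : K -> K) : closed D -> seg_convex D ->
  (forall z : K, D z -> is_derive z 1 f (f' z)) ->
  forall a b c, D a -> D b -> D c -> tri f a b c = 0.
Proof.
move=> cD Dc df a b c Da Db Dc'.
have cf : cont_on D f by move=> z /df /derive_cont.
pose P (p q : corners) := inD D p ->
  [/\ inD D q, perimT q = perimT p / 2, nrm (q.1.1 - p.1.1) <= perimT p &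
     nrm (triT f p) <= 4 * nrm (triT f q)].
have [step Hstep] : {step : corners -> corners & forall p, P p (step p)}.
  apply: (@choice _ _ P) => p; have [h|h] := pselect (inD D p).
    by have [q Hq] := descent_step Dc cf h; exists q.
  by exists p.
pose s n := iter n step ((a, b), c).
pose L := perim a b c.
have Ds n : inD D (s n) by elim: n => [|n IH] //=; case: (Hstep _ IH).
have p2 n : 0 < (2 : R) ^+ n by rewrite exprn_gt0.
have Ps n : perimT (s n) = L / 2 ^+ n.
  elim: n => [|n IH]; first by rewrite expr0 divr1.
  have [_ /= -> _ _] := Hstep _ (Ds n).
  by rewrite -/(s n) IH exprS invfM [2^-1 * _]mulrC mulrA.
have Ts n : nrm (tri f a b c) <= 4 ^+ n * nrm (triT f (s n)).
  elim: n => [|n IH]; first by rewrite expr0 mul1r.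
  apply: le_trans IH _; have [_ _ _ h] := Hstep _ (Ds n).
  have -> : 4 ^+ n.+1 * nrm (triT f (s n.+1)) = 4 ^+ n * (4 * nrm (triT f (s n.+1))).
    by rewrite exprS; ring.
  by rewrite ler_wpM2l ?exprn_ge0.
have [|z Hz] := @geometric_lim (fun n => (s n).1.1) L.
  by move=> n; rewrite -Ps; have [_ _ h _] := Hstep _ (Ds n).
have L0 : 0 <= L by rewrite /L /perim !addr_ge0 ?nrm_ge0.
have small (e : R) : 0 < e -> exists n, L / 2 ^+ n < e.
  move=> e0; have [n Hn] : exists n : nat, L / e < n%:R.
    by exists (Num.bound (L / e)); apply: le_lt_trans (archi_boundP _); rewrite ?divr_ge0 ?(ltW e0).
  exists n; rewrite ltr_pdivrMr //; move: Hn; rewrite ltr_pdivrMr // => /lt_le_trans; apply.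
  rewrite mulrC ler_wpM2l ?(ltW e0) // -natrX ler_nat ltnW // ltn_expl //.
have Dz : D z.
  apply: cD => A /nbhs_nrm[e e0 sub].
  have [n Hn] := small (e / 4) (divr_gt0 e0 (ltr0Sn _ 3)).
  exists (s n).1.1; split; first by case: (Ds n).
  by apply: sub; apply: le_lt_trans (Hz n) _; lra.
apply: nrm_eq0P; apply/ler_addgt0Pr => e e0; rewrite add0r.
(* The bound obtained at the end is 12 e' L^2; the added 1 covers L = 0. *)
have e1 : 0 < e / (24 * L ^+ 2 + 1) by rewrite divr_gt0 //; nra.
have /derive_nrmP/(_ _ e1)[d d0 Hd] := df z Dz.
have [n Hn] := small (d / 6) (divr_gt0 d0 (ltr0Sn _ 5)).
set e' := e / _ in e1 Hd.
apply: le_trans (Ts n) _.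
pose u := f z - z * f' z; pose r (w : K) := f w - (u + f' z * w).
pose P' := L / 2 ^+ n.
have P'0 : 0 <= P' by rewrite divr_ge0 ?(ltW (p2 _)).
have [Dan Dbn Dcn] := Ds n.
have := Ps n; rewrite /perimT /perim -/P' => Pn.
have hz := Hz n; rewrite -mulrA -/P' in hz.
rewrite /triT; set an := (s n).1.1 in Dan Pn hz *; set bn := (s n).1.2 in Dbn Pn *.
set cn := (s n).2 in Dcn Pn *.
have nab := nrm_ge0 (bn - an); have nbc := nrm_ge0 (cn - bn); have nca := nrm_ge0 (an - cn).
have cs x y : D x -> D y -> cont_on (on_seg x y) f by apply: cont_on_seg.
have cr x y : D x -> D y -> cont_on (on_seg x y) r by move=> Dx Dy; apply/cont_sub_affine/cs.
have ER x y : D x -> D y -> seg f x y = seg r x y + ((y - x) * u + f' z * (y ^+ 2 - x ^+ 2) / 2).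
  move=> Dx Dy; rewrite -seg_affine -[seg (fun _ => _ + _) _ _]mul1r.
  rewrite -seg_lin; [|exact: cr|exact: cont_affine].
  by apply: eq_seg => w _; rewrite /r mul1r subrK.
have -> : tri f an bn cn = tri r an bn cn.
  rewrite /tri !ER //; set x1 := seg r _ _; set x2 := seg r _ _; set x3 := seg r _ _.
  have h : (2 : K) != 0 by rewrite pnatr_eq0.
  by field.
have rsmall w : nrm (w - z) <= 6 * P' -> nrm (r w) <= e' * (6 * P').
  move=> hw; have /Hd : nrm (w - z) < d by apply: le_lt_trans hw _; rewrite /P'; lra.
  have -> : f w - f z - (w - z) * f' z = r w by rewrite /r /u; ring.
  by move=> /le_trans; apply; rewrite ler_wpM2l // ltW.
have nb : nrm (bn - z) <= 5 * P'.
  apply: le_trans (nrm_sub _ an _) _; lra.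
have nc : nrm (cn - z) <= 5 * P'.
  apply: le_trans (nrm_sub _ an _) _; rewrite nrmB; lra.
have S x y : D x -> D y -> nrm (x - z) <= 5 * P' -> nrm (y - x) <= P' ->
   nrm (seg r x y) <= 2 * (nrm (y - x) * (e' * (6 * P'))).
  move=> Dx Dy hx hy; apply: seg_le; first exact: cr.
  by move=> w hw; apply: rsmall; apply: le_trans (on_seg_dist hw hx) _; lra.
have Tle : nrm (tri r an bn cn) <= 12 * e' * P' ^+ 2.
  have S1 := S an bn Dan Dbn ltac:(lra) ltac:(lra).
  have S2 := S bn cn Dbn Dcn nb ltac:(lra).
  have S3 := S cn an Dcn Dan nc ltac:(lra).
  apply: le_trans (nrmD _ _) _; apply: le_trans (lerD (nrmD _ _) (lexx _)) _.
  apply: le_trans (lerD (lerD S1 S2) S3) _.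
  have -> : 12 * e' * P' ^+ 2 = 12 * e' * P' * P' by ring.
  rewrite -[X in _ <= _ * X]Pn; lra.
apply: le_trans (ler_wpM2l (exprn_ge0 _ _) Tle) _ => //.
have -> : 4 ^+ n * (12 * e' * P' ^+ 2) = 12 * e' * L ^+ 2.
  rewrite /P'; have -> : (4 : R) ^+ n = 2 ^+ n * 2 ^+ n by rewrite -exprMn; congr (_ ^+ _); lra.
  by have := gt_eqF (p2 n); move: (2 ^+ n) => x /negbT x0; field.
have -> : 12 * e' * L ^+ 2 = e * (12 * L ^+ 2 / (24 * L ^+ 2 + 1)) by rewrite /e'; ring.
rewrite ler_piMr ?(ltW e0) // ler_pdivrMr; nra.
Qed.
End Goursat.

(** * Integrals over a diamond around the origin *)

Section CauchyFunctional.
Variable R : realType.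
Local Notation K := (C R).
Local Notation toC := (@toC R).
Local Notation "''j'" := ('i%C : K).

Definition unit_disc : set K := [set z | nrm z <= 1].
Definition punctured_disc : set K := [set z | nrm z <= 1 /\ z != 0].

Lemma nrm_j : nrm 'j = 1.
Proof. by apply: toC_inj; rewrite -nrmE [LHS]normc_def /= expr0n add0r expr1n sqrtr1. Qed.

(** For s = (+-1, +-1), the linear functional that equals 1 on one side of the
    diamond |Re z| + |Im z| = 1. *)
Definition side (s : R * R) (z : K) : R := s.1 * complex.Re z + s.2 * complex.Im z.

Lemma sideD s z w : side s (z + w) = side s z + side s w.
Proof. by rewrite /side cReD cImD; ring. Qed.
Lemma sideZ s (t : R) z : side s (toC t * z) = t * side s z.
Proof. by rewrite /side cReM cImM /=; ring. Qed.
Lemma sideN s z : side s (- z) = - side s z.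
Proof. by case: z => a b; rewrite /side /=; ring. Qed.

Definition sign_pair (s : R * R) := (s.1 = 1 \/ s.1 = -1) /\ (s.2 = 1 \/ s.2 = -1).

Lemma side_le s z : sign_pair s -> `|side s z| <= 2 * nrm z.
Proof.
have := Re_le_nrm z; have := Im_le_nrm z; rewrite /side !ler_norml => /andP[? ?] /andP[? ?].
by case=> [[->|->] [->|->]]; lra.
Qed.

Lemma nrm_segment (a b : K) t : 0 <= t <= 1 -> nrm (a + toC t * (b - a)) <= (1 - t) * nrm a + t * nrm b.
Proof.
move=> /andP[t0 t1]; have -> : a + toC t * (b - a) = toC (1 - t) * a + toC t * b.
  by rewrite toCD toCN toC1; ring.
by apply: le_trans (nrmD _ _) _; rewrite !nrmM !nrm_toC !ger0_norm //; lra.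
Qed.

(** A convex closed piece of the disc; for l > 0 it avoids 0, and hence lies
    in the domain of functions with a singularity at 0. *)
Definition cap s (l : R) : set K := [set z | nrm z <= 1 /\ l <= side s z].

Lemma cap_convex s l : seg_convex (cap s l).
Proof.
move=> a b [a1 al] [b1 bl] _ [t t01 ->]; split.
  apply: le_trans (nrm_segment _ _ t01) _; have /andP[? ?] := t01; nra.
by rewrite sideD sideZ sideD sideN; have /andP[? ?] := t01; nra.
Qed.

Lemma cap_closed s l : sign_pair s -> closed (cap s l).
Proof.
move=> ss z cz.
have H (e : R) : 0 < e -> exists2 w, cap s l w & nrm (w - z) < e.
  move=> e0; have [|w [Dw we]] := cz [set w | nrm (w - z) < e].
    by apply/nbhs_nrm; exists e.
  by exists w.
split; apply/ler_addgt0Pr => e e0.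
  have [w [w1 _] wz] := H e e0; have := nrm_sub z w 0; rewrite !subr0 nrmB; lra.
have [w [_ w1] wz] := H (e / 2) ltac:(lra).
have := side_le (z - w) ss; rewrite sideD sideN nrmB ler_norml => /andP[? ?]; lra.
Qed.

Lemma cap_punctured s l z : 0 < l -> cap s l z -> punctured_disc z.
Proof.
move=> l0 [z1 zl]; split => //; apply/eqP => z0; move: zl.
by rewrite z0 /side /= !mulr0 addr0 leNgt l0.
Qed.

Lemma seg_in_cap s b c (l m : R) : nrm b <= 1 -> nrm c <= 1 -> side s b = 1 -> side s c = 1 ->
  0 < l <= m -> m <= 1 -> forall z, on_seg (toC m * b) (toC m * c) z -> cap s l z.
Proof.
move=> b1 c1 sb sc /andP[l0 lm] m1; apply: cap_convex; split;
  rewrite ?nrmM ?nrm_toC ?sideZ ?sb ?sc ?ger0_norm; nra.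
Qed.

(** The trapezium between two homothetic sides of the diamond is cut by a
    diagonal into two triangles, both inside a cap. *)
Lemma sector_shift (f f' : K -> K) s b c l : sign_pair s ->
  (forall z : K, punctured_disc z -> is_derive z 1 f (f' z)) ->
  nrm b <= 1 -> nrm c <= 1 -> side s b = 1 -> side s c = 1 -> 0 < l <= 1 ->
  seg f b c - seg f (toC l * b) (toC l * c) = seg f (toC l * c) c - seg f (toC l * b) b.
Proof.
move=> ss df b1 c1 sb sc /andP[l0 l1].
have capD z : nrm z <= 1 -> side s z = 1 -> cap s l z /\ cap s l (toC l * z).
  by move=> z1 zl; split; split; rewrite ?sideZ ?nrmM ?nrm_toC ?zl ?mulr1 ?ger0_norm ?(ltW l0) //; nra.
have [Db Db'] := capD b b1 sb; have [Dc Dc'] := capD c c1 sc.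
have dcap z : cap s l z -> is_derive z 1 f (f' z) by move=> /(cap_punctured l0) /df.
have cf : cont_on (cap s l) f by move=> z /dcap /derive_cont.
have T1 := goursat (cap_closed (l := l) ss) (@cap_convex s l) dcap Db' Db Dc.
have T2 := goursat (cap_closed (l := l) ss) (@cap_convex s l) dcap Db' Dc Dc'.
have cs := cont_on_seg (@cap_convex s l) cf.
move: T1 T2; rewrite /tri (seg_rev (cs _ _ Db' Dc)) (seg_rev (cs _ _ Db' Dc')) (seg_rev (cs _ _ Dc' Dc)).
set x1 := seg f _ b; set x2 := seg f b c; set x3 := seg f _ c; set x4 := seg f _ c.
set x5 := seg f _ _ => T1 T2.
have -> : x2 - x5 = (x1 + x2 - x3) + (x3 - x4 - x5) + (x4 - x1) by ring.
by rewrite T1 T2 !add0r.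
Qed.

(** The contour is a diamond rather than a circle, so that only integrals over
    segments occur. *)
Definition diamond (f : K -> K) (l : R) : K :=
  seg f (toC l * 1) (toC l * 'j) + seg f (toC l * 'j) (toC l * -1) +
  seg f (toC l * -1) (toC l * - 'j) + seg f (toC l * - 'j) (toC l * 1).

(** The four sides of the diamond are all treated as instances of one
    statement about a side from b to c with functional s. *)
Lemma diamond_ind (P : R * R -> K -> K -> Prop) :
  (forall s b c, sign_pair s -> nrm b <= 1 -> nrm c <= 1 -> side s b = 1 -> side s c = 1 -> P s b c) ->
  [/\ P (1, 1) 1 'j, P (-1, 1) 'j (-1), P (-1, -1) (-1) (- 'j) & P (1, -1) (- 'j) 1].
Proof.
move=> H; split; apply: H; rewrite /sign_pair /side /= ?nrmN ?nrm_j ?nrm1 //;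
  try (by split; [(by left) || (by right) | (by left) || (by right)]); ring.
Qed.

Lemma telescope4 (a1 a2 a3 a4 b1 b2 b3 b4 r1 r2 r3 r4 : K) :
  a1 - b1 = r2 - r1 -> a2 - b2 = r3 - r2 -> a3 - b3 = r4 - r3 -> a4 - b4 = r1 - r4 ->
  a1 + a2 + a3 + a4 = b1 + b2 + b3 + b4.
Proof.
move=> h1 h2 h3 h4; apply/eqP; rewrite -subr_eq0; apply/eqP.
have -> : a1 + a2 + a3 + a4 - (b1 + b2 + b3 + b4) =
  (a1 - b1) + (a2 - b2) + (a3 - b3) + (a4 - b4) by ring.
by rewrite h1 h2 h3 h4; ring.
Qed.

(** The radial segments produced by the four sides cancel in pairs. *)
Lemma diamond_shift (f f' : K -> K) l :
  (forall z : K, punctured_disc z -> is_derive z 1 f (f' z)) -> 0 < l <= 1 ->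
  diamond f 1 = diamond f l.
Proof.
move=> df l01.
have [h1 h2 h3 h4] := diamond_ind (fun s b c ss b1 c1 sb sc => sector_shift ss df b1 c1 sb sc l01).
by rewrite /diamond toC1 !mul1r; apply: telescope4 h1 h2 h3 h4.
Qed.

Lemma inv_cont (a b : K) : (forall z, on_seg a b z -> z != 0) -> cont_on (on_seg a b) (fun z => z^-1).
Proof.
by move=> h z hz; apply: continuousV; [exact: h | move=> A; exact].
Qed.

Lemma seg_inv_scale (m a b : K) : m != 0 -> (forall z, on_seg a b z -> z != 0) ->
  seg (fun z => z^-1) (m * a) (m * b) = seg (fun z => z^-1) a b.
Proof.
move=> m0 h; rewrite -seg_scale.
have -> : seg (fun z : K => (m * z)^-1) a b = seg (fun z => 0 + m^-1 * z^-1) a b.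
  by apply: eq_seg => z _; rewrite invfM add0r.
rewrite seg_lin; last exact: inv_cont.
  have -> : seg (fun=> 0) a b = 0 :> K.
    by rewrite (segE (G := fun=> 0)) ?subrr // => t t01; rewrite mulr0; split; exact: is_derive_cst.
  by rewrite add0r mulrAC mulVf // mul1r.
by move=> z _; exact: cst_continuous.
Qed.

(** The number 2 pi i, as the integral of 1/z. *)
Definition diamond_period : K := diamond (fun z => z^-1) 1.

Lemma seg_punctured s b c l : nrm b <= 1 -> nrm c <= 1 -> side s b = 1 -> side s c = 1 ->
  0 < l <= 1 -> forall z, on_seg (toC l * b) (toC l * c) z -> punctured_disc z.
Proof.
move=> b1 c1 sb sc /andP[l0 l1] z hz; apply: (@cap_punctured s l) => //.
by apply: seg_in_cap hz => //; rewrite l0 lexx.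
Qed.

Lemma diamond_sides : [/\ forall z, on_seg 1 'j z -> punctured_disc z,
  forall z, on_seg 'j (-1) z -> punctured_disc z,
  forall z, on_seg (-1) (- 'j) z -> punctured_disc z &
  forall z, on_seg (- 'j) 1 z -> punctured_disc z].
Proof.
have one : (0 : R) < (1 : R) <= (1 : R) by rewrite ltr01 lexx.
have := diamond_ind (fun s b c ss b1 c1 sb sc => seg_punctured b1 c1 sb sc one).
by rewrite toC1 !mul1r.
Qed.

Lemma diamond_inv l : 0 < l <= 1 -> diamond (fun z => z^-1) l = diamond_period.
Proof.
move=> l01; have l0 : toC l != 0.
  by rewrite -toC0 (inj_eq (@toC_inj R)); case/andP: l01 => /gt_eqF ->.
have [h1 h2 h3 h4] := diamond_sides.
rewrite /diamond_period /diamond toC1 !mul1r.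
rewrite (seg_inv_scale l0 (fun z h => (h1 z h).2)) (seg_inv_scale l0 (fun z h => (h2 z h).2)).
by rewrite (seg_inv_scale l0 (fun z h => (h3 z h).2)) (seg_inv_scale l0 (fun z h => (h4 z h).2)).
Qed.

(** The imaginary part of the integrand (j - 1) / (1 + t (j - 1)) is positive. *)
Lemma seg_inv_im : 0 < complex.Im (seg (fun z : K => z^-1) 1 'j).
Proof.
have [h1 _ _ _] := diamond_sides.
have [G HG] := exists_sprim (inv_cont (fun z h => (h1 z h).2)).
rewrite (segE HG).
have [c c01 Ec] := mvt01 (fun t ht => (HG t ht).2).
have -> : complex.Im (G 1 - G 0) = complex.Im (G 1) - complex.Im (G 0).
  by case: (G 1) (G 0) => ? ? [? ?].
rewrite Ec /=.
have N0 : 0 < (1 - c) ^+ 2 + c ^+ 2 by nra.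
have H x : x = ((1 - c) ^+ 2 + c ^+ 2)^-1 -> 0 < x by move=> ->; rewrite invr_gt0.
by apply: H; field; apply/negbT; apply: gt_eqF; nra.
Qed.

(** By homogeneity of dz / z, all four sides contribute the same amount as the
    one in [seg_inv_im]. *)
Lemma diamond_period_neq0 : diamond_period != 0.
Proof.
have [h1 h2 h3 h4] := diamond_sides.
have jj : 'j * 'j = -1 by rewrite -expr2; exact: sqr_i.
have j0 : 'j != 0 by rewrite -nrm_eq0 nrm_j oner_neq0.
have := seg_inv_im; rewrite /diamond_period /diamond toC1 !mul1r.
set x := seg _ 1 'j.
have e1 : seg (fun z : K => z^-1) 'j (-1) = x.
  by rewrite /x -(seg_inv_scale j0 (fun z h => (h1 z h).2)) jj mulr1.
have e2 : seg (fun z : K => z^-1) (-1) (- 'j) = x.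
  by rewrite -e1 -(seg_inv_scale j0 (fun z h => (h2 z h).2)) jj mulrN1.
have e3 : seg (fun z : K => z^-1) (- 'j) 1 = x.
  by rewrite -e2 -(seg_inv_scale j0 (fun z h => (h3 z h).2)) mulrN1 mulrN jj opprK.
rewrite e1 e2 e3 => x0; apply/eqP => E.
have : complex.Im (x + x + x + x) = 0 by rewrite E.
rewrite !cImD; lra.
Qed.
End CauchyFunctional.

(** * The derivative as a bounded functional *)

Section CauchyFunctional2.
Variable R : realType.
Local Notation K := (C R).
Local Notation toC := (@toC R).
Local Notation "''j'" := ('i%C : K).

Lemma diamond_lin (f g : K -> K) (c : K) l : 0 < l <= 1 ->
  cont_on (@punctured_disc R) f -> cont_on (@punctured_disc R) g ->
  diamond (fun z => f z + c * g z) l = diamond f l + c * diamond g l.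
Proof.
move=> l01 cf cg.
have [h1 h2 h3 h4] := diamond_ind (fun s b c ss b1 c1 sb sc => seg_punctured b1 c1 sb sc l01).
have H (h : K -> K) a b : (forall z, on_seg a b z -> punctured_disc z) ->
  cont_on (@punctured_disc R) h -> cont_on (on_seg a b) h by move=> H ch z /H /ch.
rewrite /diamond !seg_lin; try (by apply: H); ring.
Qed.

Lemma diamond_le (f : K -> K) l M : 0 < l <= 1 ->
  cont_on (@punctured_disc R) f ->
  (forall z : K, nrm z <= l -> l <= 2 * nrm z -> nrm (f z) <= M) ->
  nrm (diamond f l) <= 16 * (l * M).
Proof.
move=> l01 cf fM; have /andP[l0 l1] := l01.
have M0 : 0 <= M.
  have := fM (toC l); rewrite nrm_toC ger0_norm ?(ltW l0) // => /(_ (lexx _) ltac:(lra)).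
  exact/le_trans/nrm_ge0.
have [h1 h2 h3 h4] := diamond_ind (fun s b c ss b1 c1 sb sc =>
  conj (seg_punctured b1 c1 sb sc l01) (conj ss (conj (conj b1 c1) (conj sb sc)))).
have H s b c : (forall z, on_seg (toC l * b) (toC l * c) z -> punctured_disc z) /\
   (sign_pair s /\ ((nrm b <= 1 /\ nrm c <= 1) /\ (side s b = 1 /\ side s c = 1))) ->
   nrm (seg f (toC l * b) (toC l * c)) <= 4 * (l * M).
  move=> [hp [ss [[b1 c1] [sb sc]]]]; apply: le_trans (seg_le _ _) _.
  - by move=> z /hp /cf.
  - move=> z hz; apply: fM.
      case: hz => t t01 ->; apply: le_trans (nrm_segment _ _ t01) _.
      rewrite !nrmM !nrm_toC ger0_norm ?(ltW l0) //; have /andP[? ?] := t01.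
      have lb : l * nrm b <= l by rewrite ler_piMr // ltW.
      have lc : l * nrm c <= l by rewrite ler_piMr // ltW.
      nra.
    have -> : l = side s z.
      case: hz => t t01 ->; rewrite !(sideD, sideZ, sideN) sb sc; ring.
    exact: le_trans (ler_norm _) (side_le _ ss).
  - rewrite -mulrBr nrmM nrm_toC ger0_norm ?(ltW l0) //.
    have : nrm (c - b) <= 2 by apply: le_trans (nrmD _ _) _; rewrite nrmN; lra.
    have := nrm_ge0 (c - b); move: (nrm _) => n n0 n2.
    have : l * n * M <= l * 2 * M by rewrite ler_wpM2r // ler_wpM2l // ltW.
    lra.
have H1 := H _ _ _ h1; have H2 := H _ _ _ h2; have H3 := H _ _ _ h3; have H4 := H _ _ _ h4.
rewrite /diamond; apply: le_trans (nrmD _ _) _.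
apply: le_trans (lerD (nrmD _ _) (lexx _)) _.
apply: le_trans (lerD (lerD (nrmD _ _) (lexx _)) (lexx _)) _; lra.
Qed.

(** Subtracting f 0 makes the integrand of order 1/z near 0, so that the
    contour can be shrunk with a controlled error. *)
Definition ckernel (f : K -> K) (z : K) : K := (f z - f 0) * (z^-1 * z^-1).
Definition cauchy_fun (f : K -> K) : K := (diamond_period R)^-1 * diamond (ckernel f) 1.

Lemma ckernel_cont f : cont_on (@unit_disc R) f -> cont_on (@punctured_disc R) (ckernel f).
Proof.
move=> cf z [z1 z0]; apply: continuousM.
  by apply: continuousB; [exact: cf | exact: cst_continuous].
by apply: continuousM; apply: continuousV => //; move=> A; exact.
Qed.

Lemma ckernel_derivable f : (forall z : K, unit_disc z -> derivable f z 1) ->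
  forall z : K, punctured_disc z -> derivable (ckernel f) z 1.
Proof.
move=> df z [z1 z0]; apply: derivableM.
  by apply: derivableB; [exact: df | exact: derivable_cst].
by apply: derivableM; apply: derivableV => //; exact: derivable_id.
Qed.

Lemma one01 : (0 : R) < (1 : R) <= (1 : R). Proof. by rewrite ltr01 lexx. Qed.

Lemma eq_diamond (f g : K -> K) l : 0 < l <= 1 -> (forall z, punctured_disc z -> f z = g z) ->
  diamond f l = diamond g l.
Proof.
move=> l01 fg.
have [h1 h2 h3 h4] := diamond_ind (fun s b c ss b1 c1 sb sc => seg_punctured b1 c1 sb sc l01).
by rewrite /diamond; congr (_ + _ + _ + _); apply: eq_seg => z; [move/h1|move/h2|move/h3|move/h4]; exact: fg.
Qed.

Lemma cauchy_fun_lin f g c : cont_on (@unit_disc R) f -> cont_on (@unit_disc R) g ->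
  cauchy_fun (fun z => f z + c * g z) = cauchy_fun f + c * cauchy_fun g.
Proof.
move=> cf cg; rewrite /cauchy_fun mulrCA -mulrDr; congr (_ * _).
rewrite -diamond_lin ?one01 //; try exact: ckernel_cont.
by apply: eq_diamond => [|z _]; [exact: one01 | rewrite /ckernel; ring].
Qed.

Lemma eq_cauchy_fun f g : (forall z, unit_disc z -> f z = g z) -> cauchy_fun f = cauchy_fun g.
Proof.
move=> fg; rewrite /cauchy_fun; congr (_ * _); apply: eq_diamond => [|z [z1 z0]]; first exact: one01.
by rewrite /ckernel !fg // /unit_disc /= nrm0.
Qed.

Definition cauchy_cst : R := 128 * nrm (diamond_period R)^-1.

Lemma cauchy_fun_le f M : cont_on (@unit_disc R) f ->
  (forall z, unit_disc z -> nrm (f z) <= M) -> nrm (cauchy_fun f) <= cauchy_cst * M.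
Proof.
move=> cf fM; rewrite /cauchy_fun /cauchy_cst nrmM.
set n := nrm (diamond_period R)^-1; have -> : 128 * n * M = n * (128 * M) by ring.
rewrite ler_wpM2l ?nrm_ge0 //.
have M0 : 0 <= M by apply: le_trans (nrm_ge0 (f 0)) (fM _ _); rewrite /unit_disc /= nrm0.
apply: le_trans (diamond_le one01 (ckernel_cont cf) (M := 8 * M) _) _; last lra.
move=> z z1 z2; rewrite /ckernel nrmM nrmM nrmV.
have n0 : 0 < nrm z by lra.
have h1 : nrm (f z - f 0) <= 2 * M.
  apply: le_trans (nrmD _ _) _; rewrite nrmN; have := fM z z1; have := fM 0.
  by rewrite /unit_disc /= nrm0 => /(_ ler01); lra.
have h2 : (nrm z)^-1 <= 2 by rewrite invf_ple ?posrE // ; lra.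
have h3 : 0 <= (nrm z)^-1 by rewrite invr_ge0 nrm_ge0.
have := nrm_ge0 (f z - f 0); move: (nrm (f z - f 0)) ((nrm z)^-1) h1 h2 h3 => a b h1 h2 h3 h0.
have : b * b <= 4 by nra.
have : 0 <= b * b by nra.
move: (b * b) => d; nra.
Qed.

(** Shrinking the diamond does not change the integral of the kernel, and near
    0 the kernel is f'(0) / z up to an error that becomes small against 1/z;
    the integral of 1/z is [diamond_period] on every diamond. *)
Lemma cauchy_funE (f : K -> K) : (forall z : K, unit_disc z -> derivable f z 1) ->
  'D_1 f (0 : K) = cauchy_fun f.
Proof.
move=> df.
have u0 : unit_disc (0 : K) by rewrite /unit_disc /= nrm0.
have dk := ckernel_derivable df.
have cf : cont_on (@unit_disc R) f.
  by move=> z /df /derivable1_diffP /differentiable_continuous.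
set l := 'D_1 f 0.
suff : diamond (ckernel f) 1 = l * diamond_period R.
  by move=> E; rewrite /cauchy_fun E mulrCA mulVf ?mulr1 // diamond_period_neq0.
apply/eqP; rewrite -subr_eq0; apply/eqP/nrm_eq0P/ler_addgt0Pr => e e0; rewrite add0r.
have /derive_nrmP/(_ (e / 32) ltac:(lra))[d d0 Hd] : is_derive (0 : K) 1 f l by split; [exact: df|].
pose r := Num.min 1 (d / 2).
have r01 : 0 < r <= 1 by rewrite /r lt_min ge_min lexx ltr01 divr_gt0.
have rd : r < d by rewrite /r gt_min; apply/orP; right; lra.
have /andP[r0 r1] := r01.
rewrite (diamond_shift (f' := fun z => 'D_1 (ckernel f) z) _ r01); last first.
  by move=> z hz; split => //; exact: dk.
pose rem (z : K) := ckernel f z + - l * z^-1.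
have cinv : cont_on (@punctured_disc R) (fun z => z^-1).
  by move=> z [z1 z0]; apply: continuousV => //; move=> A; exact.
have crem : cont_on (@punctured_disc R) rem.
  move=> z hz; apply: continuousD; first exact: ckernel_cont.
  by apply: continuousM; [exact: cst_continuous | exact: cinv].
have -> : diamond (ckernel f) r - l * diamond_period R = diamond rem r.
  have E := diamond_lin (- l) r01 (ckernel_cont cf) cinv.
  by rewrite /rem E (diamond_inv r01) mulNr.
apply: le_trans (diamond_le r01 crem (M := e / 32 * (2 / r)) _) _; last first.
  have -> : 16 * (r * (e / 32 * (2 / r))) = e * (r / r) by field; rewrite gt_eqF.
  by rewrite divff ?mulr1 // gt_eqF.
move=> z z1 z2; have z0 : 0 < nrm z by lra.
have zn0 : z != 0 by rewrite -nrm_eq0 gt_eqF.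
have -> : rem z = (f z - f 0 - (z - 0) * l) * (z^-1 * z^-1).
  by rewrite /rem /ckernel; field.
have := Hd z; rewrite !subr0 => /(_ ltac:(lra)) h.
rewrite !nrmM !nrmV; have h3 : 0 < (nrm z)^-1 by rewrite invr_gt0.
have h4 : (nrm z)^-1 <= 2 / r.
  by rewrite -[2 / r]invrK invf_div lef_pV2 ?posrE ?divr_gt0 //; lra.
have -> : forall x : R, x * ((nrm z)^-1 * (nrm z)^-1) = x / nrm z * (nrm z)^-1 by move=> x; rewrite mulrA.
apply: le_trans (ler_wpM2r (ltW h3) (_ : _ <= e / 32)) _; first by rewrite ler_pdivrMr.
by rewrite ler_wpM2l //; lra.
Qed.
End CauchyFunctional2.

(** * Complex differentiability in terms of real-valued norms *)

Section DiffNrm.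
Variables (R : realType) (V W : normedModType (C R)).
Local Notation K := (C R).
Local Notation toC := (@toC R).

Lemma diff_nrm (f : V -> W) (x : V) : differentiable f x ->
  forall e : R, 0 < e -> exists2 d : R, 0 < d & forall y, nrm (y - x) < d ->
    nrm (f y - f x - 'd f x (y - x)) <= e * nrm (y - x).
Proof.
move=> /diff_locally E e e0.
have {E} : (f \o shift x = cst (f x) + 'd f x +o_ (0 : V) id) by exact: E.
move=> /eqaddoP /(_ (toC e)).
have -> : 0 < toC e by rewrite -toC0 toC_lt.
move=> /(_ isT) /nbhs_nrm[d d0 Hd]; exists d => // y yd.
have := Hd (y - x); rewrite subr0 => /(_ yd) /=.
rewrite [X in `|X| <= _](_ : _ = f y - f x - 'd f x (y - x)); last first.
  by rewrite !fctE /= subrK opprD addrA.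
by rewrite !nrmE -toCM toC_le.
Qed.

(** The bound on L is what makes L continuous, as a differential has to be. *)
Lemma nrm_is_diff (f : V -> W) (x : V) (L : V -> W) (M : R) : linear L ->
  (forall v, nrm (L v) <= M * nrm v) ->
  (forall e : R, 0 < e -> exists2 d : R, 0 < d & forall y, nrm (y - x) < d ->
    nrm (f y - f x - L (y - x)) <= e * nrm (y - x)) -> is_diff x f L.
Proof.
move=> linL LM H.
pose scallM := GRing.isLinear.Build _ _ _ _ L linL.
pose LL : {linear V -> W} := HB.pack L scallM.
have cL : continuous LL.
  move=> v; apply/continuous_nrm => e e0.
  have M1 : 0 < `|M| + 1 by have := normr_ge0 M; lra.
  exists (e / (`|M| + 1)); first exact: divr_gt0.
  move=> y; rewrite ltr_pdivlMr // => yv; rewrite -linearB.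
  apply: le_lt_trans (LM _) _; apply: le_lt_trans yv; rewrite mulrC ler_wpM2l ?nrm_ge0 //.
  by apply: le_trans (ler_norm M) _; rewrite lerDl.
have E : f \o shift x = cst (f x) + LL +o_ (0 : V) id.
  apply/eqaddoP => _/posnumP[e]; have [e' e'0 ee'] := toC_pos (gt0 e).
  have [d d0 Hd] := H _ e'0; apply/nbhs_nrm; exists d => // y; rewrite subr0 => yd.
  have := Hd (y + x); rewrite addrK => /(_ yd) h.
  rewrite [X in `|X| <= _](_ : _ = f (y + x) - f x - L y); last first.
    by rewrite !fctE /= opprD addrA.
  by rewrite ee' !nrmE -toCM toC_le.
have EL := diff_unique cL E.
by apply: DiffDef; [apply/diff_locallyP; rewrite EL; split|].
Qed.

Lemma near_eq_diff (f g : V -> W) (x : V) : (\forall y \near x, f y = g y) ->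
  differentiable f x -> is_diff x g ('d f x).
Proof.
move=> /nbhs_nrm[r r0 fg] df.
have fgx : f x = g x by apply: fg; rewrite subrr nrm0.
have [k k0 Hk] := linear_lipschitz (diff_continuous df).
have [k' k'0 kk'] := toC_pos k0.
apply: (@nrm_is_diff _ _ _ k').
- exact: linearP.
- by move=> v; have := Hk v; rewrite kk' !nrmE -toCM toC_le.
move=> e e0; have [d d0 Hd] := diff_nrm df e0.
exists (Num.min r d); first by rewrite lt_min r0.
by move=> y; rewrite lt_min => /andP[yr yd]; rewrite -fgx -fg //; apply: Hd.
Qed.

Lemma near_eq_differentiable (f g : V -> W) (x : V) : (\forall y \near x, f y = g y) ->
  differentiable f x -> differentiable g x.
Proof. by move=> fg df; have [] := near_eq_diff fg df. Qed.
End DiffNrm.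

(** * Cauchy estimates and second derivatives *)

Section Holo.
Variables (R : realType) (V : normedModType (C R)).
Local Notation K := (C R).
Local Notation toC := (@toC R).

Lemma line_derive (W : normedModType K) (f : V -> W) (x v : V) (z : K) :
  differentiable f (x + z *: v) ->
  forall e : R, 0 < e -> exists2 d : R, 0 < d & forall y : K, nrm (y - z) < d ->
    nrm (f (x + y *: v) - f (x + z *: v) - (y - z) *: 'D_v f (x + z *: v)) <= e * nrm (y - z).
Proof.
move=> df e e0; have nv : 0 < nrm v + 1 by have := nrm_ge0 v; lra.
have [d d0 Hd] := diff_nrm df (divr_gt0 e0 nv).
exists (d / (nrm v + 1)); first exact: divr_gt0.
move=> y; rewrite ltr_pdivlMr // => yz.
have E : x + y *: v - (x + z *: v) = (y - z) *: v by rewrite opprD addrACA subrr add0r scalerBl.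
have h : nrm (x + y *: v - (x + z *: v)) <= nrm (y - z) * (nrm v + 1).
  by rewrite E nrmZ ler_wpM2l ?nrm_ge0 // lerDl.
have := Hd _ (le_lt_trans h yz); rewrite deriveE // E linearZ /=.
move=> /le_trans; apply; rewrite -E; apply: le_trans (ler_wpM2l _ h) _.
  by rewrite divr_ge0 ?ltW.
by rewrite le_eqVlt; apply/orP; left; apply/eqP; field; rewrite gt_eqF.
Qed.

Variable phi : V -> K.

Lemma is_derive_line (x v : V) (z : K) : differentiable phi (x + z *: v) ->
  is_derive z 1 (fun y : K => phi (x + y *: v)) ('D_v phi (x + z *: v)).
Proof.
by move=> df; apply/derive_nrmP => e e0; have [d d0 Hd] := line_derive df e0; exists d.
Qed.

Lemma deriveZv (c : K) (x v : V) : differentiable phi x -> 'D_(c *: v) phi x = c * 'D_v phi x.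
Proof. by move=> df; rewrite !deriveE // linearZ. Qed.

Lemma cder_line (x w : V) (t : R) : differentiable phi (x + toC t *: w) ->
  cder (fun t => phi (x + toC t *: w)) t ('D_w phi (x + toC t *: w)).
Proof.
move=> /is_derive_line H.
have H0 : is_derive (0 + toC t * 1) 1 (fun y : K => phi (x + y *: w)) ('D_w phi (x + toC t *: w)).
  by rewrite add0r mulr1.
split.
  have := derivable_Re H0; rewrite mulr1.
  by under [X in is_derive _ _ X]eq_fun do rewrite add0r mulr1.
have := derivable_Im H0; rewrite mulr1.
by under [X in is_derive _ _ X]eq_fun do rewrite add0r mulr1.
Qed.

Lemma segment_mvt (x w : V) M :
  (forall t : R, 0 <= t <= 1 -> differentiable phi (x + toC t *: w)) ->
  (forall t : R, 0 <= t <= 1 -> nrm ('D_w phi (x + toC t *: w)) <= M) ->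
  nrm (phi (x + w) - phi x) <= 2 * M.
Proof.
move=> df dM; pose G (t : R) := phi (x + toC t *: w).
have -> : phi (x + w) - phi x = G 1 - G 0 by rewrite /G toC0 toC1 scale1r scale0r addr0.
apply: (@cder_mvt_le R G (fun t => 'D_w phi (x + toC t *: w))) => // t t01.
exact/cder_line/df.
Qed.

Section Ball.
Variables (x0 : V) (r B : R).
Hypotheses (rpos : 0 < r)
  (dphi : forall x, nrm (x - x0) < r -> differentiable phi x)
  (bphi : forall x, nrm (x - x0) < r -> nrm (phi x) <= B).

Local Notation c := (cauchy_cst R).

Lemma disc_in (x v : V) s : nrm (x - x0) + nrm v < s -> forall z : K, unit_disc z -> nrm (x + z *: v - x0) < s.
Proof.
move=> h z z1; rewrite addrAC; apply: le_lt_trans (nrmD _ _) _; rewrite nrmZ.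
apply: le_lt_trans h; rewrite lerD2l ler_piMl ?nrm_ge0 //.
Qed.

(** The derivative of a function of several variables in the direction v is
    read off on the complex line through x, as a functional of the values of
    the function. All estimates below apply this functional to differences. *)
Lemma cauchy_directional (x v : V) : nrm (x - x0) + nrm v < r ->
  'D_v phi x = cauchy_fun (fun z => phi (x + z *: v)).
Proof.
move=> h; rewrite -cauchy_funE.
  have df : differentiable phi (x + (0 : K) *: v).
    by apply: dphi; apply: disc_in => //; rewrite /unit_disc /= nrm0.
  by have [_ ->] := is_derive_line df; rewrite scale0r addr0.
by move=> z z1; have [] := is_derive_line (dphi (disc_in h z1)).
Qed.

Lemma cont_line (x v : V) : nrm (x - x0) + nrm v < r ->
  cont_on (@unit_disc R) (fun z : K => phi (x + z *: v)).
Proof.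
by move=> h z z1; apply: (derive_cont (is_derive_line (dphi (disc_in h z1)))).
Qed.

Lemma B_ge0 : 0 <= B.
Proof. by apply: le_trans (nrm_ge0 (phi x0)) (bphi _); rewrite subrr nrm0. Qed.

Lemma c_ge0 : 0 <= c. Proof. by rewrite /cauchy_cst mulr_ge0 ?nrm_ge0. Qed.

(** Cauchy estimates bound directional derivatives only for vectors that keep
    a disc inside the domain; homogeneity extends them to all vectors. *)
Lemma short_to_linear (L : V -> K) (s M : R) (v : V) : 0 < s -> 0 <= M ->
  (forall (a : K) u, L (a *: u) = a * L u) ->
  (forall u, nrm u <= s -> nrm (L u) <= M) -> nrm (L v) <= M / s * nrm v.
Proof.
move=> s0 M0 LZ H; have [->|v0] := eqVneq v 0.
  by rewrite -(scale0r (0 : V)) LZ mul0r scale0r !nrm0 mulr0.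
have nv : 0 < nrm v by rewrite lt_neqAle eq_sym nrm_eq0 v0 nrm_ge0.
have := H (toC (s / nrm v) *: v); rewrite nrmZ nrm_toC ger0_norm ?divr_ge0 ?(ltW s0) ?(ltW nv) //.
rewrite divfK ?gt_eqF // => /(_ (lexx _)); rewrite LZ nrmM nrm_toC ger0_norm ?divr_ge0 ?(ltW s0) ?(ltW nv) //.
rewrite -ler_pdivlMl ?divr_gt0 // invf_div; move=> /le_trans; apply.
by rewrite [X in _ <= X]mulrAC mulrC mulrA.
Qed.

Definition gradient_cst := 2 * (c * B) / (r / 2).

Lemma cauchy_estimate (x v : V) : nrm (x - x0) < r / 2 -> nrm ('D_v phi x) <= gradient_cst * nrm v.
Proof.
move=> hx.
have rp := rpos; have hr : r / 2 < r by lra.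
have dx : differentiable phi x by apply: dphi; apply: lt_trans hx hr.
(* A vector of length r / 4 at distance r / 2 keeps its disc in the ball. *)
rewrite /gradient_cst; have -> : 2 * (c * B) / (r / 2) = c * B / (r / 4) by field; rewrite gt_eqF.
apply: (@short_to_linear (fun v => 'D_v phi x)); first lra.
- by rewrite mulr_ge0 ?c_ge0 ?B_ge0.
- by move=> a u; exact: deriveZv.
move=> u hu; have h : nrm (x - x0) + nrm u < r by lra.
rewrite cauchy_directional //; apply: cauchy_fun_le; first exact: cont_line.
by move=> z z1; apply/bphi/disc_in.
Qed.

Lemma gradient_cst_ge0 : 0 <= gradient_cst.
Proof. rewrite /gradient_cst; apply: divr_ge0; last by have rp := rpos; lra.
by apply: mulr_ge0 => //; apply: mulr_ge0; [exact: c_ge0 | exact: B_ge0]. Qed.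

Lemma segment_in (x y : V) (s : R) (t : R) : nrm (x - x0) < s -> nrm (y - x0) < s ->
  0 <= t <= 1 -> nrm (x + toC t *: (y - x) - x0) < s.
Proof.
move=> hx hy /andP[t0 t1].
have -> : x + toC t *: (y - x) - x0 = toC (1 - t) *: (x - x0) + toC t *: (y - x0).
  have -> : y - x = (y - x0) - (x - x0) by rewrite opprB addrA subrK.
  by rewrite addrAC toCD toCN toC1 scalerBl scale1r scalerBr addrA addrAC.
apply: le_lt_trans (nrmD _ _) _; rewrite !nrmZ !nrm_toC !ger0_norm ?subr_ge0 //.
move: (nrm (x - x0)) (nrm (y - x0)) hx hy => a b ha hb; have [ab|ab] := lerP a b.
  by apply: le_lt_trans hb; nra.
apply: le_lt_trans ha; have : 0 <= t * (a - b) by rewrite mulr_ge0 // subr_ge0 ltW.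
lra.
Qed.

Lemma phi_lipschitz (x y : V) : nrm (x - x0) < r / 2 -> nrm (y - x0) < r / 2 ->
  nrm (phi y - phi x) <= 2 * gradient_cst * nrm (y - x).
Proof.
move=> hx hy; have rp := rpos.
have H t (t01 : 0 <= t <= 1) := segment_in hx hy t01.
have -> : phi y - phi x = phi (x + (y - x)) - phi x by rewrite [x + _]addrC subrK.
rewrite -mulrA; apply: segment_mvt => t t01.
  by apply: dphi; apply: lt_trans (H t t01) _; lra.
exact/cauchy_estimate/H.
Qed.

Definition hessian_cst := c * (2 * gradient_cst) / (r / 4).

(** The functional applied to the difference of the restrictions of phi to two
    parallel lines, which is small because phi is Lipschitz. *)
Lemma derive_lipschitz (x y v : V) : nrm (x - x0) < r / 4 -> nrm (y - x0) < r / 4 ->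
  nrm ('D_v phi y - 'D_v phi x) <= hessian_cst * nrm (y - x) * nrm v.
Proof.
move=> hx hy; have rp := rpos.
have dx : differentiable phi x by apply: dphi; lra.
have dy : differentiable phi y by apply: dphi; lra.
have -> : hessian_cst * nrm (y - x) = c * (2 * gradient_cst * nrm (y - x)) / (r / 4) by rewrite /hessian_cst; ring.
apply: (@short_to_linear (fun v => 'D_v phi y - 'D_v phi x)); first lra.
- apply: mulr_ge0; first exact: c_ge0.
  apply: mulr_ge0; last exact: nrm_ge0.
  by apply: mulr_ge0 => //; exact: gradient_cst_ge0.
- by move=> a u; rewrite !deriveZv // mulrBr.
move=> u hu.
have hxu : nrm (x - x0) + nrm u < r / 2 by lra.
have hyu : nrm (y - x0) + nrm u < r / 2 by lra.
have lt2 : r / 2 < r by lra.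
rewrite !cauchy_directional ?(lt_trans hxu) ?(lt_trans hyu) //.
have cx := cont_line (lt_trans hxu lt2); have cy := cont_line (lt_trans hyu lt2).
have -> : cauchy_fun (fun z => phi (y + z *: u)) - cauchy_fun (fun z => phi (x + z *: u)) =
   cauchy_fun (fun z => phi (y + z *: u) + -1 * phi (x + z *: u)).
  by rewrite (cauchy_fun_lin (-1) cy cx) mulN1r.
apply: cauchy_fun_le.
  move=> z hz; apply: continuousD; first exact: cy.
  by apply: continuousM; [exact: cst_continuous | exact: cx].
move=> z hz; rewrite mulN1r.
have -> : y - x = (y + z *: u) - (x + z *: u) by rewrite opprD addrACA subrr addr0.
by apply: phi_lipschitz; apply: disc_in.
Qed.

Lemma hessian_cst_ge0 : 0 <= hessian_cst.
Proof.
rewrite /hessian_cst; apply: divr_ge0; last by have rp := rpos; lra.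
by apply: mulr_ge0; [exact: c_ge0 | apply: mulr_ge0 => //; exact: gradient_cst_ge0].
Qed.

Lemma taylor2 (x w : V) : nrm (x - x0) < r / 8 -> nrm w < r / 8 ->
  nrm (phi (x + w) - phi x - 'D_w phi x) <= 2 * hessian_cst * nrm w ^+ 2.
Proof.
move=> hx hw; have rp := rpos.
have hin t : 0 <= t <= 1 -> nrm (x + toC t *: w - x0) < r / 4.
  move=> /andP[t0 t1]; rewrite addrAC; apply: le_lt_trans (nrmD _ _) _.
  rewrite nrmZ nrm_toC ger0_norm //; have := nrm_ge0 w; nra.
have dx : differentiable phi x by apply: dphi; lra.
pose G (t : R) := phi (x + toC t *: w) + - 'D_w phi x * toC t.
have -> : phi (x + w) - phi x - 'D_w phi x = G 1 - G 0.
  by rewrite /G toC0 toC1 scale1r scale0r addr0 mulr0 mulr1 addr0 addrAC.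
rewrite -mulrA.
apply: (@cder_mvt_le R G (fun t => 'D_w phi (x + toC t *: w) + - 'D_w phi x * 1)) => t t01.
  apply: cderD.
    have dt : differentiable phi (x + toC t *: w) by apply: dphi; apply: lt_trans (hin t t01) _; lra.
    exact: cder_line.
  by apply: cderZ; split => /=; [exact: is_derive_id | exact: is_derive_cst].
rewrite mulr1; apply: le_trans (derive_lipschitz _ _ _) _; first lra.
  exact: hin.
rewrite addrAC subrr add0r nrmZ nrm_toC; have /andP[t0 t1] := t01; rewrite ger0_norm //.
rewrite expr2 !mulrA ler_wpM2r ?nrm_ge0 // ler_wpM2r ?nrm_ge0 //.
by have := hessian_cst_ge0; nra.
Qed.

(** For a short vector u, the derivative of x |-> 'D_u phi x at x0 in the
    direction w: differentiation in w under the integral that computes 'D_u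
    phi. *)
Definition hess (u w : V) : K := cauchy_fun (fun z => 'D_w phi (x0 + z *: u)).

Section Short.
Variable u : V.
Hypothesis hu : nrm u < r / 16.

Lemma short_in (z : K) : unit_disc z -> nrm (x0 + z *: u - x0) < r / 16.
Proof.
move=> hz; apply: disc_in => //; rewrite subrr nrm0 add0r; exact: hu.
Qed.

Lemma hess_cont (w : V) : cont_on (@unit_disc R) (fun z => 'D_w phi (x0 + z *: u)).
Proof.
have rp := rpos; have hu' := hu.
move=> z hz; apply/continuous_nrm => e e0.
pose M := (hessian_cst * (nrm u * nrm w) + 1).
have M0 : 0 < M.
  rewrite /M ltr_wpDl //; apply: mulr_ge0; first exact: hessian_cst_ge0.
  by apply: mulr_ge0; exact: nrm_ge0.
have un : 0 < nrm u + 1 by have := nrm_ge0 u; lra.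
exists (Num.min (e / M) (r / 16 / (nrm u + 1))).
  by rewrite lt_min !divr_gt0.
move=> y; rewrite lt_min => /andP[y1 y2].
have E : x0 + y *: u - (x0 + z *: u) = (y - z) *: u by rewrite opprD addrACA subrr add0r scalerBl.
have h1 : nrm (x0 + z *: u - x0) < r / 4 by apply: lt_trans (short_in hz) _; lra.
have h2 : nrm (x0 + y *: u - x0) < r / 4.
  apply: le_lt_trans (nrm_sub _ (x0 + z *: u) _) _; rewrite E nrmZ.
  move: y2; rewrite ltr_pdivlMr //; have := short_in hz; have := nrm_ge0 (y - z).
  have := nrm_ge0 u; nra.
apply: le_lt_trans (derive_lipschitz _ h1 h2) _; rewrite E nrmZ.
move: y1; rewrite ltr_pdivlMr // /M; apply: le_lt_trans.
have := nrm_ge0 (y - z); lra.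
Qed.

Lemma hess_linear : linear (hess u).
Proof.
have rp := rpos.
move=> a v w; rewrite /hess [RHS]addrC -cauchy_fun_lin; try exact: hess_cont.
apply: eq_cauchy_fun => z /short_in hz.
by have dz : differentiable phi (x0 + z *: u) by [apply: dphi; apply: lt_trans hz _; lra];
  rewrite !deriveE // linearP addrC.
Qed.

Lemma hess_bound (w : V) : nrm (hess u w) <= c * gradient_cst * nrm w.
Proof.
have rp := rpos.
rewrite -mulrA; apply: cauchy_fun_le; first exact: hess_cont.
by move=> z /short_in hz; apply: cauchy_estimate; apply: lt_trans hz _; lra.
Qed.

(** The remainder is the functional applied to the second-order Taylor
    remainder of phi, uniformly along a disc. *)
Lemma is_diff_derive : is_diff x0 (fun x => 'D_u phi x) (hess u).
Proof.
have rp := rpos; have hu' := hu; have u0 := nrm_ge0 u.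
apply: (nrm_is_diff hess_linear hess_bound) => e e0.
pose M := c * (2 * hessian_cst) + 1.
have M0 : 0 < M.
  rewrite /M ltr_wpDl //; apply: mulr_ge0; first exact: c_ge0.
  by apply: mulr_ge0 => //; exact: hessian_cst_ge0.
exists (Num.min (e / M) (r / 16)); first by rewrite lt_min !divr_gt0.
move=> y; rewrite lt_min => /andP[y1 y2]; set w := y - x0.
have hy : nrm (y - x0) + nrm u < r by rewrite -/w; lra.
have hx : nrm (x0 - x0) + nrm u < r by rewrite subrr nrm0; lra.
rewrite !cauchy_directional // /hess.
have cy := cont_line hy; have cx := cont_line hx; have ch := @hess_cont w.
have -> : forall a b d : K, a - b - d = a + -1 * (b + 1 * d) by move=> *; ring.
have cxh : cont_on (@unit_disc R) (fun z => phi (x0 + z *: u) + 1 * 'D_w phi (x0 + z *: u)).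
  move=> z hz; apply: continuousD; first exact: cx.
  by apply: continuousM; [exact: cst_continuous | exact: ch].
rewrite -(cauchy_fun_lin 1 cx ch) -(cauchy_fun_lin (-1) cy cxh).
apply: le_trans (cauchy_fun_le (M := 2 * hessian_cst * nrm w ^+ 2) _ _) _.
- move=> z hz; apply: continuousD; first exact: cy.
  by apply: continuousM; [exact: cst_continuous | exact: cxh].
- move=> z /short_in hz; rewrite mul1r mulN1r opprD addrA.
  have -> : y + z *: u = x0 + z *: u + w by rewrite /w addrAC [x0 + _]addrC subrK.
  by apply: taylor2; [apply: lt_trans hz _; lra | rewrite /w; lra].
have -> : c * (2 * hessian_cst * nrm w ^+ 2) = c * (2 * hessian_cst) * nrm w * nrm w by rewrite expr2; ring.
rewrite ler_wpM2r ?nrm_ge0 //.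
move: y1; rewrite -/w ltr_pdivlMr // /M => h; apply: le_trans (ltW h).
by have := nrm_ge0 w; move: (nrm w) (c) (hessian_cst) => n a b n0; lra.
Qed.
End Short.
End Ball.
End Holo.

(** * Derivatives of holomorphic maps are holomorphic *)

Section HoloThm.
Variables (R : realType) (V : normedModType (C R)).
Local Notation K := (C R).
Local Notation toC := (@toC R).

Section Scalar.
Variables (phi : V -> K) (O : set V).
Hypotheses (openO : open O) (dphi : forall x, O x -> differentiable phi x).

Lemma exists_bounded_ball (x0 : V) : O x0 -> exists r B : R, [/\ 0 < r,
  forall x, nrm (x - x0) < r -> O x & forall x, nrm (x - x0) < r -> nrm (phi x) <= B].
Proof.
move=> Ox; have /nbhs_nrm[d d0 Hd] : nbhs x0 O by apply: open_nbhs_nbhs.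
have /continuous_nrm/(_ 1 ltr01)[d' d'0 Hd'] := differentiable_continuous (dphi Ox).
exists (Num.min d d'), (nrm (phi x0) + 1); split => [|x|x].
- by rewrite lt_min d0.
- by rewrite lt_min => /andP[/Hd].
- rewrite lt_min => /andP[_ /Hd' h]; have := nrm_sub (phi x) (phi x0) 0.
  rewrite !subr0; lra.
Qed.

Lemma exists_short_multiple (u : V) (r : R) : 0 < r -> exists2 m : R, 0 < m & nrm (toC m *: u) < r.
Proof.
move=> r0; have n1 : 0 < nrm u + 1 by have := nrm_ge0 u; lra.
exists (r / (nrm u + 1)); first exact: divr_gt0.
rewrite nrmZ nrm_toC ger0_norm ?divr_ge0 ?ltW //.
by rewrite -mulrA gtr_pMr // mulrC ltr_pdivrMr // mul1r ltrDl.
Qed.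

Lemma near_derive_scale (u : V) (m : R) (x0 : V) : O x0 -> 0 < m ->
  \forall x \near x0, (toC m)^-1 *: 'D_(toC m *: u) phi x = 'D_u phi x.
Proof.
move=> Ox m0; have : nbhs x0 O by apply: open_nbhs_nbhs.
apply: filterS => x /dphi dx; rewrite deriveZv // [_ *: _]mulrA mulVf ?mul1r //.
by rewrite -toC0 (inj_eq (@toC_inj R)) gt_eqF.
Qed.

Lemma differentiable_derive (u x0 : V) : O x0 -> differentiable (fun x => 'D_u phi x) x0.
Proof.
move=> Ox; have [r [B [r0 rO rB]]] := exists_bounded_ball Ox.
have [m m0 hm] := @exists_short_multiple u (r / 16) ltac:(lra).
apply: near_eq_differentiable (near_derive_scale u Ox m0) _.
have [d _] := is_diff_derive r0 (fun x hx => dphi (rO x hx)) rB hm.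
exact: differentiableZ.
Qed.
End Scalar.

(** The functional of [cauchy_fun] gives on the one hand the derivative in w
    of 'D_u phi, by differentiation under the integral, and on the other hand
    the derivative in u of 'D_w phi, by [cauchy_funE] applied to 'D_w phi. *)
Lemma derive_sym (phi : V -> K) (O : set V) (u w x0 : V) : open O ->
  (forall x, O x -> differentiable phi x) -> O x0 ->
  'D_w (fun x => 'D_u phi x) x0 = 'D_u (fun x => 'D_w phi x) x0.
Proof.
move=> oO dphi Ox; have [r [B [r0 rO rB]]] := exists_bounded_ball oO dphi Ox.
have [m m0 hm] := @exists_short_multiple u (r / 16) ltac:(lra).
have mn0 : toC m != 0 by rewrite -toC0 (inj_eq (@toC_inj R)) gt_eqF.
have dO x (hx : nrm (x - x0) < r) := dphi x (rO x hx).
have dD v x : O x -> differentiable (fun x => 'D_v phi x) x by apply: differentiable_derive.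
have [d E] := is_diff_derive r0 dO rB hm.
have Eu : 'D_w (fun x => 'D_(toC m *: u) phi x) x0 = toC m * 'D_w (fun x => 'D_u phi x) x0.
  have N : \forall x \near x0, 'D_(toC m *: u) phi x = (toC m \*: (fun x => 'D_u phi x)) x.
    have : nbhs x0 O by apply: open_nbhs_nbhs.
    by apply: filterS => x /dphi dx; rewrite deriveZv.
  apply: (etrans (@near_eq_derive _ _ _ _ _ x0 w N)).
  have dU : derivable (fun x => 'D_u phi x) x0 w by apply/diff_derivable/dD.
  exact: (deriveZ (toC m) dU).
have E1 : 'D_w (fun x => 'D_(toC m *: u) phi x) x0 = hess phi x0 (toC m *: u) w.
  by rewrite -E; exact: (deriveE w d).
pose psi x := 'D_w phi x.
have dpsi (z : K) : unit_disc z -> differentiable psi (x0 + z *: (toC m *: u)).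
  move=> z1; apply/dD/rO; apply: le_lt_trans (_ : r / 16 < _); last lra.
  by rewrite addrAC subrr add0r nrmZ; apply: le_trans (ltW hm); rewrite ler_piMl ?nrm_ge0.
have E2 : hess phi x0 (toC m *: u) w = 'D_1 (fun z : K => psi (x0 + z *: (toC m *: u))) 0.
  rewrite cauchy_funE // => z /dpsi dz.
  by have [] := is_derive_line dz.
have d0 : differentiable psi (x0 + (0 : K) *: (toC m *: u)).
  by apply: dpsi; rewrite /unit_disc /= nrm0.
have [_ E3] := is_derive_line d0.
rewrite scale0r addr0 in E3.
have d1 : differentiable psi x0 by exact: dD.
apply: (mulfI mn0); apply: (etrans (esym Eu)); apply: (etrans E1); apply: (etrans E2).
by apply: (etrans E3); exact: deriveZv.
Qed.

Section Coordinates.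
Variable n : nat.
Implicit Types f : V -> 'rV[K]_n.

Lemma is_diff_coord (j : 'I_n) (M : 'rV[K]_n) :
  is_diff M (fun N : 'rV[K]_n => N 0 j) (fun N : 'rV[K]_n => N 0 j).
Proof.
apply: (@nrm_is_diff _ _ _ _ _ _ 1).
- by move=> a u v; rewrite !mxE.
- move=> v; rewrite mul1r -toC_le -!nrmE.
  rewrite [X in _ <= X]/Num.norm /= mx_normE -[X in X <= _]nngE num_le.
  exact: (le_bigmax _ (fun ij : 'I_1 * 'I_n => `|v ij.1 ij.2|%:nng) (0, j)).
move=> e e0; exists 1 => // y _; rewrite !mxE subrr nrm0 mulr_ge0 ?nrm_ge0 // ltW //.
Qed.

Lemma differentiable_coordP f x :
  differentiable f x <-> forall j, differentiable (fun y => f y 0 j) x.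
Proof.
split=> [df j|H].
  have [dc _] := is_diff_coord j (f x).
  exact: (differentiable_comp (g := fun N : 'rV[K]_n => N 0 j) df dc).
have -> : f = \sum_(j < n) (fun y => f y 0 j *: (delta_mx 0 j : 'rV[K]_n)).
  apply/funext => y; rewrite [LHS]row_sum_delta fct_sumE.
  by [].
by apply: differentiable_sum => j; apply: differentiableZl.
Qed.

Lemma derive_coord f x v j : differentiable f x -> ('D_v f x) 0 j = 'D_v (fun y => f y 0 j) x.
Proof.
move=> df; have [dc Ec] := is_diff_coord j (f x).
have h := (differentiable_coordP f x).1 df j.
rewrite !deriveE //.
have Hc := diff_comp (f := f) (g := fun N : 'rV[K]_n => N 0 j) df dc.
by apply: (etrans _ (congr1 (fun h => h v) (esym Hc))); rewrite /= Ec.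
Qed.

Lemma differentiable_derive_rV f (O : set V) (u x : V) : open O ->
  (forall x, O x -> differentiable f x) -> O x -> differentiable (fun x => 'D_u f x) x.
Proof.
move=> oO df Ox; apply/differentiable_coordP => j.
apply: (@near_eq_differentiable _ _ _ (fun y => 'D_u (fun y => f y 0 j) y)).
  have : nbhs x O by apply: open_nbhs_nbhs.
  by apply: filterS => y /df dy; rewrite derive_coord.
by apply: (@differentiable_derive _ O) => // y /df dy; exact: ((differentiable_coordP f y).1 dy j).
Qed.

Lemma derive_sym_rV f (O : set V) (u w x : V) : open O ->
  (forall x, O x -> differentiable f x) -> O x ->
  'D_w (fun x => 'D_u f x) x = 'D_u (fun x => 'D_w f x) x.
Proof.
move=> oO df Ox; apply/rowP => j.
have dD v := differentiable_derive_rV v oO df Ox.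
apply: (etrans (derive_coord w j (dD u))); apply: (etrans _ (esym (derive_coord u j (dD w)))).
have near v : \forall y \near x, ('D_v f y) 0 j = 'D_v (fun y => f y 0 j) y.
  have : nbhs x O by apply: open_nbhs_nbhs.
  by apply: filterS => y /df dy; rewrite derive_coord.
apply: (etrans (@near_eq_derive _ _ _ _ _ x w (near u))).
apply: (etrans _ (esym (@near_eq_derive _ _ _ _ _ x u (near w)))).
by apply: (derive_sym (O := O)) => // y /df dy; exact: ((differentiable_coordP f y).1 dy j).
Qed.
End Coordinates.
End HoloThm.

(** * Algebras with a frame of idempotents *)

Section Algebra.
Variables (K : fieldType) (n' : nat).
Local Notation n := n'.+1.
Local Notation V := 'rV[K]_n.

Record unital_algebra (m : V -> V -> V) (e : V) : Prop := UnitalAlgebra {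
  ua_linear : forall u, linear (m u);
  ua_comm : forall u v, m u v = m v u;
  ua_assoc : forall u v w, m u (m v w) = m (m u v) w;
  ua_unit : forall u, m e u = u }.

Variables (m : V -> V -> V) (e : V).
Hypothesis ua : unital_algebra m e.

Lemma mulaD u v w : m u (v + w) = m u v + m u w.
Proof. by have := ua_linear ua u 1 v w; rewrite !scale1r. Qed.
Lemma mula0 u : m u 0 = 0.
Proof. by apply: (addrI (m u 0)); rewrite -mulaD !addr0. Qed.
Lemma mulaZ u a v : m u (a *: v) = a *: m u v.
Proof. by have := ua_linear ua u a v 0; rewrite !addr0 mula0 addr0. Qed.
Lemma mulaDl u v w : m (u + v) w = m u w + m v w.
Proof. by rewrite ![m _ w](ua_comm ua) mulaD. Qed.
Lemma mulaZl u a v : m (a *: u) v = a *: m u v.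
Proof. by rewrite ![m _ v](ua_comm ua) mulaZ. Qed.
Lemma mula0l u : m 0 u = 0.
Proof. by rewrite (ua_comm ua) mula0. Qed.
Lemma mula_sum u (I : finType) (f : I -> V) : m u (\sum_i f i) = \sum_i m u (f i).
Proof. exact: (big_morph (m u) (mulaD u) (mula0 u)). Qed.

(** Multiplication by u, acting on row vectors from the right. *)
Definition mulmat (u : V) : 'M[K]_n := \matrix_(i, j) (m u (delta_mx 0 i)) 0 j.

Lemma mulmatE u v : v *m mulmat u = m u v.
Proof.
rewrite [v in RHS]row_sum_delta mula_sum; apply/rowP => j; rewrite mxE summxE.
by apply: eq_bigr => i _; rewrite mulaZ !mxE.
Qed.

Lemma mulmat_ext (A : 'M[K]_n) u : (forall v, v *m A = m u v) -> mulmat u = A.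
Proof. by move=> H; apply/row_matrixP => i; rewrite !rowE mulmatE H. Qed.

Lemma mulmat_mul u v : mulmat (m u v) = mulmat u *m mulmat v.
Proof.
by apply: mulmat_ext => w; rewrite mulmxA !mulmatE (ua_assoc ua) (ua_comm ua v).
Qed.
Lemma mulmatC u v : mulmat u *m mulmat v = mulmat v *m mulmat u.
Proof. by rewrite -!mulmat_mul (ua_comm ua). Qed.
Lemma mulmatD u v : mulmat (u + v) = mulmat u + mulmat v.
Proof. by apply: mulmat_ext => w; rewrite mulmxDr !mulmatE mulaDl. Qed.
Lemma mulmatZ a u : mulmat (a *: u) = a *: mulmat u.
Proof. by apply: mulmat_ext => w; rewrite -scalemxAr !mulmatE mulaZl. Qed.
Lemma mulmat_sum u : mulmat u = \sum_i u 0 i *: mulmat (delta_mx 0 i).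
Proof.
rewrite {1}(row_sum_delta u).
rewrite (big_morph mulmat mulmatD (_ : mulmat 0 = 0)); last first.
  by apply: mulmat_ext => w; rewrite mulmx0 mula0l.
by apply: eq_bigr => i _; rewrite mulmatZ.
Qed.

(** The trace form of the algebra. Over an algebraically closed field it is
    non-degenerate exactly if the algebra has a frame of idempotents, which
    makes semi-simplicity the non-vanishing of a determinant. *)
Definition trform (u v : V) : K := \tr (mulmat (m u v)).

Definition nondeg (T : V -> V -> K) := forall u, (forall v, T u v = 0) -> u = 0.

Section Frame.
Variable F : 'M[K]_n.
Hypothesis idF : idempotent_frame m F.

(** Coordinates with respect to the frame F. *)
Definition fcoord (u : V) : V := u *m invmx F.

Lemma fcoordK u : fcoord u *m F = u.
Proof. by case: idF => uF _; rewrite /fcoord mulmxKV. Qed.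
Lemma fcoord_row i : fcoord (row i F) = delta_mx 0 i.
Proof. by case: idF => uF _; rewrite /fcoord rowE mulmxK. Qed.
Lemma fcoordZ a u : fcoord (a *: u) = a *: fcoord u.
Proof. by rewrite /fcoord scalemxAl. Qed.
Lemma fcoord_sum u : u = \sum_i fcoord u 0 i *: row i F.
Proof. by rewrite -{1}(fcoordK u) mulmx_sum_row. Qed.

(** Every idempotent of the frame spans a line that is an ideal. *)
Lemma frame_mul_row u i : m u (row i F) = fcoord u 0 i *: row i F.
Proof.
have [_ H] := idF.
rewrite (ua_comm ua) {1}(fcoord_sum u) mula_sum (bigD1 i) //= big1 ?addr0.
  by rewrite mulaZ H eqxx.
by move=> j ji; rewrite mulaZ H eq_sym (negbTE ji) scaler0.
Qed.

Lemma fcoord_mul u v i : fcoord (m u v) 0 i = fcoord u 0 i * fcoord v 0 i.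
Proof.
have H : m (m u v) (row i F) = m u (m v (row i F)) by rewrite (ua_assoc ua).
move: H; rewrite !frame_mul_row mulaZ frame_mul_row scalerA => /(congr1 fcoord).
rewrite !fcoordZ fcoord_row => /rowP/(_ i).
by rewrite !mxE !eqxx !mulr1 mulrC.
Qed.

Lemma row_frame_neq0 i : row i F != 0.
Proof.
apply/eqP => r0; have := fcoord_row i; rewrite r0 /fcoord mul0mx => /rowP/(_ i).
by rewrite !mxE !eqxx => /esym/eqP; rewrite oner_eq0.
Qed.

Lemma fcoord_unit i : fcoord e 0 i = 1.
Proof.
have := frame_mul_row e i; rewrite (ua_unit ua) -{1}[row i F]scale1r => /eqP.
rewrite -subr_eq0 -scalerBl scaler_eq0 (negbTE (row_frame_neq0 i)) orbF subr_eq0.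
by move=> /eqP.
Qed.

Lemma unit_frame_sum : e = \sum_i row i F.
Proof.
rewrite {1}(fcoord_sum e); apply: eq_bigr => i _.
by rewrite fcoord_unit scale1r.
Qed.

Lemma trform_frame u v : trform u v = \sum_i fcoord u 0 i * fcoord v 0 i.
Proof.
have [uF _] := idF; rewrite /trform.
have -> : mulmat (m u v) = invmx F *m diag_mx (fcoord (m u v)) *m F.
  apply: mulmat_ext => w; rewrite !mulmxA -/(fcoord w).
  rewrite [m _ w]fcoord_sum mulmx_sum_row; apply: eq_bigr => i _; congr (_ *: _).
  by rewrite fcoord_mul mul_mx_diag mxE mulrC.
rewrite mxtrace_mulC mulmxA mulmxV // mul1mx mxtrace_diag.
by apply: eq_bigr => i _; rewrite fcoord_mul.
Qed.

Lemma deltaE (i j : 'I_n) : (delta_mx 0 i : V) 0 j = (j == i)%:R.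
Proof. by rewrite mxE eqxx. Qed.

Lemma frame_nondeg : nondeg trform.
Proof.
move=> u H; rewrite (fcoord_sum u) big1 // => i _.
have := H (row i F); rewrite trform_frame (bigD1 i) //= fcoord_row.
rewrite [X in _ + X]big1 => [|j ji]; first by rewrite deltaE eqxx mulr1 addr0 => ->; rewrite scale0r.
by rewrite deltaE (negbTE ji) mulr0.
Qed.

(** An ideal contains each e_i along which one of its elements has a non-zero
    coordinate, so it is spanned by part of the frame, and the remaining e_i
    span a complement. *)
Lemma frame_semisimple : semisimple_algebra m.
Proof.
move=> I idI.
pose J : {vspace V} := (\sum_(i | row i F \notin I) <[row i F]>)%VS.
have idJ : ideal_of_algebra m J.
  move=> a v /memv_sumP[w Hw ->]; rewrite big_mkcond /= mula_sum.
  apply: memv_suml => i _; case: ifP => [Hi|]; last by rewrite mula0 mem0v.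
  apply: (subvP (sumv_sup i Hi (subvv _))).
  by have /vlineP[k ->] := Hw i Hi; rewrite mulaZ frame_mul_row !memvZ // memv_line.
have fI i v : v \in I -> fcoord v 0 i != 0 -> row i F \in I.
  move=> vI v0; have := idI (row i F) v vI; rewrite (ua_comm ua) frame_mul_row.
  by move=> /(memvZ (fcoord v 0 i)^-1); rewrite scalerA mulVf // scale1r.
exists J; split => //.
  apply/eqP; rewrite eqEsubv subvf /=; apply/subvP => v _; rewrite (fcoord_sum v).
  apply: memv_suml => i _; apply: memvZ.
  have [h|h] := boolP (row i F \in I).
    exact: (subvP (addvSl _ _)).
  by apply: (subvP (addvSr _ _)); apply: (subvP (sumv_sup i h (subvv _))); rewrite memv_line.
apply/eqP; rewrite -subv0; apply/subvP => v; rewrite memv_cap => /andP[vI vJ].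
rewrite memv0 (fcoord_sum v) big1 // => i _.
have [->|h] := eqVneq (fcoord v 0 i) 0; first by rewrite scale0r.
have fi := fI i v vI h; case/negP: h; apply/eqP.
case/memv_sumP: vJ => w Hw ->.
rewrite /fcoord mulmx_suml summxE big1 // => j Hj.
have /vlineP[k ->] := Hw j Hj; rewrite -scalemxAl -/(fcoord (row j F)) fcoord_row !mxE.
have [ij|_] := eqVneq i j; first by rewrite -ij fi in Hj.
by rewrite andbF mulr0.
Qed.
End Frame.
End Algebra.

(** * Existence of idempotent frames *)

Section Nilpotent.
Variables (K : closedFieldType) (n' : nat).
Local Notation n := n'.+1.

(** All eigenvalues are zero, so the characteristic polynomial is X^n. *)
Lemma trace_nilpotent (A : 'M[K]_n) k : A ^+ k = 0 -> \tr A = 0.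
Proof.
move=> Ak.
have ev a : eigenvalue A a -> a = 0.
  move=> /eigenvalueP[v vA v0]; have H j : v *m A ^+ j = a ^+ j *: v.
    elim: j => [|j IH]; first by rewrite expr0 mulmx1 scale1r.
    by rewrite exprSr mulmxA IH -scalemxAl vA scalerA exprSr.
  have := H k; rewrite Ak mulmx0 => /esym/eqP; rewrite scaler_eq0 (negbTE v0) orbF.
  by rewrite expf_eq0 => /andP[_ /eqP].
have [r Er] := closed_field_poly_normal (char_poly A).
rewrite (monicP (char_poly_monic A)) scale1r in Er.
have r0 : forall z, z \in r -> z = 0.
  by move=> z zr; apply: ev; rewrite eigenvalue_root_char Er root_prod_XsubC.
have E : char_poly A = 'X^n.
  have szr : size r = n.
    by have := size_char_poly A; rewrite Er size_prod_XsubC => -[].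
  rewrite Er (eq_big_seq (fun=> 'X)); last by move=> z /r0 ->; rewrite subr0.
  by rewrite big_const_seq count_predT iter_mulr_1 szr.
have := char_poly_trace A (ltn0Sn n'); rewrite E coefXn /= eqn_leq ltnn andbF.
by move=> /esym/eqP; rewrite oppr_eq0 => /eqP.
Qed.
End Nilpotent.

Section Existence.
Variables (K : closedFieldType) (n' : nat).
Local Notation n := n'.+1.
Local Notation V := 'rV[K]_n.
Variables (m : V -> V -> V) (e : V).
Hypothesis ua : unital_algebra m e.
Hypothesis nd : nondeg (trform m).

(** The polynomials in a multiplication operator are multiplication operators
    themselves. *)
Lemma horner_mulmat (u : V) (p : {poly K}) :
  horner_mx (mulmat m u) p = mulmat m (e *m horner_mx (mulmat m u) p).
Proof.
set P := horner_mx _ _; apply/esym; apply: (mulmat_ext ua) => v.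
rewrite -[in LHS](ua_unit ua v) (ua_comm ua e v) -(mulmatE ua) -mulmxA.
have C : mulmat m v *m P = P *m mulmat m v.
  by apply: comm_mx_horner; rewrite /comm_mx (mulmatC ua).
by rewrite C mulmxA (mulmatE ua) (ua_comm ua).
Qed.

(** An algebra with non-degenerate trace form has no nilpotent elements: the
    product of a nilpotent element with anything is nilpotent, hence
    traceless. *)
Lemma horner_nilpotent (u : V) (p : {poly K}) k :
  horner_mx (mulmat m u) p ^+ k = 0 -> horner_mx (mulmat m u) p = 0.
Proof.
move=> Pk; rewrite horner_mulmat; set w := e *m _.
suff -> : w = 0 by apply: (mulmat_ext ua) => v; rewrite mulmx0 (mula0l ua).
apply: nd => v; apply: (@trace_nilpotent _ _ _ k).
have -> : mulmat m (m w v) = horner_mx (mulmat m u) p * mulmat m v.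
  by rewrite (mulmat_mul ua) -horner_mulmat.
have C : GRing.comm (horner_mx (mulmat m u) p) (mulmat m v).
  apply/esym; apply: comm_mx_horner; rewrite /comm_mx (mulmatC ua) //.
by rewrite exprMn_comm // Pk mul0r.
Qed.

(** A power of the squarefree part of the minimal polynomial kills the
    operator; in the absence of nilpotents the squarefree part does so too. *)
Lemma mulmat_diagonalizable (u : V) : diagonalizable (mulmat m u).
Proof.
apply/diagonalizableP.
have [r Er] := closed_field_poly_normal (mxminpoly (mulmat m u)).
exists (undup r); first exact: undup_uniq.
rewrite dvd_mxminpoly; apply/eqP; apply: (@horner_nilpotent _ _ (size r)).
rewrite -rmorphXn /=; apply/mxminpoly_minP.
rewrite Er (monicP (mxminpoly_monic _)) scale1r.
have sub : {subset r <= undup r} by move=> z; rewrite mem_undup.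
move: (undup r) sub (undup_uniq r) => q sub uq {Er}.
elim: r sub => [|z r IH] sub; first by rewrite big_nil expr0.
rewrite big_cons exprS dvdp_mul //; last by apply: IH => y yr; apply: sub; rewrite inE yr orbT.
by rewrite dvdp_XsubCl root_prod_XsubC sub // mem_head.
Qed.

(** The multiplication operators commute and are diagonalizable, hence have a
    common basis of eigenvectors; products of two different members of this
    basis are proportional to both and vanish, and each member can be rescaled
    to an idempotent because the unity has a component along it. *)
Lemma exists_frame : exists F : 'M[K]_n, idempotent_frame m F.
Proof.
pose As := [seq mulmat m (delta_mx 0 i) | i <- enum 'I_n].
have [|P uP /allP HP] := (codiagonalizableP As).1.
  split=> [A B /mapP[i _ ->] /mapP[j _ ->]|A /mapP[i _ ->]]; first exact: (mulmatC ua).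
  exact: mulmat_diagonalizable.
have PA i : exists d, P *m mulmat m (delta_mx 0 i) = diag_mx d *m P.
  have /HP /= : mulmat m (delta_mx 0 i) \in As by apply/map_f; rewrite mem_enum.
  move=> /diagonalizable_forPex[d /simmxPp E]; exists d; apply: E.
  by rewrite stablemx_unit.
have ev u i : exists c, m u (row i P) = c *: row i P.
  have [d Hd] : exists d : 'I_n -> V, forall j, P *m mulmat m (delta_mx 0 j) = diag_mx (d j) *m P.
    have /choice[d Hd] := PA; by exists d.
  exists (\sum_j u 0 j * d j 0 i).
  rewrite -(mulmatE ua) (mulmat_sum ua) mulmx_sumr scaler_suml; apply: eq_bigr => j _.
  rewrite -scalemxAr -row_mul Hd row_mul row_diag_mx -scalemxAl -rowE scalerA //.
have /choice[c Hc] : forall ui : V * 'I_n, exists c, m ui.1 (row ui.2 P) = c *: row ui.2 P.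
  by move=> [u i]; exact: ev.
have indep (a b : K) i j : i != j -> a *: row i P = b *: row j P -> a = 0.
  move=> ij /(congr1 (fun v => v *m invmx P)); rewrite -!scalemxAl !rowE !mulmxK //.
  by move=> /rowP/(_ i); rewrite !mxE !eqxx (negbTE ij) mulr1 mulr0.
have ij0 i j : i != j -> m (row i P) (row j P) = 0.
  move=> ij; have H1 := Hc (row i P, j); have H2 := Hc (row j P, i).
  rewrite /= in H1 H2; rewrite H1.
  suff -> : c (row i P, j) = 0 by rewrite scale0r.
  by apply: (indep _ (c (row j P, i)) j i); [rewrite eq_sym | rewrite -H1 -H2 (ua_comm ua)].
have r0 i : row i P != 0.
  apply/eqP => /(congr1 (fun v => v *m invmx P)); rewrite rowE mulmxK // mul0mx.
  by move=> /rowP/(_ i); rewrite !mxE !eqxx => /eqP; rewrite oner_eq0.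
have cii i : c (row i P, i) != 0.
  apply/eqP => c0; have Ei := Hc (row i P, i); rewrite /= c0 scale0r in Ei.
  have := ua_unit ua (row i P); rewrite (ua_comm ua).
  have -> : e = \sum_j (e *m invmx P) 0 j *: row j P by rewrite -mulmx_sum_row mulmxKV.
  rewrite (mula_sum ua) big1 => [|j _]; first by move/esym/eqP; rewrite (negbTE (r0 i)).
  rewrite (mulaZ ua); have [<-|ij] := eqVneq i j; first by rewrite Ei scaler0.
  by rewrite ij0 // scaler0.
pose F := diag_mx (\row_i (c (row i P, i))^-1) *m P.
have rF i : row i F = (c (row i P, i))^-1 *: row i P.
  by rewrite /F row_mul row_diag_mx -scalemxAl -rowE mxE.
exists F; split.
  rewrite unitmx_mul uP andbT unitmxE det_diag unitfE; apply/prodf_neq0 => i _.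
  by rewrite mxE invr_eq0.
move=> i j; rewrite !rF (mulaZ ua) (mulaZl ua); have [<-|ij] := eqVneq i j.
  have E := Hc (row i P, i); rewrite /= in E.
  by rewrite E !scalerA mulfVK.
by rewrite ij0 // !scaler0.
Qed.
End Existence.

(** * Determinants and Gram determinants in dimension three *)

Section Dim3.
Variable K : fieldType.
Local Notation V := 'rV[K]_3.

Definition o0 : 'I_3 := @Ordinal 3 0 isT.
Definition o1 : 'I_3 := @Ordinal 3 1 isT.
Definition o2 : 'I_3 := @Ordinal 3 2 isT.

Lemma sum3 (U : nmodType) (f : 'I_3 -> U) : \sum_i f i = f o0 + f o1 + f o2.
Proof.
rewrite !big_ord_recr big_ord0 /= add0r; congr (f _ + f _ + f _); exact: val_inj.
Qed.

Lemma ord3P (i : 'I_3) : [\/ i = o0, i = o1 | i = o2].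
Proof.
case: i => [[|[|[|k]]] Hk] //; [apply: Or31|apply: Or32|apply: Or33]; exact: val_inj.
Qed.

Definition det3 (a b c : V) : K :=
  a 0 o0 * (b 0 o1 * c 0 o2 - b 0 o2 * c 0 o1)
  - a 0 o1 * (b 0 o0 * c 0 o2 - b 0 o2 * c 0 o0)
  + a 0 o2 * (b 0 o0 * c 0 o1 - b 0 o1 * c 0 o0).

Lemma row3P (u v : V) : u 0 o0 = v 0 o0 -> u 0 o1 = v 0 o1 -> u 0 o2 = v 0 o2 -> u = v.
Proof. by move=> h0 h1 h2; apply/rowP => i; case: (ord3P i) => ->. Qed.

Lemma cramer3 a b c v :
  det3 a b c *: v = det3 v b c *: a + det3 a v c *: b + det3 a b v *: c.
Proof. by apply: row3P; rewrite !mxE /det3; ring. Qed.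

Lemma cramer_div a b c v : det3 a b c != 0 ->
  (det3 v b c / det3 a b c) *: a + (det3 a v c / det3 a b c) *: b =
  v - (det3 a b v / det3 a b c) *: c.
Proof.
move=> d0; apply: (scalerI d0).
have H z : det3 a b c * (z / det3 a b c) = z by rewrite mulrC divfK.
by rewrite scalerDr scalerBr !scalerA !H (cramer3 a b c v) addrK.
Qed.

Lemma det3_derivation (B : 'M[K]_3) a b c :
  det3 (a *m B) b c + det3 a (b *m B) c + det3 a b (c *m B) = \tr B * det3 a b c.
Proof. by rewrite /det3 /mxtrace !mxE !sum3; ring. Qed.

(** Multiples of a in the second argument and of b in the third drop out, and
    the two terms of weight q cancel; this removes the unknown multiples of e
    from the evolution of the cubic. *)
Lemma det3_shear3 (a b c a' b' c' : V) (q p : K) :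
  det3 (a' - q *: a) b c + det3 a (b' - p *: a) c + det3 a b (c' + q *: c - (p + p) *: b) =
  det3 a' b c + det3 a b' c + det3 a b c'.
Proof. by rewrite /det3 !mxE; ring. Qed.

Lemma det3_shear2 (a b c a' b' c' : V) (q p p' : K) :
  det3 (a' - q *: a) b c + det3 a (b' - p *: a) c + det3 a b (c' - p' *: a) =
  det3 a' b c + det3 a b' c + det3 a b c' - q * det3 a b c.
Proof. by rewrite /det3 !mxE; ring. Qed.

Lemma cubic_arith (p q r s : V) (eta k0 : K) :
  p - eta *: q + (p - eta *: q) + (r - p - p + k0 *: s) = r + k0 *: s - (eta + eta) *: q.
Proof. by apply: row3P; rewrite !mxE; ring. Qed.

Definition rows3 (a b c : V) : 'M[K]_3 := \matrix_(i, j) (if i == o0 then a 0 j else if i == o1 then b 0 j else c 0 j).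

Lemma mul_rows3 (v : V) a b c : v *m rows3 a b c = v 0 o0 *: a + v 0 o1 *: b + v 0 o2 *: c.
Proof. by apply/rowP => j; rewrite !mxE sum3 !mxE. Qed.

Lemma det_rows3 a b c : \det (rows3 a b c) = det3 a b c.
Proof.
have E (M : 'M[K]_3) : \det M = M o0 o0 * (M o1 o1 * M o2 o2 - M o1 o2 * M o2 o1)
  - M o0 o1 * (M o1 o0 * M o2 o2 - M o1 o2 * M o2 o0)
  + M o0 o2 * (M o1 o0 * M o2 o1 - M o1 o1 * M o2 o0).
  rewrite (expand_det_row _ o0) sum3 /cofactor.
  rewrite !(expand_det_row _ ord0) /cofactor !big_ord_recl !big_ord0 !det_mx11 !mxE.
  have l00 : lift o0 (0 : 'I_2) = o1 by apply: val_inj.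
  have l01 : lift o0 (lift 0 0 : 'I_2) = o2 by apply: val_inj.
  have l10 : lift o1 (0 : 'I_2) = o0 by apply: val_inj.
  have l11 : lift o1 (lift 0 0 : 'I_2) = o2 by apply: val_inj.
  have l20 : lift o2 (0 : 'I_2) = o0 by apply: val_inj.
  have l21 : lift o2 (lift 0 0 : 'I_2) = o1 by apply: val_inj.
  have k0 : lift (0 : 'I_2) (0 : 'I_1) = lift 0 0 by apply: val_inj.
  have k1 : lift (lift 0 0 : 'I_2) (0 : 'I_1) = 0 by apply: val_inj.
  rewrite ?k0 ?k1 ?l00 ?l01 ?l10 ?l11 ?l20 ?l21 /= /bump /= !expr0 ?expr1 ?expr2.
  ring.
by rewrite E !mxE.
Qed.

Lemma det3_neq0 a b c : (forall x y z, x *: a + y *: b + z *: c = 0 -> [/\ x = 0, y = 0 & z = 0]) ->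
  det3 a b c != 0.
Proof.
move=> H; rewrite -det_rows3; apply/negP => /det0P[v v0]; rewrite mul_rows3 => /H[h0 h1 h2].
by case/negP: v0; apply/eqP; apply: row3P; rewrite mxE.
Qed.

Lemma det3_indep a b c x y z : det3 a b c != 0 -> x *: a + y *: b + z *: c = 0 ->
  [/\ x = 0, y = 0 & z = 0].
Proof.
move=> d0 E.
have E1 : det3 (x *: a + y *: b + z *: c) b c = x * det3 a b c by rewrite /det3 !mxE; ring.
have E2 : det3 a (x *: a + y *: b + z *: c) c = y * det3 a b c by rewrite /det3 !mxE; ring.
have E3 : det3 a b (x *: a + y *: b + z *: c) = z * det3 a b c by rewrite /det3 !mxE; ring.
have Z1 : det3 0 b c = 0 by rewrite /det3 !mxE; ring.
have Z2 : det3 a 0 c = 0 by rewrite /det3 !mxE; ring.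
have Z3 : det3 a b 0 = 0 by rewrite /det3 !mxE; ring.
split; apply: (mulIf d0); rewrite mul0r.
- by rewrite -E1 E.
- by rewrite -E2 E.
- by rewrite -E3 E.
Qed.

Lemma cramer_unique a b c v0 v1 p0 p1 x y w : det3 a b c != 0 ->
  v0 *: a + v1 *: b = w - x *: c -> p0 *: a + p1 *: b = w - y *: c -> v0 = p0 /\ v1 = p1.
Proof.
move=> d0 H1 H2; have Z : (v0 - p0) *: a + (v1 - p1) *: b + (x - y) *: c = 0.
  have -> : (v0 - p0) *: a + (v1 - p1) *: b + (x - y) *: c =
    (v0 *: a + v1 *: b) - (p0 *: a + p1 *: b) + (x - y) *: c.
    by apply: row3P; rewrite !mxE; ring.
  by rewrite H1 H2; apply: row3P; rewrite !mxE; ring.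
by have [/eqP + /eqP + _] := det3_indep d0 Z; rewrite !subr_eq0 => /eqP -> /eqP ->.
Qed.

Definition bilin (T : V -> V -> K) := (forall u, scalar (T u)) /\ (forall v, scalar (T^~ v)).
Definition gramrow (T : V -> V -> K) (i : 'I_3) : V := \row_j T (delta_mx 0 i) (delta_mx 0 j).
Definition gram (T : V -> V -> K) : K := det3 (gramrow T o0) (gramrow T o1) (gramrow T o2).

Lemma scalar_sum (f : V -> K) (v : V) : scalar f -> f v = \sum_j v 0 j * f (delta_mx 0 j).
Proof.
move=> lf; have fD u w : f (u + w) = f u + f w by have := lf 1 u w; rewrite scale1r mul1r.
have f0 : f 0 = 0 by apply: (addrI (f 0)); rewrite -fD !addr0.
have fZ a u : f (a *: u) = a * f u by have := lf a u 0; rewrite !addr0 f0 addr0.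
rewrite {1}(row_sum_delta v) (big_morph f fD f0).
by apply: eq_bigr => j _; rewrite fZ.
Qed.

Lemma bilin_sum T u v : bilin T -> T u v = \sum_i \sum_j u 0 i * v 0 j * T (delta_mx 0 i) (delta_mx 0 j).
Proof.
move=> [T1 T2]; rewrite (scalar_sum u (T2 v)); apply: eq_bigr => i _.
rewrite (scalar_sum v (T1 _)) mulr_sumr; apply: eq_bigr => j _; ring.
Qed.

Lemma gram_neq0 T : bilin T -> nondeg T -> gram T != 0.
Proof.
move=> bT nT; apply: det3_neq0 => x y z E.
pose u : V := \row_i (if i == o0 then x else if i == o1 then y else z).
have u0 : u = 0.
  apply: nT => v; rewrite (bilin_sum _ _ bT) exchange_big /= big1 // => j _.
  have := congr1 (fun w : V => w 0 j) E; rewrite !mxE => Ej.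
  rewrite sum3 !mxE /=.
  have -> : forall p q r s, x * s * p + y * s * q + z * s * r = s * (x * p + y * q + z * r) by move=> *; ring.
  by rewrite Ej mulr0.
by split; [have := congr1 (fun w : V => w 0 o0) u0 | have := congr1 (fun w : V => w 0 o1) u0 |
  have := congr1 (fun w : V => w 0 o2) u0]; rewrite !mxE.
Qed.

Lemma gram_nondeg T : bilin T -> gram T != 0 -> nondeg T.
Proof.
move=> bT gT u H.
have E : u 0 o0 *: gramrow T o0 + u 0 o1 *: gramrow T o1 + u 0 o2 *: gramrow T o2 = 0.
  apply/rowP => j; rewrite !mxE -(H (delta_mx 0 j)).
  by have [_ T2] := bT; rewrite (scalar_sum u (T2 _)) sum3.
by have [h0 h1 h2] := det3_indep gT E; apply: row3P; rewrite mxE.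
Qed.

(** The terms B t and t B^T contribute tr B each; the factor found here is the
    rate at which Gram determinants evolve. *)
Lemma gram_derivation (t : 'M[K]_3) (B : 'M[K]_3) c :
  let t' := c *: t - B *m t - t *m B^T in
  det3 (row o0 t') (row o1 t) (row o2 t) + det3 (row o0 t) (row o1 t') (row o2 t) +
  det3 (row o0 t) (row o1 t) (row o2 t') =
  (3%:R * c - 2%:R * \tr B) * det3 (row o0 t) (row o1 t) (row o2 t).
Proof. by rewrite /det3 /mxtrace !mxE !sum3 !mxE; ring. Qed.

Section WebCubic.
Variables (m : V -> V -> V) (e : V).
Hypothesis ua : unital_algebra m e.
Variable F : 'M[K]_3.
Hypothesis idF : idempotent_frame m F.

Lemma frame_det3 : det3 (row o0 F) (row o1 F) (row o2 F) != 0.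
Proof.
apply: det3_neq0 => x y z /(congr1 (fun v => v *m invmx F)).
have [uF _] := idF.
rewrite mul0mx !mulmxDl -!scalemxAl !rowE !mulmxK // => /rowP H.
by split; [have := H o0 | have := H o1 | have := H o2];
  rewrite !mxE /= !mulr1 !mulr0 ?addr0 ?add0r.
Qed.

(** In frame coordinates the determinant is the Vandermonde product of the
    coordinates of u, and two coordinates of u agree exactly if u lies in a
    plane spanned by e and an idempotent. The left-hand side does not mention
    the frame, which makes it meaningful and holomorphic at all points. *)
Lemma web_cubicP u : det3 e u (m u u) = 0 <->
  exists (k : 'I_3) (a b : K), u = a *: e + b *: row k F.
Proof.
split; last first.
  move=> [k [a [b ->]]].
  have -> : m (a *: e + b *: row k F) (a *: e + b *: row k F) =
     a ^+ 2 *: e + (2%:R * a * b + b ^+ 2) *: row k F.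
    have [_ H] := idF; have := H k k; rewrite eqxx => Hk.
    rewrite (mulaD ua) !(mulaZ ua) !(mulaDl ua) !(mulaZl ua) !(ua_unit ua) (ua_comm ua _ e) (ua_unit ua) Hk.
    by apply: row3P; rewrite !mxE; ring.
  by rewrite /det3 !mxE; ring.
move=> Q0.
pose c := fcoord F u.
have Eu : u = c 0 o0 *: row o0 F + c 0 o1 *: row o1 F + c 0 o2 *: row o2 F.
  by rewrite {1}(fcoord_sum idF u) sum3.
have Euu : m u u = c 0 o0 ^+ 2 *: row o0 F + c 0 o1 ^+ 2 *: row o1 F + c 0 o2 ^+ 2 *: row o2 F.
  by rewrite (fcoord_sum idF (m u u)) sum3 !(fcoord_mul ua idF) -!expr2.
have Ee : e = row o0 F + row o1 F + row o2 F by rewrite (unit_frame_sum ua idF) sum3.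
move: c Eu Euu => c Eu Euu.
have : (c 0 o1 - c 0 o0) * (c 0 o2 - c 0 o0) * (c 0 o2 - c 0 o1) *
  det3 (row o0 F) (row o1 F) (row o2 F) = 0.
  rewrite -[RHS]Q0 Euu Eu Ee /det3 !mxE.
  by move: (c 0 o0) (c 0 o1) (c 0 o2) => x y z; ring.
move=> /eqP; rewrite !mulf_eq0 (negbTE frame_det3) orbF !subr_eq0 => /orP[/orP[]|] /eqP E.
- exists o2, (c 0 o0), (c 0 o2 - c 0 o0); rewrite Eu E Ee.
  by apply: row3P; rewrite !mxE; ring.
- exists o1, (c 0 o0), (c 0 o1 - c 0 o0); rewrite Eu E Ee.
  by apply: row3P; rewrite !mxE; ring.
- exists o0, (c 0 o1), (c 0 o0 - c 0 o1); rewrite Eu E Ee.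
  by apply: row3P; rewrite !mxE; ring.
Qed.
End WebCubic.
End Dim3.

(** * Differentiation along complex curves *)

Section Ode.
Variable R : realType.
Local Notation K := (C R).
Local Notation toC := (@toC R).

Lemma is_derive_expRl (a t : R) : is_derive t 1 (fun s => expR (a * s)) (expR (a * t) * a).
Proof.
have H : is_derive t 1 (fun s : R => a * s) a.
  by have := is_derive_affine 0 a t; under eq_fun do rewrite add0r.
exact: (@is_derive1_comp R expR (fun s => a * s) t _ _ (is_derive_expR (a * t)) H).
Qed.

(** On the segment from 0 to t the function |nu|^2 exp (-2 Re (c t) s) of the
    real parameter s has derivative zero. *)
Lemma ode_zero (nu : K -> K) (c : K) (r : R) (t : K) :
  (forall z : K, nrm z < r -> is_derive z 1 nu (c * nu z)) -> nrm t < r ->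
  (nu t = 0 <-> nu 0 = 0).
Proof.
move=> dnu tr.
have seg_in (s : R) : 0 <= s <= 1 -> nrm (toC s * t) < r.
  move=> /andP[s0 s1]; apply: le_lt_trans tr; rewrite nrmM nrm_toC ger0_norm //.
  by rewrite ler_piMl ?nrm_ge0.
pose a s := complex.Re (nu (0 + toC s * t)); pose b s := complex.Im (nu (0 + toC s * t)).
pose q := complex.Re (c * t); pose p := complex.Im (c * t).
have da (s : R) : 0 <= s <= 1 -> is_derive s 1 a (q * a s - p * b s).
  move=> s01; have H : is_derive (0 + toC s * t) 1 nu (c * nu (0 + toC s * t)).
    by apply: dnu; rewrite add0r seg_in.
  have := derivable_Re H; rewrite mulrAC cReM; exact.
have db (s : R) : 0 <= s <= 1 -> is_derive s 1 b (q * b s + p * a s).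
  move=> s01; have H : is_derive (0 + toC s * t) 1 nu (c * nu (0 + toC s * t)).
    by apply: dnu; rewrite add0r seg_in.
  have := derivable_Im H; rewrite mulrAC cImM; exact.
(* The exponential compensates the growth rate 2 q of |nu|^2. *)
pose N s := (a s * a s + b s * b s) * expR (- (2 * q) * s).
have dN (s : R) : 0 <= s <= 1 -> is_derive s 1 N 0.
  move=> s01; have Ha := da s s01; have Hb := db s s01; have He := is_derive_expRl (- (2 * q)) s.
  have H1 := is_deriveM Ha Ha; have H2 := is_deriveM Hb Hb; have H3 := is_deriveD H1 H2.
  have H4 := is_deriveM H3 He.
  apply: (@is_derive_eq _ _ _ N s 1 _ _ H4).
  rewrite /GRing.scale /= -!/(a s) -!/(b s); set x := expR _.
  have -> : (a * a + b * b) s = a s * a s + b s * b s by [].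
  ring.
have [s s01 E] := mvt01 (f := fun=> 0) dN.
have N0 : N 0 = a 0 ^+ 2 + b 0 ^+ 2 by rewrite /N mulr0 expR0 mulr1.
have zero s' : a s' = 0 -> b s' = 0 -> nu (toC s' * t) = 0.
  by rewrite /a /b add0r; case: (nu _) => x y /= -> ->.
have N1 : N 1 = N 0 by apply/eqP; rewrite -subr_eq0 E.
have sq0 (x y z : R) : 0 < z -> (x * x + y * y) * z = 0 -> x = 0 /\ y = 0.
  move=> z0 /eqP; rewrite mulf_eq0 (gt_eqF z0) orbF paddr_eq0 ?sqr_ge0 -?expr2 ?sqr_ge0 //.
  by rewrite !sqrf_eq0 => /andP[/eqP -> /eqP ->].
split=> z0.
  have Nz : N 0 = 0.
    by rewrite -N1 /N /a /b add0r toC1 mul1r z0 /= !mulr0 addr0 mul0r.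
  move: (sq0 _ _ _ (expR_gt0 _) Nz) => [a0 b0].
  by have := zero _ a0 b0; rewrite toC0 mul0r.
have Nz : N 1 = 0 by rewrite N1 N0 /a /b toC0 mul0r addr0 z0 /= expr0n addr0.
move: (sq0 _ _ _ (expR_gt0 _) Nz) => [a0 b0].
by have := zero _ a0 b0; rewrite toC1 mul1r.
Qed.
End Ode.

Section Curves.
Variable R : realType.
Local Notation K := (C R).
Local Notation V := 'rV[K]_3.
Implicit Types (t : K) (f g : K -> K).

Lemma curveD f g t l k : is_derive t 1 f l -> is_derive t 1 g k ->
  is_derive t 1 (fun s => f s + g s) (l + k).
Proof. exact: is_deriveD. Qed.
Lemma curveB f g t l k : is_derive t 1 f l -> is_derive t 1 g k ->
  is_derive t 1 (fun s => f s - g s) (l - k).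
Proof. exact: is_deriveB. Qed.
Lemma curveM f g t l k : is_derive t 1 f l -> is_derive t 1 g k ->
  is_derive t 1 (fun s => f s * g s) (l * g t + f t * k).
Proof.
move=> H1 H2; apply: (is_derive_eq (is_deriveM H1 H2)).
by rewrite /GRing.scale /=; ring.
Qed.
Lemma curve_sum n (h : 'I_n -> K -> K) (dh : 'I_n -> K) t :
  (forall i, is_derive t 1 (h i) (dh i)) ->
  is_derive t 1 (fun s => \sum_i h i s) (\sum_i dh i).
Proof.
move=> H; have := is_derive_sum H; congr is_derive; apply/funext => s.
by rewrite fct_sumE.
Qed.

Lemma curve_coord n (x : K -> 'rV[K]_n) (t : K) (x' : 'rV[K]_n) :
  is_derive t 1 x x' <-> forall j, is_derive t 1 (fun s => x s 0 j) (x' 0 j).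
Proof.
split=> [[dx <-] j|H].
  have dx' : differentiable x t by apply/derivable1_diffP.
  have := (differentiable_coordP x t).1 dx' j.
  split; first by apply/derivable1_diffP.
  by rewrite derive_coord.
have dx : differentiable x t.
  by apply/differentiable_coordP => j; apply/derivable1_diffP; case: (H j).
split; first by apply/derivable1_diffP.
by apply/rowP => j; rewrite derive_coord //; case: (H j).
Qed.

Lemma curve_comp (W W' : normedModType K) (f : W -> W') (x : K -> W) (t : K) (x' : W) :
  differentiable f (x t) -> is_derive t 1 x x' -> is_derive t 1 (f \o x) ('D_x' f (x t)).
Proof.
move=> df [dx E]; have dx' : differentiable x t by apply/derivable1_diffP.
have dfx := differentiable_comp dx' df.
split; first by apply/derivable1_diffP.
have E1 : 'D_1 (f \o x) t = 'd (f \o x) t (1 : K) := deriveE _ dfx.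
have E2 : 'D_x' f (x t) = 'd f (x t) x' := deriveE _ df.
have E3 : 'D_1 x t = 'd x t (1 : K) := deriveE _ dx'.
by rewrite E1 E2 diff_comp //= -E3 E.
Qed.

Lemma curve_det3 (a b c : K -> V) (t : K) (a' b' c' : V) :
  is_derive t 1 a a' -> is_derive t 1 b b' -> is_derive t 1 c c' ->
  is_derive t 1 (fun s => det3 (a s) (b s) (c s))
    (det3 a' (b t) (c t) + det3 (a t) b' (c t) + det3 (a t) (b t) c').
Proof.
move=> /curve_coord Ha /curve_coord Hb /curve_coord Hc.
have M2 i j := curveM (Hb i) (Hc j).
have S i j := curveB (M2 i j) (M2 j i).
have P k i j := curveM (Ha k) (S i j).
apply: (is_derive_eq (curveD (curveB (P o0 o1 o2) (P o1 o0 o2)) (P o2 o0 o1))).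
by rewrite /det3; ring.
Qed.

(** Only the components of beta on constant vectors are known to be
    differentiable, so the product rule is applied to the expansion in
    coordinates. *)
Lemma curve_bilin (O : set V) (beta : V -> V -> V -> K) (x u v : K -> V) (t : K) (x' u' v' : V) :
  open O -> (forall y, O y -> bilin (beta y)) ->
  (forall y a b, O y -> differentiable (fun y => beta y a b) y) ->
  O (x t) -> is_derive t 1 x x' -> is_derive t 1 u u' -> is_derive t 1 v v' ->
  is_derive t 1 (fun s => beta (x s) (u s) (v s))
    (beta (x t) u' (v t) + beta (x t) (u t) v' + 'D_x' (fun y => beta y (u t) (v t)) (x t)).
Proof.
move=> oO bb db Ox dx /curve_coord du /curve_coord dv.
pose d i : V := delta_mx 0 i.
have cx : {for t, continuous x} by case: dx => /derivable1_diffP /differentiable_continuous.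
have NO : nbhs (x t) O by apply: open_nbhs_nbhs.
have Nt : \forall s \near t, O (x s) by exact: cx.
have D i j := curve_comp (db (x t) (d i) (d j) Ox) dx.
have T i j := curveM (curveM (du i) (dv j)) (D i j).
have S := curve_sum (fun i => curve_sum (fun j => T i j)).
have Nd : \forall s \near t, \sum_i \sum_j u s 0 i * v s 0 j * beta (x s) (d i) (d j) = beta (x s) (u s) (v s).
  by apply: filterS Nt => s /bb h; rewrite -bilin_sum.
apply: (is_derive_eq (near_eq_is_derive Nd S)).
rewrite !(bilin_sum _ _ (bb _ Ox)) -!big_split /=.
have E : 'D_x' (fun y => beta y (u t) (v t)) (x t) =
   \sum_i \sum_j u t 0 i * v t 0 j * 'D_x' (fun y => beta y (d i) (d j)) (x t).
  have Ny : \forall y \near x t, \sum_i \sum_j u t 0 i * v t 0 j * beta y (d i) (d j) = beta y (u t) (v t).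
    by apply: filterS NO => y /bb h; rewrite -bilin_sum.
  have Hs i j : is_derive (x t) x' (fun y => u t 0 i * v t 0 j * beta y (d i) (d j))
     (u t 0 i * v t 0 j * 'D_x' (fun y => beta y (d i) (d j)) (x t)).
    by apply: is_deriveZ; apply/derivableP/diff_derivable/db.
  have Hi i := is_derive_sum (Hs i); have Hij := is_derive_sum Hi.
  have F : \sum_i \sum_j (fun y => u t 0 i * v t 0 j * beta y (d i) (d j)) =
     (fun y => \sum_i \sum_j u t 0 i * v t 0 j * beta y (d i) (d j)).
    by apply/funext => y; rewrite fct_sumE; apply: eq_bigr => i _; rewrite fct_sumE.
  by rewrite F in Hij; have [_ <-] := near_eq_is_derive Ny Hij.
rewrite E -!big_split; apply: eq_bigr => i _ /=; rewrite -!big_split; apply: eq_bigr => j _ /=.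
rewrite -!/(d _); ring.
Qed.
End Curves.

(** * Frobenius structures on open sets of coordinate space *)

Section LocalFrobenius.
Variable R : realType.
Local Notation K := (C R).
Local Notation V := 'rV[K]_3.

(** The part of a Frobenius structure that the argument uses, read in one
    chart: multiplication, metric, unity, Euler field and Christoffel symbols
    as functions on an open set of C^3. *)
Record local_frobenius (O : set V) (m : V -> V -> V -> V) (g : V -> V -> V -> K)
    (e E : V -> V) (G : V -> V -> V -> V) (k k' : K) : Prop := LocalFrobenius {
  lf_open : open O;
  lf_algebra : forall y, O y -> unital_algebra (m y) (e y);
  lf_mul_diff : forall y u v, O y -> differentiable (fun y => m y u v) y;
  lf_metric_bilin : forall y, O y -> bilin (g y);
  lf_metric_diff : forall y u v, O y -> differentiable (fun y => g y u v) y;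
  lf_metric_sym : forall y u v, O y -> g y u v = g y v u;
  lf_metric_nondeg : forall y, O y -> nondeg (g y);
  lf_unity_diff : forall y, O y -> differentiable e y;
  lf_euler_diff : forall y, O y -> differentiable E y;
  lf_conn_sym : forall y u v, O y -> G y u v = G y v u;
  lf_conn_metric : forall y u v w, O y ->
    'D_u (fun y => g y v w) y = g y (G y u v) w + g y v (G y u w);
  lf_unity_flat : forall y u, O y -> 'D_u e y + G y u (e y) = 0;
  lf_euler_mul : forall y u v, O y ->
    'D_(E y) (fun y => m y u v) y - 'D_(m y u v) E y + m y ('D_u E y) v + m y u ('D_v E y)
    = k *: m y u v;
  lf_euler_metric : forall y u v, O y ->
    'D_(E y) (fun y => g y u v) y + g y ('D_u E y) v + g y u ('D_v E y) = k' * g y u v;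
  lf_potential : forall y z u v w, O y ->
    let c y u v w := g y (m y u v) w in
    let nc z u v w := 'D_z (fun y => c y u v w) y
      - c y (G y z u) v w - c y u (G y z v) w - c y u v (G y z w) in
    nc z u v w = nc u z v w }.

Variables (O : set V) (m : V -> V -> V -> V) (g : V -> V -> V -> K)
    (e E : V -> V) (G : V -> V -> V -> V) (k k' : K).
Hypothesis lf : local_frobenius O m g e E G k k'.
Notation oO := (lf_open lf).

Lemma bilinD1 (T : V -> V -> K) u v w : bilin T -> T (u + v) w = T u w + T v w.
Proof. by move=> [_ /(_ w) h]; have := h 1 u v; rewrite scale1r mul1r. Qed.
Lemma bilinD2 (T : V -> V -> K) u v w : bilin T -> T u (v + w) = T u v + T u w.
Proof. by move=> [/(_ u) h _]; have := h 1 v w; rewrite scale1r mul1r. Qed.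
Lemma bilinZ1 (T : V -> V -> K) a u w : bilin T -> T (a *: u) w = a * T u w.
Proof.
move=> bT; have [_ /(_ w) h] := bT; have := h a u 0; rewrite addr0 => ->.
suff -> : T 0 w = 0 by rewrite addr0.
by apply: (addrI (T 0 w)); rewrite -bilinD1 // !addr0.
Qed.
Lemma bilinZ2 (T : V -> V -> K) a u w : bilin T -> T u (a *: w) = a * T u w.
Proof.
move=> bT; have [/(_ u) h _] := bT; have := h a w 0; rewrite addr0 => ->.
suff -> : T u 0 = 0 by rewrite addr0.
by apply: (addrI (T u 0)); rewrite -bilinD2 // !addr0.
Qed.
Lemma bilinN1 (T : V -> V -> K) u w : bilin T -> T (- u) w = - T u w.
Proof. by move=> bT; rewrite -scaleN1r bilinZ1 // mulN1r. Qed.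
Lemma bilinN2 (T : V -> V -> K) u w : bilin T -> T u (- w) = - T u w.
Proof. by move=> bT; rewrite -scaleN1r bilinZ2 // mulN1r. Qed.

Lemma metric_inj y u v : O y -> (forall w, g y u w = g y v w) -> u = v.
Proof.
move=> Oy H; apply/eqP; rewrite -subr_eq0; apply/eqP/(lf_metric_nondeg lf Oy) => w.
by rewrite (bilinD1 _ _ _ (lf_metric_bilin lf Oy)) (bilinN1 _ _ (lf_metric_bilin lf Oy)) H subrr.
Qed.

Definition mcoord (l : 'I_3) (y u v : V) : K := (m y u v) 0 l.

Lemma mcoord_bilin l y : O y -> bilin (mcoord l y).
Proof.
move=> Oy; have ua := lf_algebra lf Oy; split=> [u a v w|v a u w].
  by rewrite /mcoord (ua_linear ua) !mxE.
by rewrite /mcoord (mulaDl ua) (mulaZl ua) !mxE.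
Qed.

Lemma mcoord_diff l y u v : O y -> differentiable (fun y => mcoord l y u v) y.
Proof. by move=> Oy; apply: (differentiable_coordP (fun y => m y u v) y).1; exact: lf_mul_diff lf _ _ _ Oy. Qed.

Lemma mcoord_derive l y u v z : O y ->
  'D_z (fun y => mcoord l y u v) y = ('D_z (fun y => m y u v) y) 0 l.
Proof. by move=> Oy; rewrite derive_coord //; exact: (lf_mul_diff lf). Qed.

Lemma mulaN y u v : unital_algebra (m y) (e y) -> m y u (- v) = - m y u v.
Proof. by move=> ua; rewrite -scaleN1r (mulaZ ua) scaleN1r. Qed.
Lemma mulaNl y u v : unital_algebra (m y) (e y) -> m y (- u) v = - m y u v.
Proof. by move=> ua; rewrite -scaleN1r (mulaZl ua) scaleN1r. Qed.

Section CurveMul.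
Variables (x u v : K -> V) (t : K) (x' u' v' : V).
Hypotheses (Ox : O (x t)) (dx : is_derive t 1 x x') (du : is_derive t 1 u u')
  (dv : is_derive t 1 v v').

Lemma curve_mul : is_derive t 1 (fun s => m (x s) (u s) (v s))
  (m (x t) u' (v t) + m (x t) (u t) v' + 'D_x' (fun y => m y (u t) (v t)) (x t)).
Proof.
apply/curve_coord => l; rewrite !mxE -(mcoord_derive _ _ _ _ Ox).
exact: (curve_bilin oO (mcoord_bilin l) (fun y a b => @mcoord_diff l y a b) Ox dx du dv).
Qed.

Lemma curve_metric : is_derive t 1 (fun s => g (x s) (u s) (v s))
  (g (x t) u' (v t) + g (x t) (u t) v' + 'D_x' (fun y => g y (u t) (v t)) (x t)).
Proof.
exact: (curve_bilin oO (lf_metric_bilin lf) (fun y a b => @lf_metric_diff _ _ _ _ _ _ _ _ lf y a b) Ox dx du dv).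
Qed.
End CurveMul.

Lemma line_curve (y z : V) : is_derive (0 : K) 1 (fun s : K => s *: z + y) z.
Proof.
have H : is_diff (0 : K) (fun s : K => s *: z) (fun s : K => s *: z) by exact: is_diff_scalel.
have D : is_derive (0 : K) 1 (fun s : K => s *: z) z.
  split; first by apply/derivable1_diffP; case: H.
  by have [d Ed] := H; rewrite deriveE // Ed scale1r.
have D2 := is_deriveD D (is_derive_cst y (0 : K) 1).
by apply: (is_derive_eq D2); rewrite addr0.
Qed.

Lemma derive_line (W : normedModType K) (f : V -> W) (y z : V) :
  'D_z f y = 'D_1 (fun s : K => f (s *: z + y)) 0.
Proof.
rewrite /derive; set g1 := fun h => h^-1 *: _; set g2 := fun h => h^-1 *: _.
suff -> : g1 = g2 by [].
by rewrite funeqE /g1 /g2 => h /=; rewrite addr0 scale0r add0r [_%:A]mulr1.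
Qed.

Section Identities.
Variables (y : V) (Oy : O y).
Let ua := lf_algebra lf Oy.
Let gb := lf_metric_bilin lf Oy.
Let ln z : O ((0 : K) *: z + y). Proof. by rewrite scale0r add0r. Qed.

Let near_line z : \forall s \near (0 : K), O (s *: z + y).
Proof.
have c : {for (0 : K), continuous (fun s : K => s *: z + y)}.
  by case: (line_curve y z) => /derivable1_diffP /differentiable_continuous.
by apply: c; apply: open_nbhs_nbhs; split; [exact: oO | exact: ln].
Qed.

Lemma derive_mul_unity z v : 'D_z (fun y => m y (e y) v) y = 0.
Proof.
rewrite derive_line (near_eq_derive (g := cst v)) ?derive_cst //.
by apply: filterS (near_line z) => s /(lf_algebra lf) u; rewrite (ua_unit u).
Qed.

(** Differentiate e.v = v. *)
Lemma derive_mul_unity1 z v : 'D_z (fun y' => m y' (e y) v) y = - m y ('D_z e y) v.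
Proof.
have de : is_derive (0 : K) 1 (fun s : K => e (s *: z + y)) ('D_z e y).
  have := @curve_comp R V _ e (fun s : K => s *: z + y) 0 z.
  by rewrite scale0r add0r => /(_ (lf_unity_diff lf Oy) (line_curve y z)).
have H := curve_mul (ln z) (line_curve y z) de (is_derive_cst v (0 : K) 1).
have := derive_mul_unity z v; rewrite derive_line.
case: H => _ ->; rewrite !scale0r !add0r (mula0 ua) addr0 => /eqP.
by rewrite addrC addr_eq0 => /eqP.
Qed.

(** [E, e] = - k e, from the rescaling of the multiplication applied to e.e =
    e. *)
Lemma bracket_euler_unity : 'D_(E y) e y = 'D_(e y) E y - k *: e y.
Proof.
have me u : m y u (e y) = u by rewrite (ua_comm ua) (ua_unit ua).
have H2 : 'D_(E y) (fun y' => m y' (e y) (e y)) y = - 'D_(E y) e y.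
  by rewrite (derive_mul_unity1 (E y) (e y)) me.
have := lf_euler_mul lf (e y) (e y) Oy.
rewrite H2 !me (ua_unit ua) => <-.
move: ('D_(E y) e y) ('D_(e y) E y) => a b.
by apply: row3P; rewrite !mxE; ring.
Qed.

Lemma conn_unity u : G y (e y) u = - 'D_u e y.
Proof.
rewrite (lf_conn_sym lf _ _ Oy); apply/eqP; rewrite -addr_eq0 addrC.
by rewrite (lf_unity_flat lf u Oy).
Qed.

Lemma conn_unity' u : G y u (e y) = - 'D_u e y.
Proof. by rewrite -conn_unity (lf_conn_sym lf _ _ Oy). Qed.

Lemma derive_c z u v w : 'D_z (fun y => g y (m y u v) w) y =
  g y ('D_z (fun y => m y u v) y) w + g y (G y z (m y u v)) w + g y (m y u v) (G y z w).
Proof.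
have dm := curve_mul (ln z) (line_curve y z) (is_derive_cst u (0 : K) 1) (is_derive_cst v (0 : K) 1).
have H := curve_metric (ln z) (line_curve y z) dm (is_derive_cst w (0 : K) 1).
rewrite derive_line; case: H => _ ->; rewrite !scale0r !add0r /cst /=.
rewrite (mula0 ua) (mula0l ua) !add0r (lf_conn_metric lf _ _ _ Oy) addrA; congr (_ + _ + _).
have -> : g y (m y u v) 0 = 0 by have := bilinZ2 0 (m y u v) 0 gb; rewrite scaler0 mul0r.
by rewrite addr0.
Qed.

Lemma lie_unity_arith (a1 a2 a3 a4 a5 b c : K) :
  a1 - a2 + a3 - - a4 - - a5 - a3 = - a4 + b + c - - a4 - b - c -> a1 = a2 - a4 - a5.
Proof.
move=> H; have -> : a1 = (a1 - a2 + a3 - - a4 - - a5 - a3) + a2 - a4 - a5 by ring.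
by rewrite H; ring.
Qed.

(** The flow of e preserves the multiplication. Exchanging z = e with u in
    nabla c turns the derivative in the direction e into terms where e is one
    of the factors; there e.v = v and the flatness of e apply. *)
Lemma lie_unity_mul u v : 'D_(e y) (fun y => m y u v) y =
  'D_(m y u v) e y - m y ('D_u e y) v - m y u ('D_v e y).
Proof.
apply: (metric_inj Oy) => w.
have := lf_potential lf (e y) u v w Oy.
rewrite /= (derive_c (e y) u v w) (derive_c u (e y) v w) (derive_mul_unity1 u v).
rewrite (conn_unity u) (conn_unity v) (conn_unity (m y u v)) (conn_unity' u) !(ua_unit ua).
rewrite !(mulaN _ _ ua) !(mulaNl _ _ ua) !(bilinD1 _ _ _ gb) !(bilinN1 _ _ gb).
exact: lie_unity_arith.
Qed.
End Identities.
End LocalFrobenius.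

(** * Evolution along an integral curve of E - h e *)

Section Transport.
Variable R : realType.
Local Notation K := (C R).
Local Notation V := 'rV[K]_3.
Variables (O : set V) (m : V -> V -> V -> V) (g : V -> V -> V -> K)
    (e E : V -> V) (G : V -> V -> V -> V) (k k' : K).
Hypothesis lf : local_frobenius O m g e E G k k'.

Lemma derive_lin (W : normedModType K) (f : V -> W) (y u v : V) (h : K) :
  differentiable f y -> 'D_(u - h *: v) f y = 'D_u f y - h *: 'D_v f y.
Proof. by move=> df; rewrite (deriveE _ df) (deriveE u df) (deriveE v df) linearB linearZ. Qed.

(** The matrix of w |-> D_w E - h D_w e, the linear part of the flow of E - h
    e with h frozen. It is locked to keep matching from unfolding it. *)
Definition flowmat (y : V) (h : K) : 'M[K]_3 :=
  locked (\matrix_(i, j) ('D_(delta_mx 0 i) E y - h *: 'D_(delta_mx 0 i) e y) 0 j).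

Lemma flow_mul_arith (h : K) (a pe ue ve pE uE vE : V) :
  a - h *: (pe - ue - ve) =
  pE - h *: pe - (uE - h *: ue) - (vE - h *: ve) + (a - pE + uE + vE).
Proof. by apply: row3P; rewrite !mxE; ring. Qed.

Lemma bilinBZ1 (T : V -> V -> K) (h : K) a b v : bilin T ->
  T (a - h *: b) v = T a v - h * T b v.
Proof. by move=> bT; rewrite (bilinD1 a (- (h *: b)) v bT) (bilinN1 (h *: b) v bT) (bilinZ1 h b v bT). Qed.

Lemma bilinBZ2 (T : V -> V -> K) (h : K) a b v : bilin T ->
  T v (a - h *: b) = T v a - h * T v b.
Proof. by move=> bT; rewrite (bilinD2 v a (- (h *: b)) bT) (bilinN2 v (h *: b) bT) (bilinZ2 h v b bT). Qed.

Lemma flow_metric_arith (h a u v u' v' : K) :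
  a - h *: (- u + - v) = a + u' + v' - (u' - h * u) - (v' - h * v).
Proof. by rewrite /GRing.scale /=; ring. Qed.

Section Point.
Variables (y : V) (h : K) (Oy : O y).
Let B := flowmat y h.
Let ua := lf_algebra lf Oy.
Let gb := lf_metric_bilin lf Oy.
Let dE := lf_euler_diff lf Oy.
Let de := lf_unity_diff lf Oy.

Lemma flowmatE u : u *m B = 'D_u E y - h *: 'D_u e y.
Proof.
have -> : B = lin1_mx ('d E y) - h *: lin1_mx ('d e y).
  by rewrite /B /flowmat -lock; apply/matrixP => i j; rewrite !mxE (deriveE _ dE) (deriveE _ de).
have E1 : 'D_u E y = 'd E y u := deriveE u dE.
have E2 : 'D_u e y = 'd e y u := deriveE u de.
rewrite E1 E2 mulmxBr; congr (_ - _); first exact: (mul_rV_lin1 ('d E y) u).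
apply: (etrans (esym (scalemxAr h u (lin1_mx ('d e y))))).
by congr (h *: _); exact: (mul_rV_lin1 ('d e y) u).
Qed.

Lemma flow_mul u v : 'D_(E y - h *: e y) (fun y => m y u v) y =
  m y u v *m B - m y (u *m B) v - m y u (v *m B) + k *: m y u v.
Proof.
rewrite derive_lin; last exact: (lf_mul_diff lf).
have H1 := lf_euler_mul lf u v Oy; have H2 := lie_unity_mul lf Oy u v.
rewrite H2 -H1 !flowmatE !(mulaD ua) !(mulaDl ua) !(mulaN _ _ ua) !(mulaNl _ _ ua) !(mulaZ ua) !(mulaZl ua).
exact: flow_mul_arith.
Qed.

Lemma flow_metric u v : 'D_(E y - h *: e y) (fun y => g y u v) y =
  k' * g y u v - g y (u *m B) v - g y u (v *m B).
Proof.
rewrite derive_lin; last exact: (lf_metric_diff lf).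
have H1 := lf_euler_metric lf u v Oy; have H2 := lf_conn_metric lf (e y) u v Oy.
rewrite (conn_unity lf Oy u) (conn_unity lf Oy v) in H2.
rewrite H2 -H1 !flowmatE (bilinBZ1 _ _ _ _ gb) (bilinBZ2 _ _ _ _ gb).
rewrite (bilinN1 _ _ gb) (bilinN2 _ _ gb); exact: flow_metric_arith.
Qed.

Lemma flow_unity : 'D_(E y - h *: e y) e y = e y *m B - k *: e y.
Proof.
rewrite (derive_lin _ _ _ de) flowmatE (bracket_euler_unity lf Oy).
by rewrite addrAC.
Qed.
End Point.

Section Curve.
Variables (x : K -> V) (t h : K).
Hypotheses (Ox : O (x t)) (dx : is_derive t 1 x (E (x t) - h *: e (x t))).
Let B := flowmat (x t) h.
Let ua := lf_algebra lf Ox.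
Let gb := lf_metric_bilin lf Ox.

(** Both the metric and the trace form are transported by B up to a constant
    weight c, whence their Gram determinants satisfy the same equation. *)
Lemma gram_derive (T : K -> V -> V -> K) (c : K) :
  (forall i j, is_derive t 1 (fun s => T s (delta_mx 0 i) (delta_mx 0 j))
    (c * T t (delta_mx 0 i) (delta_mx 0 j) - T t (delta_mx 0 i *m B) (delta_mx 0 j)
      - T t (delta_mx 0 i) (delta_mx 0 j *m B))) -> bilin (T t) ->
  is_derive t 1 (fun s => gram (T s)) ((3%:R * c - 2%:R * \tr B) * gram (T t)).
Proof.
move=> H bT; pose tm : 'M[K]_3 := \matrix_(i, j) T t (delta_mx 0 i) (delta_mx 0 j).
pose tm' := c *: tm - B *m tm - tm *m B^T.
have deltaB i l : ((delta_mx 0 i : V) *m B) 0 l = B i l by rewrite -(rowE i B) mxE.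
have growE i : gramrow (T t) i = row i tm by apply/rowP => j; rewrite !mxE.
have D i : is_derive t 1 (fun s => gramrow (T s) i) (row i tm').
  apply/curve_coord => j.
  have -> : (fun s => gramrow (T s) i 0 j) = (fun s => T s (delta_mx 0 i) (delta_mx 0 j)).
    by apply/funext => s; rewrite mxE.
  apply: (is_derive_eq (H i j)); rewrite !mxE; congr (_ - _ - _).
    have [_ /(_ (delta_mx 0 j)) h1] := bT; rewrite (scalar_sum _ h1).
    by apply: eq_bigr => l _; rewrite deltaB mxE.
  have [/(_ (delta_mx 0 i)) h1 _] := bT; rewrite (scalar_sum _ h1).
  by apply: eq_bigr => l _; rewrite deltaB !mxE mulrC.
apply: (is_derive_eq (curve_det3 (D o0) (D o1) (D o2))).
by rewrite /gram !growE -gram_derivation.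
Qed.

Lemma flow_gram_metric : is_derive t 1 (fun s => gram (g (x s)))
  ((3%:R * k' - 2%:R * \tr B) * gram (g (x t))).
Proof.
apply: (@gram_derive (fun s => g (x s)) k') => [i j|]; last exact: gb.
have H := curve_metric lf Ox dx (is_derive_cst (delta_mx 0 i) t 1) (is_derive_cst (delta_mx 0 j) t 1).
apply: (is_derive_eq H); rewrite /cst (flow_metric h Ox).
have g0 v : g (x t) 0 v = 0 by have := bilinZ1 0 v v gb; rewrite scale0r mul0r.
have g0' v : g (x t) v 0 = 0 by have := bilinZ2 0 v v gb; rewrite scale0r mul0r.
by rewrite g0 g0' !add0r.
Qed.

Lemma trformE y u v : O y -> trform (m y) u v = \sum_l (m y (m y u v) (delta_mx 0 l)) 0 l.
Proof. by move=> Oy; rewrite /trform /mxtrace; apply: eq_bigr => l _; rewrite mxE. Qed.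

Lemma trform_bilin y : O y -> bilin (trform (m y)).
Proof.
move=> Oy; have u' := lf_algebra lf Oy.
have lin a p q : mulmat (m y) (a *: p + q) = a *: mulmat (m y) p + mulmat (m y) q.
  by rewrite (mulmatD u') (mulmatZ u').
split=> [u a v w|v a u w]; rewrite /trform.
  by rewrite (ua_linear u') lin linearP.
by rewrite (mulaDl u') (mulaZl u') lin linearP.
Qed.

(** In the trace of multiplication by u.v the commutator of B with the
    multiplication operator has trace zero. *)
Lemma flow_trform (u v : V) : is_derive t 1 (fun s => trform (m (x s)) u v)
  ((k + k) * trform (m (x t)) u v - trform (m (x t)) (u *m B) v - trform (m (x t)) u (v *m B)).
Proof.
pose p := m (x t) u v.
have dm := curve_mul lf Ox dx (is_derive_cst u t 1) (is_derive_cst v t 1).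
have dl l := (curve_coord _ _ _).1 (curve_mul lf Ox dx dm (is_derive_cst (delta_mx 0 l) t 1)) l.
have S := curve_sum dl.
have cx : {for t, continuous x} by case: dx => /derivable1_diffP /differentiable_continuous.
have Nt : \forall s \near t, \sum_l (m (x s) (m (x s) u v) (delta_mx 0 l)) 0 l = trform (m (x s)) u v.
  have : \forall s \near t, O (x s).
    by apply: cx; apply: open_nbhs_nbhs; split; [exact: lf_open lf | exact: Ox].
  by apply: filterS => s Os; rewrite trformE.
apply: (is_derive_eq (near_eq_is_derive Nt S)).
rewrite /cst (mula0 ua) (mula0l ua) !add0r (flow_mul h Ox u v) -/p -/B.
have tr_mul q : \sum_l (m (x t) q (delta_mx 0 l)) 0 l = \tr (mulmat (m (x t)) q).
  by apply: eq_bigr => l _; rewrite mxE.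
have E1 l : (m (x t) (p *m B - m (x t) (u *m B) v - m (x t) u (v *m B) + k *: p) (delta_mx 0 l) +
   m (x t) p 0 + 'D_(E (x t) - h *: e (x t)) (fun y => m y p (delta_mx 0 l)) (x t)) 0 l =
   (k + k) * (m (x t) p (delta_mx 0 l)) 0 l - (m (x t) (m (x t) (u *m B) v) (delta_mx 0 l)) 0 l
   - (m (x t) (m (x t) u (v *m B)) (delta_mx 0 l)) 0 l +
   ((m (x t) p (delta_mx 0 l) *m B) 0 l - (m (x t) p (delta_mx 0 l *m B)) 0 l).
  rewrite (flow_mul h Ox p _) -/B (mula0 ua) !(mulaDl ua) !(mulaNl _ _ ua) !(mulaZl ua) !mxE.
  ring.
under eq_bigr do rewrite E1.
rewrite big_split /= !sumrB -mulr_sumr !tr_mul.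
have -> : \sum_l (m (x t) p (delta_mx 0 l) *m B) 0 l = \tr (mulmat (m (x t)) p *m B).
  by apply: eq_bigr => l _; rewrite -(mulmatE ua) -mulmxA -rowE mxE.
have -> : \sum_l m (x t) p (delta_mx 0 l *m B) 0 l = \tr (B *m mulmat (m (x t)) p).
  by apply: eq_bigr => l _; rewrite -(mulmatE ua) -mulmxA -rowE mxE.
by rewrite mxtrace_mulC subrr addr0.
Qed.
End Curve.
End Transport.

(** * Quantities whose zeros are preserved *)

Section Invariants.
Variable R : realType.
Local Notation K := (C R).
Local Notation V := 'rV[K]_3.
Variables (O : set V) (m : V -> V -> V -> V) (g : V -> V -> V -> K)
    (e E : V -> V) (G : V -> V -> V -> V) (k k' : K).
Hypothesis lf : local_frobenius O m g e E G k k'.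

Section Curve.
Variables (x : K -> V) (t h : K).
Hypotheses (Ox : O (x t)) (dx : is_derive t 1 x (E (x t) - h *: e (x t))).
Let B := flowmat e E (x t) h.
Let ua := lf_algebra lf Ox.

(** Z evolves like the variation of a family of integral curves of E - h e: by
    the linear part of the flow, up to a multiple of e that comes from the
    variation of h. *)
Definition transverse_variation (Z : K -> V) (eta : K) :=
  is_derive t 1 Z (Z t *m B - eta *: e (x t)).

Lemma curve_unity : is_derive t 1 (e \o x) (e (x t) *m B - k *: e (x t)).
Proof.
have := curve_comp (lf_unity_diff lf Ox) dx.
by rewrite (flow_unity lf h Ox).
Qed.

Lemma curve_cubic Z eta : transverse_variation Z eta ->
  is_derive t 1 (fun s => det3 (e (x s)) (Z s) (m (x s) (Z s) (Z s)))
    (\tr B * det3 (e (x t)) (Z t) (m (x t) (Z t) (Z t))).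
Proof.
move=> dZ; have dM := curve_mul lf Ox dx dZ dZ.
have eM : m (x t) (Z t *m B - eta *: e (x t)) (Z t) + m (x t) (Z t) (Z t *m B - eta *: e (x t)) +
   'D_(E (x t) - h *: e (x t)) (fun y => m y (Z t) (Z t)) (x t) =
   m (x t) (Z t) (Z t) *m B + k *: m (x t) (Z t) (Z t) - (eta + eta) *: Z t.
  rewrite (flow_mul lf h Ox (Z t) (Z t)) (ua_comm ua _ (Z t)) -/B.
  have -> : m (x t) (Z t) (Z t *m B - eta *: e (x t)) = m (x t) (Z t) (Z t *m B) - eta *: Z t.
    rewrite (mulaD ua) (mulaN _ _ ua) (mulaZ ua).
    by rewrite [m (x t) (Z t) (e _)](ua_comm ua) (ua_unit ua).
  rewrite [m (x t) (Z t *m B) (Z t)](ua_comm ua).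
  exact: cubic_arith.
apply: (is_derive_eq (curve_det3 curve_unity dZ dM)).
by rewrite eM det3_shear3 det3_derivation.
Qed.

Lemma curve_area Z Z' eta eta' : transverse_variation Z eta -> transverse_variation Z' eta' ->
  is_derive t 1 (fun s => det3 (e (x s)) (Z s) (Z' s))
    ((\tr B - k) * det3 (e (x t)) (Z t) (Z' t)).
Proof.
move=> dZ dZ'; apply: (is_derive_eq (curve_det3 curve_unity dZ dZ')).
by rewrite det3_shear2 det3_derivation mulrBl.
Qed.

Lemma metric_gram_neq0 : gram (g (x t)) != 0.
Proof. by apply: gram_neq0; [exact: (lf_metric_bilin lf) | exact: (lf_metric_nondeg lf)]. Qed.

(** The factors - 2 tr B of the two Gram determinants cancel in the quotient,
    which leaves a constant rate. *)
Lemma trform_ratio : is_derive t 1 (fun s => gram (trform (m (x s))) * (gram (g (x s)))^-1)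
  ((3%:R * (k + k) - 3%:R * k') * (gram (trform (m (x t))) * (gram (g (x t)))^-1)).
Proof.
have gn := metric_gram_neq0.
have Hg := flow_gram_metric lf Ox dx.
have HT : is_derive t 1 (fun s => gram (trform (m (x s))))
   ((3%:R * (k + k) - 2%:R * \tr B) * gram (trform (m (x t)))).
  apply: (@gram_derive _ e E x t h (fun s => trform (m (x s))) (k + k)); last exact: (trform_bilin lf).
  by move=> i j; exact: (flow_trform lf Ox dx).
have HV : is_derive t 1 (fun s => (gram (g (x s)))^-1)
   (- (gram (g (x t)) ^- 2) * ((3%:R * k' - 2%:R * \tr B) * gram (g (x t)))).
  have [dg eg] := Hg.
  split; first exact: derivableV.
  by rewrite deriveV // eg.
apply: (is_derive_eq (curveM HT HV)).
by move: (gram (g (x t))) (gram (trform _)) (\tr B) gn => p q b p0; field.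
Qed.

(** The Gram determinant of the metric has rate 3 k' - 2 tr B, which
    compensates the square of a density of rate tr B + c. *)
Lemma square_density (D : K -> K) (c : K) : is_derive t 1 D ((\tr B + c) * D t) ->
  is_derive t 1 (fun s => D s * D s * gram (g (x s)))
    ((3%:R * k' + 2%:R * c) * (D t * D t * gram (g (x t)))).
Proof.
move=> HD; have Hg := flow_gram_metric lf Ox dx.
apply: (is_derive_eq (curveM (curveM HD HD) Hg)).
by rewrite -/B; move: (gram (g (x t))) (\tr B) (D t) => p b d; ring.
Qed.
End Curve.

Section Disc.
Variables (x : K -> V) (h : K -> K) (r : R) (t : K).
Hypotheses (Ox : forall z : K, nrm z < r -> O (x z))
  (dx : forall z : K, nrm z < r -> is_derive z 1 x (E (x z) - h z *: e (x z)))
  (tr : nrm t < r).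

Lemma r_gt0 : nrm (0 : K) < r.
Proof. by rewrite nrm0; apply: le_lt_trans tr; exact: nrm_ge0. Qed.

Lemma flow_semisimple : gram (trform (m (x t))) = 0 <-> gram (trform (m (x 0))) = 0.
Proof.
have H := ode_zero (fun z hz => trform_ratio (Ox hz) (dx hz)) tr.
have g1 := metric_gram_neq0 (Ox tr); have g0 := metric_gram_neq0 (Ox r_gt0).
have E0 (a b : K) : b != 0 -> (a * b^-1 = 0 <-> a = 0).
  move=> b0; split=> [/eqP|->]; last by rewrite mul0r.
  by rewrite mulf_eq0 invr_eq0 (negbTE b0) orbF => /eqP.
split=> z0; first by apply/(E0 _ _ g0)/H.1/(E0 _ _ g1).
by apply/(E0 _ _ g1)/H.2/(E0 _ _ g0).
Qed.

Lemma density_zero (D : K -> K) (c : K) :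
  (forall z : K, nrm z < r -> is_derive z 1 D ((\tr (flowmat e E (x z) (h z)) + c) * D z)) ->
  (D t = 0 <-> D 0 = 0).
Proof.
move=> HD.
have H := ode_zero (fun z hz => square_density (Ox hz) (dx hz) (HD z hz)) tr.
have g1 := metric_gram_neq0 (Ox tr); have g0 := metric_gram_neq0 (Ox r_gt0).
have E0 (a b : K) : b != 0 -> (a * a * b = 0 <-> a = 0).
  move=> b0; split=> [/eqP|->]; last by rewrite !mul0r.
  by rewrite !mulf_eq0 (negbTE b0) orbF orbb => /eqP.
split=> z0; first by apply/(E0 _ _ g0)/H.1/(E0 _ _ g1).
by apply/(E0 _ _ g1)/H.2/(E0 _ _ g0).
Qed.

Lemma flow_cubic (Z : K -> V) (eta : K -> K) :
  (forall z : K, nrm z < r -> transverse_variation x z (h z) Z (eta z)) ->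
  det3 (e (x t)) (Z t) (m (x t) (Z t) (Z t)) = 0 <->
  det3 (e (x 0)) (Z 0) (m (x 0) (Z 0) (Z 0)) = 0.
Proof.
move=> dZ.
apply: (@density_zero (fun s => det3 (e (x s)) (Z s) (m (x s) (Z s) (Z s))) 0) => z hz.
by rewrite addr0; apply: (curve_cubic (Ox hz) (dx hz) (dZ z hz)).
Qed.

Lemma flow_area (Z Z' : K -> V) (eta eta' : K -> K) :
  (forall z : K, nrm z < r -> transverse_variation x z (h z) Z (eta z)) ->
  (forall z : K, nrm z < r -> transverse_variation x z (h z) Z' (eta' z)) ->
  det3 (e (x t)) (Z t) (Z' t) = 0 <-> det3 (e (x 0)) (Z 0) (Z' 0) = 0.
Proof.
move=> dZ dZ'.
apply: (@density_zero (fun s => det3 (e (x s)) (Z s) (Z' s)) (- k)) => z hz.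
exact: (curve_area (Ox hz) (dx hz) (dZ z hz) (dZ' z hz)).
Qed.
End Disc.
End Invariants.

(** * The Euler field is not parallel to the unity on a surface *)

Section NotParallel.
Variable R : realType.
Local Notation K := (C R).
Local Notation V := 'rV[K]_3.
Variables (O : set V) (m : V -> V -> V -> V) (g : V -> V -> V -> K)
    (e E : V -> V) (G : V -> V -> V -> V) (k k' : K).
Hypothesis lf : local_frobenius O m g e E G k k'.

Lemma unity_neq0 y : O y -> e y != 0.
Proof.
move=> Oy; have ua := lf_algebra lf Oy; apply/eqP => e0.
have := ua_unit ua (delta_mx 0 o0); rewrite e0 (mula0l ua) => /rowP/(_ o0).
by rewrite !mxE !eqxx => /esym/eqP; rewrite oner_eq0.
Qed.

(** Since E - h e vanishes at y, [flow_metric] becomes the algebraic identity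
    k' g(u, v) = eta(u) g(e, v) + eta(v) g(u, e), and [flow_unity] gives
    eta(e) = k. A vector u <> 0 killed by both functionals eta and g(., e)
    would be in the kernel of the metric if k' <> 0, so k' = 0; then u = v = e
    and u = w, v = e show in turn that g(e, e) = 0 and that e is in the kernel
    of the metric. *)
Lemma euler_not_parallel (y : V) (h : K) (eta : V -> K) : O y -> k != 0 ->
  E y = h *: e y -> (forall w, w *m flowmat e E y h = eta w *: e y) -> False.
Proof.
move=> Oy k0 Eh HB; set B := flowmat e E y h in HB.
have e0 := unity_neq0 Oy; have gb := lf_metric_bilin lf Oy.
have E0 : E y - h *: e y = 0 by rewrite Eh subrr.
have ek : eta (e y) = k.
  have := flow_unity lf h Oy; rewrite E0 derive0 HB => /eqP.
  rewrite eq_sym subr_eq0 -subr_eq0 -scalerBl scaler_eq0 (negbTE e0) orbF subr_eq0.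
  by move=> /eqP.
have id1 u v : k' * g y u v = eta u * g y (e y) v + eta v * g y u (e y).
  have := flow_metric lf h Oy u v; rewrite E0 derive0 !HB.
  rewrite (bilinZ1 _ _ _ gb) (bilinZ2 _ _ _ gb) => /esym/eqP.
  by rewrite -addrA -opprD subr_eq0 => /eqP.
have [a ea] : exists a, e y 0 a != 0.
  case/rV0Pn: e0 => a ea; by exists a.
(* The equation w *m B = eta w *: e is read off at an index a with e_a <> 0, so
   that eta becomes a column of a matrix; three rows in a plane have a linear
   relation. *)
pose A : 'M[K]_(3, 2) := \matrix_(i, j) (if j == 0 then g y (delta_mx 0 i) (e y) else B i a).
have [u u0 uA] : exists2 u : V, u != 0 & u *m A = 0.
  have nz : kermx A != 0.
    rewrite -mxrank_eq0 mxrank_ker subn_eq0 -ltnNge ltnS.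
    exact: rank_leq_col.
  have /rowV0Pn[u Hu u0] := nz.
  by exists u => //; apply/sub_kermxP.
have gu0 : g y u (e y) = 0.
  have [_ /(_ (e y)) h1] := gb; rewrite (scalar_sum u h1).
  have := congr1 (fun M : 'rV[K]_2 => M 0 0) uA; rewrite !mxE => Hs.
  by rewrite -[RHS]Hs; apply: eq_bigr => i _; rewrite mxE.
have eu0 : eta u = 0.
  have := congr1 (fun M : 'rV[K]_2 => M 0 1) uA; rewrite !mxE => Hs.
  have := congr1 (fun M : V => M 0 a) (HB u); rewrite !mxE.
  have -> : \sum_j u 0 j * B j a = 0 by rewrite -[RHS]Hs; apply: eq_bigr => i _; rewrite mxE.
  by move=> /esym/eqP; rewrite mulf_eq0 (negbTE ea) orbF => /eqP.
have k'0 : k' = 0.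
  apply/eqP; apply: contraNT u0 => k'n; apply/eqP/(lf_metric_nondeg lf Oy) => v.
  by apply: (mulfI k'n); rewrite mulr0 id1 eu0 gu0 mul0r mulr0 addr0.
have gee : g y (e y) (e y) = 0.
  have := id1 (e y) (e y); rewrite k'0 mul0r ek => /esym/eqP.
  by rewrite -mulrDl mulf_eq0 -mulr2n mulrn_eq0 /= (negbTE k0) => /eqP.
case/negP: e0; apply/eqP/(lf_metric_nondeg lf Oy) => w; rewrite (lf_metric_sym lf _ _ Oy).
have := id1 w (e y); rewrite k'0 mul0r gee mulr0 add0r ek => /esym/eqP.
by rewrite mulf_eq0 (negbTE k0) => /eqP.
Qed.
End NotParallel.

(** * Families of integral curves *)

Lemma derive_comp (R : realType) (A B D : normedModType (C R)) (f : A -> B) (h : B -> D) (a v : A) :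
  differentiable f a -> differentiable h (f a) -> 'D_v (h \o f) a = 'D_('D_v f a) h (f a).
Proof.
move=> df dh; have dc := differentiable_comp df dh.
have E1 : 'D_v (h \o f) a = 'd (h \o f) a v := deriveE _ dc.
have E2 : 'D_('D_v f a) h (f a) = 'd h (f a) ('D_v f a) := deriveE _ dh.
have E3 : 'D_v f a = 'd f a v := deriveE _ df.
by rewrite E1 E2 E3 diff_comp.
Qed.

Lemma entry_arith (K : fieldType) n (a b c : 'rV[K]_n) (x y : K) i :
  a 0 i - (x * b 0 i + c 0 i * y) = (a - x *: b - y *: c) 0 i.
Proof. by rewrite !mxE; ring. Qed.

Section FlowFamily.
Variable R : realType.
Local Notation K := (C R).
Local Notation V := 'rV[K]_3.
Local Notation S2 := 'rV[K]_2.
Variables (O : set V) (m : V -> V -> V -> V) (g : V -> V -> V -> K)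
    (e E : V -> V) (G : V -> V -> V -> V) (k k' : K).
Hypothesis lf : local_frobenius O m g e E G k k'.
(** Differentiating E - H e produces the linear part of the flow, with H
    frozen, and a multiple of e. *)
Lemma derive_projected (W : normedModType K) (Th : W -> V) (H : W -> K) (q v : W) :
  differentiable Th q -> differentiable H q -> O (Th q) ->
  'D_v (fun p => E (Th p) - H p *: e (Th p)) q =
  'D_v Th q *m flowmat e E (Th q) (H q) - 'D_v H q *: e (Th q).
Proof.
move=> dq dH Oq.
have dE : differentiable (E \o Th) q by apply: differentiable_comp => //; exact: (lf_euler_diff lf).
have de : differentiable (e \o Th) q by apply: differentiable_comp => //; exact: (lf_unity_diff lf).
rewrite (flowmatE lf _ Oq).
have EE : 'D_v (E \o Th) q = 'D_('D_v Th q) E (Th q) := derive_comp v dq (lf_euler_diff lf Oq).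
have Ee : 'D_v (e \o Th) q = 'D_('D_v Th q) e (Th q) := derive_comp v dq (lf_unity_diff lf Oq).
have der2 i : is_derive q v (fun p => H p * (e (Th p)) 0 i)
   (H q * ('D_('D_v Th q) e (Th q)) 0 i + (e (Th q)) 0 i * 'D_v H q).
  have h1 : is_derive q v H ('D_v H q) by apply/derivableP/diff_derivable.
  have h2 : is_derive q v (fun p => (e (Th p)) 0 i) (('D_('D_v Th q) e (Th q)) 0 i).
    have di := (differentiable_coordP _ _).1 de i.
    rewrite -Ee (derive_coord v i de).
    by apply/derivableP/diff_derivable.
  exact: (is_deriveM h1 h2).
have dF : differentiable (fun p => E (Th p) - H p *: e (Th p)) q.
  apply/differentiable_coordP => i.
  have -> : (fun p => (E (Th p) - H p *: e (Th p)) 0 i) =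
    (fun p => (E (Th p)) 0 i) - (H * (fun p => (e (Th p)) 0 i)).
    by apply/funext => p; rewrite !mxE.
  apply: differentiableB; first exact: ((differentiable_coordP _ _).1 dE i).
  apply: differentiableM; first exact: dH.
  exact: ((differentiable_coordP _ _).1 de i).
apply/rowP => i; rewrite (derive_coord v i dF).
have h1 : is_derive q v (fun p => (E (Th p)) 0 i) (('D_('D_v Th q) E (Th q)) 0 i).
  rewrite -EE (derive_coord v i dE).
  by apply/derivableP/diff_derivable/((differentiable_coordP _ _).1 dE i).
have -> : (fun p => (E (Th p) - H p *: e (Th p)) 0 i) =
    (fun p => (E (Th p)) 0 i) - (fun p => H p * (e (Th p)) 0 i).
  by apply/funext => p; rewrite !mxE.
have [_ ->] := is_deriveB h1 (der2 i).
exact: entry_arith.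
Qed.

Variables (Q : set (K * S2)%type) (Th : K * S2 -> V) (H : K * S2 -> K).
Hypotheses (oQ : open Q) (dTh : forall q, Q q -> differentiable Th q)
  (dH : forall q, Q q -> differentiable H q) (QO : forall q, Q q -> O (Th q))
  (ode : forall q, Q q -> 'D_((1, 0) : K * S2) Th q = E (Th q) - H q *: e (Th q)).

(** A variation of the initial point at fixed time. *)
Definition hor (v : S2) : K * S2 := (0, v).

Section Through.
Variables (r : R) (y0 : S2).
Hypothesis Qy0 : forall z : K, nrm z < r -> Q (z, y0).

Lemma time_curve (z : K) : is_derive z 1 (fun s : K => ((s, y0) : K * S2)) (1, 0).
Proof.
have d : is_diff z (fun s : K => ((s, y0) : K * S2)) (fun s : K => ((s, 0) : K * S2)).
  have H1 : is_diff z (fun s : K => s) (fun s : K => s) by exact: is_diff_id.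
  have H2 : is_diff z (fun _ : K => y0) (fun _ : K => (0 : S2)) by exact: is_diff_cst.
  exact: is_diff_pair.
have [dd Ed] := d; split; first by apply/derivable1_diffP.
have E1 : 'D_1 (fun s : K => ((s, y0) : K * S2)) z = 'd (fun s : K => ((s, y0) : K * S2)) z (1 : K) := deriveE _ dd.
by rewrite E1 Ed.
Qed.

Definition flow_curve (z : K) : V := Th (z, y0).
Definition flow_variation (v : S2) (z : K) : V := 'D_(hor v) Th (z, y0).

Lemma flow_curve_derive (z : K) : nrm z < r ->
  is_derive z 1 flow_curve (E (flow_curve z) - H (z, y0) *: e (flow_curve z)).
Proof.
move=> hz; rewrite -(ode (Qy0 hz)).
exact: (curve_comp (dTh (Qy0 hz)) (time_curve z)).
Qed.

(** Commuting the time derivative with the variation is the equality of mixed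
    second derivatives. *)
Lemma variation_derive (v : S2) (z : K) : nrm z < r ->
  transverse_variation e E flow_curve z (H (z, y0)) (flow_variation v) ('D_(hor v) H (z, y0)).
Proof.
move=> hz; have Qz := Qy0 hz; set q := (z, y0) in Qz *.
have dD : differentiable (fun p => 'D_(hor v) Th p) q.
  exact: (differentiable_derive_rV (hor v) oQ dTh Qz).
have C := curve_comp dD (time_curve z).
apply: (is_derive_eq C).
apply: (etrans (derive_sym_rV (hor v) (1, 0) oQ dTh Qz)).
have N : \forall p \near q, 'D_((1, 0) : K * S2) Th p = E (Th p) - H p *: e (Th p).
  have : nbhs q Q by apply: open_nbhs_nbhs.
  by apply: filterS => p /ode.
apply: (etrans (@near_eq_derive _ _ _ _ _ q (hor v) N)).
have dq := dTh Qz; have Oq := QO Qz.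
exact: (derive_projected (hor v) dq (dH Qz) Oq).
Qed.

Section At.
Variable t : K.
Hypothesis tr : nrm t < r.

Lemma family_semisimple :
  gram (trform (m (flow_curve t))) = 0 <-> gram (trform (m (flow_curve 0))) = 0.
Proof.
exact: (flow_semisimple lf (fun z hz => QO (Qy0 hz)) flow_curve_derive tr).
Qed.

Lemma family_cubic v :
  let q z := det3 (e (flow_curve z)) (flow_variation v z) (m (flow_curve z) (flow_variation v z) (flow_variation v z)) in
  q t = 0 <-> q 0 = 0.
Proof.
exact: (flow_cubic lf (fun z hz => QO (Qy0 hz)) flow_curve_derive tr (variation_derive v)).
Qed.

Lemma family_area v w :
  let q z := det3 (e (flow_curve z)) (flow_variation v z) (flow_variation w z) in
  q t = 0 <-> q 0 = 0.
Proof.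
exact: (flow_area lf (fun z hz => QO (Qy0 hz)) flow_curve_derive tr (variation_derive v) (variation_derive w)).
Qed.
End At.
End Through.
End FlowFamily.

(** * Projecting the Euler field to a surface along the unity *)

Section Projection.
Variable R : realType.
Local Notation K := (C R).
Local Notation V := 'rV[K]_3.
Local Notation S2 := 'rV[K]_2.

Lemma differentiable_det3 (W : normedModType K) (a b c : W -> V) (x : W) :
  differentiable a x -> differentiable b x -> differentiable c x ->
  differentiable (fun x => det3 (a x) (b x) (c x)) x.
Proof.
move=> /differentiable_coordP da /differentiable_coordP db /differentiable_coordP dc.
have M2 i j := differentiableM (db i) (dc j).
have S i j := differentiableB (M2 i j) (M2 j i).
have P l i j := differentiableM (da l) (S i j).
exact: (differentiableD (differentiableB (P o0 o1 o2) (P o1 o0 o2)) (P o2 o0 o1)).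
Qed.

Definition q0 : 'I_2 := @Ordinal 2 0 isT.
Definition q1 : 'I_2 := @Ordinal 2 1 isT.

Lemma ord2P (i : 'I_2) : i = q0 \/ i = q1.
Proof. by case: i => [[|[|k]] Hk] //; [left|right]; apply: val_inj. Qed.

Lemma row2_sum (v : S2) : v = v 0 q0 *: delta_mx 0 q0 + v 0 q1 *: delta_mx 0 q1.
Proof. by apply/rowP => i; case: (ord2P i) => ->; rewrite !mxE /=; ring. Qed.

Variables (psi : S2 -> V) (e E : V -> V).

Definition dir (j : 'I_2) (y : S2) : V := 'D_(delta_mx 0 j) psi y.
Definition jacobian (y : S2) : K := det3 (dir q0 y) (dir q1 y) (e (psi y)).
(** Cramer's rule for v in the equation D_v psi = E - c e; [proj_height] is
    the unknown c. *)
Definition proj_field (y : S2) : S2 :=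
  \row_j (if j == q0 then det3 (E (psi y)) (dir q1 y) (e (psi y)) / jacobian y
          else det3 (dir q0 y) (E (psi y)) (e (psi y)) / jacobian y).
Definition proj_height (y : S2) : K := det3 (dir q0 y) (dir q1 y) (E (psi y)) / jacobian y.

Lemma derive_dir (y v : S2) : differentiable psi y ->
  'D_v psi y = v 0 q0 *: dir q0 y + v 0 q1 *: dir q1 y.
Proof.
move=> dp; rewrite /dir (deriveE _ dp) (deriveE (delta_mx 0 q0) dp) (deriveE (delta_mx 0 q1) dp).
by rewrite {1}(row2_sum v) linearD !linearZ.
Qed.

Lemma proj_fieldE (y : S2) : differentiable psi y -> jacobian y != 0 ->
  'D_(proj_field y) psi y = E (psi y) - proj_height y *: e (psi y).
Proof.
move=> dp j0; rewrite (derive_dir _ dp) /proj_field !mxE /=.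
exact: cramer_div.
Qed.

Variables (Om : set S2) (O : set V).
Hypotheses (oOm : open Om) (dpsi : forall y, Om y -> differentiable psi y)
  (OmO : forall y, Om y -> O (psi y))
  (de : forall y, O y -> differentiable e y) (dE : forall y, O y -> differentiable E y).

Section At.
Variable y : S2.
Hypotheses (Oy : Om y) (j0 : jacobian y != 0).

Lemma dir_diff j : differentiable (dir j) y.
Proof. exact: (differentiable_derive_rV _ oOm dpsi Oy). Qed.
Lemma epsi_diff : differentiable (e \o psi) y.
Proof. by apply: differentiable_comp; [exact: dpsi | exact/de/OmO]. Qed.
Lemma Epsi_diff : differentiable (E \o psi) y.
Proof. by apply: differentiable_comp; [exact: dpsi | exact/dE/OmO]. Qed.

Lemma jacobianV_diff : differentiable (fun y => (jacobian y)^-1) y.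
Proof.
have d : differentiable jacobian y.
  by apply: differentiable_det3; [exact: dir_diff|exact: dir_diff|exact: epsi_diff].
exact: (differentiableV d j0).
Qed.

Lemma proj_height_diff : differentiable proj_height y.
Proof.
apply: differentiableM; last exact: jacobianV_diff.
by apply: differentiable_det3; [exact: dir_diff|exact: dir_diff|exact: Epsi_diff].
Qed.

Lemma proj_field_diff : differentiable proj_field y.
Proof.
apply/differentiable_coordP => j.
have [->|->] := ord2P j.
  have -> : (fun y => proj_field y 0 q0) = (fun y => det3 (E (psi y)) (dir q1 y) (e (psi y))) * (fun y => (jacobian y)^-1).
    by apply/funext => z; rewrite mxE.
  apply: differentiableM; last exact: jacobianV_diff.
  by apply: differentiable_det3; [exact: Epsi_diff|exact: dir_diff|exact: epsi_diff].
have -> : (fun y => proj_field y 0 q1) = (fun y => det3 (dir q0 y) (E (psi y)) (e (psi y))) * (fun y => (jacobian y)^-1).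
  by apply/funext => z; rewrite mxE.
apply: differentiableM; last exact: jacobianV_diff.
by apply: differentiable_det3; [exact: dir_diff|exact: Epsi_diff|exact: epsi_diff].
Qed.
End At.

Lemma proj_unique (y v : S2) (c : K) : differentiable psi y -> jacobian y != 0 ->
  'D_v psi y = E (psi y) - c *: e (psi y) -> v = proj_field y.
Proof.
move=> dp j0 H; have H2 := proj_fieldE dp j0.
rewrite (derive_dir v dp) in H; rewrite (derive_dir _ dp) in H2.
have [h0 h1] := cramer_unique j0 H H2.
by rewrite (row2_sum v) [RHS]row2_sum h0 h1.
Qed.
End Projection.

(** * Charts and tangent maps *)

Local Notation coord := Defs.coord.
Local Notation mul := Defs.mul.

Section Charts.
Variable R : realType.
Local Notation K := (C R).

Lemma coord_nbhs n (M : complex_manifold R n) (i : chart M) (s : M) (A : set M) :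
  chart_dom i s -> nbhs s A -> \forall y \near coord i s, A (point_of i y).
Proof.
move=> si nA; have c := point_of_continuous si.
by move: (c A); rewrite coordK //; apply.
Qed.

Lemma coord_near_image n (M : complex_manifold R n) (i : chart M) (s : M) :
  chart_dom i s -> \forall y \near coord i s, exists2 s', chart_dom i s' & y = coord i s'.
Proof.
move=> si; have : nbhs (coord i s) (coord i @` chart_dom i).
  by apply: open_nbhs_nbhs; split; [exact: chart_image_open | exists s].
by apply: filterS => y [s' h <-]; exists s'.
Qed.

Lemma coord_image_open n (M : complex_manifold R n) (i : chart M) (A : set M) :
  open A -> A `<=` chart_dom i -> open (coord i @` A).
Proof.
move=> oA AD; rewrite openE => _ [s As <-].
have nA : nbhs s A by apply: open_nbhs_nbhs.
apply: filterS2 (coord_nbhs (AD s As) nA) (coord_near_image (AD s As)) => y Ay [s' h E].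
by exists (point_of i y) => //; rewrite E coordK.
Qed.

Lemma chart_nbhs n (M : complex_manifold R n) (i : chart M) (s : M) : chart_dom i s -> nbhs s (chart_dom i).
Proof. by move=> si; apply: open_nbhs_nbhs; split => //; exact: chart_dom_open. Qed.

Lemma near_eq_diffE (V W : normedModType K) (f h : V -> W) (x : V) :
  (\forall y \near x, f y = h y) -> differentiable f x -> forall v, 'd h x v = 'd f x v.
Proof. by move=> fh df v; have [_ E] := near_eq_diff fh df; exact: (congr1 (fun F => F v) E). Qed.

Lemma holomorphic_id n (M : complex_manifold R n) : holomorphic_map (@id M).
Proof. by split=> [x //|i j x hi hj]; exact: transition_holomorphic. Qed.

Lemma tangent_comp a b c (A : complex_manifold R a) (B : complex_manifold R b)
    (D : complex_manifold R c) (f : A -> B) (h : B -> D) i j l (s : A) v :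
  holomorphic_map f -> holomorphic_map h ->
  chart_dom i s -> chart_dom j (f s) -> chart_dom l (h (f s)) ->
  tangent_map (h \o f) i l s v = tangent_map h j l (f s) (tangent_map f i j s v).
Proof.
move=> [cf df] [ch dh] si sj sl.
have d1 := df i j s si sj; have d2 := dh j l (f s) sj sl.
have E : coord j (f s) = local_map f i j (coord i s) by rewrite /local_map /= coordK.
rewrite E in d2.
rewrite /tangent_map E.
have N : \forall y \near coord i s, (local_map h j l \o local_map f i j) y = local_map (h \o f) i l y.
  have : nbhs s (f @^-1` chart_dom j) by apply: cf; exact: chart_nbhs.
  by move/(coord_nbhs si); apply: filterS => y hy; rewrite /local_map /= coordK.
apply: (etrans (near_eq_diffE N (differentiable_comp d1 d2) v)).
by rewrite diff_comp.
Qed.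

Lemma tangent_id n (M : complex_manifold R n) (i : chart M) (s : M) v :
  chart_dom i s -> tangent_map (@id M) i i s v = v.
Proof.
move=> si; have N : \forall y \near coord i s, id y = local_map (@id M) i i y.
  by apply: filterS (coord_near_image si) => y [s' h ->]; rewrite /local_map /= coordK.
have [d E] := is_diff_id (coord i s).
apply: (etrans (near_eq_diffE N d v)).
exact: (congr1 (fun F => F v) E).
Qed.

Lemma change_chartK n (M : complex_manifold R n) (i j : chart M) (s : M) v :
  chart_dom i s -> chart_dom j s -> change_chart j i s (change_chart i j s v) = v.
Proof.
move=> si sj; rewrite /change_chart.
have H := tangent_comp (i := i) (j := j) (l := i) (s := s) v (holomorphic_id M) (holomorphic_id M) si sj si.
by rewrite -H tangent_id.
Qed.

Section Frob.
Variables (M : complex_manifold R 3) (Fr : frobenius_structure M) (j : chart M).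
Local Notation V := 'rV[K]_3.
Local Notation P := (point_of j).

Definition chart_mul (y u v : V) : V := mul Fr j (P y) u v.
Definition chart_metric (y u v : V) : K := metric Fr j (P y) u v.
Definition chart_unity (y : V) : V := unity Fr j (P y).
Definition chart_euler (y : V) : V := euler Fr j (P y).
Definition chart_conn (y u v : V) : V := conn Fr j (P y) u v.

Lemma chart_local_frobenius (k k' : K) :
  (forall i x u v, chart_dom i x -> lie_mul (euler Fr) (mul Fr) i x u v = k *: mul Fr i x u v) ->
  (forall i x u v, chart_dom i x -> lie_metric (euler Fr) (metric Fr) i x u v = k' * metric Fr i x u v) ->
  local_frobenius (coord j @` chart_dom j) chart_mul chart_metric chart_unity chart_euler chart_conn k k'.
Proof.
move=> Hk Hk'; have lc := conn_levi_civita Fr.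
split.
- exact: chart_image_open.
- move=> _ [x hx <-]; rewrite /chart_mul /chart_unity coordK //; split.
  + by move=> u; exact: Defs.mul_linear.
  + by move=> u v; exact: Defs.mul_comm.
  + by move=> u v w; exact: Defs.mul_assoc.
  + by move=> u; exact: unity_mul.
- by move=> _ u v [x hx <-]; exact: (@mul_holomorphic _ _ _ Fr j x u v hx).
- move=> _ [x hx <-]; rewrite /chart_metric coordK //; split=> u; first exact: metric_linear.
  by move=> a v w; rewrite ![metric Fr j x _ u]Defs.metric_sym //; exact: metric_linear.
- by move=> _ u v [x hx <-]; exact: (@metric_holomorphic _ _ _ Fr j x u v hx).
- by move=> _ u v [x hx <-]; apply: Defs.metric_sym; rewrite coordK.
- move=> _ [x hx <-] u H; apply: (@metric_nondegenerate _ _ _ Fr j x u hx) => v.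
  by move: (H v); rewrite /chart_metric coordK.
- by move=> _ [x hx <-]; have [h _] := unity_holomorphic Fr; exact: h.
- by move=> _ [x hx <-]; have [h _] := euler_holomorphic Fr; exact: h.
- by move=> _ u v [x hx <-]; rewrite /chart_conn coordK //; exact: (@lc_torsion_free _ _ _ _ _ lc j x u v hx).
- move=> _ u v w [x hx <-]; rewrite /chart_conn /chart_metric coordK //.
  exact: (@lc_metric _ _ _ _ _ lc j x u v w hx).
- move=> _ u [x hx <-]; rewrite /chart_conn /chart_unity coordK //.
  exact: (@unity_parallel _ _ _ Fr j x u hx).
- move=> _ u v [x hx <-]; have := Hk j x u v hx.
  by rewrite /lie_mul /chart_mul /chart_euler coordK.
- move=> _ u v [x hx <-]; have := Hk' j x u v hx.
  by rewrite /lie_metric /chart_metric /chart_euler coordK.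
- move=> _ z u v w [x hx <-]; have [h _ _] := @nabla_c_sym _ _ _ Fr j x z u v w hx.
  by move: h; rewrite /nabla_c /chart_metric /chart_mul /chart_conn coordK.
Qed.
End Frob.
End Charts.

(** * The projected Euler field on the surface *)

Lemma mulmx_comb3 (K : fieldType) (d0 d1 e : 'rV[K]_3) (B : 'M[K]_3) (a b c x y z : K) :
  d0 *m B = x *: e -> d1 *m B = y *: e -> e *m B = z *: e ->
  (a *: d0 + b *: d1 + c *: e) *m B = (a * x + b * y + c * z) *: e.
Proof. by move=> h0 h1 h2; rewrite !mulmxDl -!scalemxAl h0 h1 h2 !scalerA !scalerDl. Qed.

Section NotZero.
Variable R : realType.
Local Notation K := (C R).
Local Notation V := 'rV[K]_3.
Local Notation S2 := 'rV[K]_2.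
Variables (O : set V) (m : V -> V -> V -> V) (g : V -> V -> V -> K)
    (e E : V -> V) (G : V -> V -> V -> V) (k k' : K).
Hypothesis lf : local_frobenius O m g e E G k k'.

(** If the projected field vanishes on an open set, then so does E - h e along
    the surface; its derivatives in tangent directions, and [flow_unity] for
    the direction e, show that the linear part of the flow has values in the
    line of e. *)
Lemma proj_field_neq0 (Om : set S2) (psi : S2 -> V) (y0 : S2) :
  k != 0 -> open Om -> Om y0 -> (forall y, Om y -> differentiable psi y) ->
  (forall y, Om y -> O (psi y)) -> (forall y, Om y -> jacobian psi e y != 0) ->
  (forall y, Om y -> proj_field psi e E y = 0) -> False.
Proof.
move=> k0 oOm Oy dpsi OmO j0 X0.
set h := proj_height psi e E.
have EZ y : Om y -> E (psi y) - h y *: e (psi y) = 0.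
  move=> hy; have := proj_fieldE E (dpsi y hy) (j0 y hy).
  by rewrite X0 // derive0.
have Oy0 := OmO _ Oy; have j00 := j0 _ Oy.
have dh := proj_height_diff oOm dpsi OmO (lf_unity_diff lf) (lf_euler_diff lf) Oy j00.
set B := flowmat e E (psi y0) (h y0).
have tan v : 'D_v psi y0 *m B = 'D_v h y0 *: e (psi y0).
  have N : \forall y \near y0, E (psi y) - h y *: e (psi y) = cst (0 : V) y.
    have : nbhs y0 Om by apply: open_nbhs_nbhs.
    by apply: filterS => y /EZ.
  have H1 := derive_projected lf v (dpsi _ Oy) dh Oy0.
  have H2 : 'D_v (fun y => E (psi y) - h y *: e (psi y)) y0 = 0.
    apply: (etrans (@near_eq_derive _ _ _ _ _ y0 v N)); exact: derive_cst.
  by apply/eqP; rewrite -subr_eq0 -H1 H2.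
have eB : e (psi y0) *m B = k *: e (psi y0).
  have := flow_unity lf (h y0) Oy0; rewrite EZ // derive0 => /esym/eqP.
  by rewrite subr_eq0 => /eqP.
have [|eta etaE] := @choice V K (fun w c => w *m B = c *: e (psi y0)).
  move=> w; set d0 := dir psi q0 y0; set d1 := dir psi q1 y0.
  have := cramer_div w j00; rewrite -/d0 -/d1 => H.
  set a := det3 w _ _ / _ in H; set b := det3 d0 w _ / _ in H; set c := det3 d0 d1 w / _ in H.
  exists (a * 'D_(delta_mx 0 q0) h y0 + b * 'D_(delta_mx 0 q1) h y0 + c * k).
  have -> : w = a *: d0 + b *: d1 + c *: e (psi y0) by rewrite H subrK.
  exact: (mulmx_comb3 _ _ _ (tan _) (tan _) eB).
have Eh : E (psi y0) = h y0 *: e (psi y0).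
  by apply/eqP; rewrite -subr_eq0 EZ.
exact: (euler_not_parallel lf Oy0 k0 Eh etaE).
Qed.
End NotZero.

Section Glue.
Variables (R : realType) (M : complex_manifold R 3) (Fr : frobenius_structure M).
Variables (S : complex_manifold R 2) (f : S -> M).
Hypotheses (hf : holomorphic_map f)
  (imm : forall i j s, chart_dom i s -> chart_dom j (f s) -> injective (tangent_map f i j s))
  (tr : transverse_to_unity Fr f).
Local Notation K := (C R).
Local Notation V := 'rV[K]_3.
Local Notation S2 := 'rV[K]_2.

Lemma algebra_at j x : chart_dom j x -> unital_algebra (mul Fr j x) (unity Fr j x).
Proof.
move=> hx; split.
- by move=> u; exact: Defs.mul_linear.
- by move=> u v; exact: Defs.mul_comm.
- by move=> u v w; exact: Defs.mul_assoc.
- by move=> u; exact: unity_mul.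
Qed.

Definition overlap (i : chart S) (j : chart M) : set S := chart_dom i `&` f @^-1` chart_dom j.

Lemma overlap_open i j : open (overlap i j).
Proof.
apply: openI; first exact: chart_dom_open.
by apply: open_comp => [x _|]; [exact: hf.1 | exact: chart_dom_open].
Qed.

Lemma overlap_image_open i j : open (coord i @` overlap i j).
Proof. by apply: coord_image_open => [|s []//]; exact: overlap_open. Qed.

Lemma local_map_diff i j y : (coord i @` overlap i j) y -> differentiable (local_map f i j) y.
Proof. by move=> [s [si sj] <-]; exact: hf.2. Qed.

Lemma local_map_coord i j s : chart_dom i s -> local_map f i j (coord i s) = coord j (f s).
Proof. by move=> si; rewrite /local_map /= coordK. Qed.

Lemma local_map_dom i j y : (coord i @` overlap i j) y ->
  (coord j @` chart_dom j) (local_map f i j y).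
Proof. by move=> [s [si sj] <-]; exists (f s) => //; rewrite local_map_coord. Qed.

Lemma derive_local_map i j s v : overlap i j s ->
  'D_v (local_map f i j) (coord i s) = tangent_map f i j s v.
Proof. by move=> [si sj]; exact: (deriveE _ (hf.2 i j s si sj)). Qed.

(** The two coordinate directions of an immersed surface and the transverse
    field e are linearly independent. *)
Lemma jacobian_neq0 i j y : (coord i @` overlap i j) y -> jacobian (local_map f i j) (chart_unity Fr j) y != 0.
Proof.
move=> [s [si sj] <-]; apply: det3_neq0 => x1 x2 x3.
rewrite /dir !derive_local_map // local_map_coord // /chart_unity coordK //.
set T := tangent_map f i j s; pose u := x1 *: delta_mx 0 q0 + x2 *: delta_mx 0 q1 : S2; move=> H.
have lT a v w : T (a *: v + w) = a *: T v + T w by exact: linearP.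
have T0 : T 0 = 0 by exact: linear0.
have TZ a v : T (a *: v) = a *: T v by exact: linearZ.
have Tu : T u = x1 *: T (delta_mx 0 q0) + x2 *: T (delta_mx 0 q1) by rewrite /u lT TZ.
rewrite -Tu in H.
have x30 : x3 = 0.
  have [//|x3n] := eqVneq x3 0.
  exfalso; apply: (tr si sj (u := - x3^-1 *: u)).
  have -> : tangent_map f i j s (- x3^-1 *: u) = - x3^-1 *: T u by exact: TZ.
  have -> : T u = - (x3 *: unity Fr j (f s)) by apply/eqP; rewrite -addr_eq0 H.
  by rewrite scaleNr scalerN opprK scalerA mulVf // scale1r.
move: H; rewrite x30 scale0r addr0 -T0 => /(imm si sj) u0.
have := congr1 (fun w : S2 => w 0 q0) u0; have := congr1 (fun w : S2 => w 0 q1) u0.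
by rewrite !mxE /= !mulr0 !mulr1 addr0 add0r.
Qed.

(** The condition defining web directions, for a single chart of the target;
    the frame in one chart determines the frames in all others. *)
Definition web_at i j s (u : S2) : Prop :=
  exists (F : 'M[K]_3) (k : 'I_3) (a b : K),
    [/\ idempotent_frame (mul Fr j (f s)) F,
        unity Fr j (f s) = \sum_l row l F &
        tangent_map f i j s u = a *: unity Fr j (f s) + b *: row k F].

Lemma tangent_change i i' j j' s u : chart_dom i s -> chart_dom i' s ->
  chart_dom j (f s) -> chart_dom j' (f s) ->
  tangent_map f i' j' s (change_chart i i' s u) =
  change_chart j j' (f s) (tangent_map f i j s u).
Proof.
move=> si si' sj sj'; rewrite /change_chart.
have H1 := tangent_comp (l := j') (f := @id S) (h := f) u (holomorphic_id S) hf si si' sj'.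
have H2 := tangent_comp (l := j') (h := @id M) u hf (holomorphic_id M) si sj sj'.
by rewrite -H1 -H2.
Qed.

(** A change of charts is an isomorphism of the tangent algebras, so it maps a
    frame of idempotents to a frame of idempotents. *)
Lemma frame_change j j' x (F : 'M[K]_3) : chart_dom j x -> chart_dom j' x ->
  idempotent_frame (mul Fr j x) F ->
  idempotent_frame (mul Fr j' x) (\matrix_l change_chart j j' x (row l F)).
Proof.
move=> xj xj' [uF HF].
pose A : 'M[K]_3 := lin1_mx (tangent_map (@id M) j j' x : {linear V -> V}).
pose B : 'M[K]_3 := lin1_mx (tangent_map (@id M) j' j x : {linear V -> V}).
have AE u : u *m A = change_chart j j' x u by exact: mul_rV_lin1.
have BE u : u *m B = change_chart j' j x u by exact: mul_rV_lin1.
have AB : A *m B = 1%:M.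
  apply/row_matrixP => l; rewrite !rowE mulmxA BE AE change_chartK //.
  by rewrite mulmx1.
have FA : \matrix_l change_chart j j' x (row l F) = F *m A.
  by apply/row_matrixP => l; rewrite rowK row_mul AE.
split.
  rewrite FA unitmx_mul uF /=; exact: (mulmx1_unit AB).1.
move=> l l'; rewrite !rowK mul_tensor // HF; case: (l == l') => //.
by rewrite -AE mul0mx.
Qed.

Lemma web_at_change i i' j j' s u : chart_dom i s -> chart_dom i' s ->
  chart_dom j (f s) -> chart_dom j' (f s) ->
  web_at i j s u -> web_at i' j' s (change_chart i i' s u).
Proof.
move=> si si' sj sj' [F [k [a [b [idF _ tF]]]]].
have idF' := frame_change sj sj' idF.
exists (\matrix_l change_chart j j' (f s) (row l F)), k, a, b; split.
- exact: idF'.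
- exact: (unit_frame_sum (algebra_at sj') idF').
have lT c v w : change_chart j j' (f s) (c *: v + w) =
    c *: change_chart j j' (f s) v + change_chart j j' (f s) w by exact: linearP.
have TZ c v : change_chart j j' (f s) (c *: v) = c *: change_chart j j' (f s) v by exact: linearZ.
rewrite (tangent_change u si si' sj sj') tF lT TZ rowK.
by have [_ H] := unity_holomorphic Fr; rewrite (H j j' (f s) I sj sj').
Qed.

Lemma web_at_semisimple i j s u : chart_dom j (f s) -> web_at i j s u -> semisimple_at Fr (f s).
Proof.
move=> sj [F [k [a [b [idF _ _]]]]] j' sj'.
exact: (frame_semisimple (algebra_at sj') (frame_change sj sj' idF)).
Qed.

(** The vector field X of the symmetry, computed in a fixed chart j0 of the
    ambient manifold. *)
Definition euler_shadow (j0 : chart M) (i : chart S) (s : S) : S2 :=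
  proj_field (local_map f i j0) (chart_unity Fr j0) (chart_euler Fr j0) (coord i s).

Lemma chart_unityE j x : chart_dom j x -> chart_unity Fr j (coord j x) = unity Fr j x.
Proof. by move=> xj; rewrite /chart_unity coordK. Qed.

Lemma chart_eulerE j x : chart_dom j x -> chart_euler Fr j (coord j x) = euler Fr j x.
Proof. by move=> xj; rewrite /chart_euler coordK. Qed.

Lemma unity_chart_diff j y : (coord j @` chart_dom j) y -> differentiable (chart_unity Fr j) y.
Proof. by move=> [x hx <-]; have [h _] := unity_holomorphic Fr; exact: h. Qed.

Lemma euler_chart_diff j y : (coord j @` chart_dom j) y -> differentiable (chart_euler Fr j) y.
Proof. by move=> [x hx <-]; have [h _] := euler_holomorphic Fr; exact: h. Qed.

Lemma overlap_image i j s : overlap i j s -> (coord i @` overlap i j) (coord i s).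
Proof. by exists s. Qed.

Lemma euler_shadowE j0 i s : overlap i j0 s ->
  tangent_map f i j0 s (euler_shadow j0 i s) = euler Fr j0 (f s) -
    proj_height (local_map f i j0) (chart_unity Fr j0) (chart_euler Fr j0) (coord i s) *: unity Fr j0 (f s).
Proof.
move=> os; have [si sj] := os; have Oy := overlap_image os.
rewrite -(derive_local_map _ os) proj_fieldE; [|exact: local_map_diff|exact: jacobian_neq0].
by rewrite (local_map_coord j0 si) (chart_eulerE sj) (chart_unityE sj).
Qed.

(** The projection is characterized by the equation of [proj_unique], which
    does not depend on the chart of the surface. *)
Lemma euler_shadow_holomorphic j0 (U : set S) :
  (forall s, U s -> chart_dom j0 (f s)) -> holomorphic_vector_field U (euler_shadow j0).
Proof.
move=> HU; split=> [i s Us si|i i' s Us si si'].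
  have Oy := overlap_image (conj si (HU s Us) : overlap i j0 s).
  have d := proj_field_diff (@overlap_image_open i j0) (@local_map_diff i j0)
    (@local_map_dom i j0) (@unity_chart_diff j0) (@euler_chart_diff j0) Oy (jacobian_neq0 Oy).
  apply: near_eq_differentiable d.
  by apply: filterS (coord_near_image si) => y [s' h ->]; rewrite /= /euler_shadow coordK.
have sj := HU s Us; have os : overlap i j0 s by [].
have os' : overlap i' j0 s by [].
apply/esym/(proj_unique (c := proj_height (local_map f i j0) (chart_unity Fr j0) (chart_euler Fr j0) (coord i s))).
- by apply: local_map_diff; exact: overlap_image.
- by apply: jacobian_neq0; exact: overlap_image.
rewrite (derive_local_map _ os') (tangent_change _ si si' sj sj) {1}/change_chart (tangent_id _ sj) (euler_shadowE os).
by rewrite (local_map_coord j0 si') (chart_eulerE sj) (chart_unityE sj).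
Qed.
End Glue.

(** * Transport of web directions by the flow *)

Lemma det3_indep_pair (K : fieldType) (d0 d1 e : 'rV[K]_3) (x y : K) : det3 d0 d1 e != 0 ->
  det3 e (x *: d0 + y *: d1) d0 = 0 -> det3 e (x *: d0 + y *: d1) d1 = 0 -> x = 0 /\ y = 0.
Proof.
move=> d h0 h1.
have e0 : det3 e (x *: d0 + y *: d1) d0 = - y * det3 d0 d1 e by rewrite /det3 !mxE; ring.
have e1 : det3 e (x *: d0 + y *: d1) d1 = x * det3 d0 d1 e by rewrite /det3 !mxE; ring.
split; apply/eqP.
  by move/eqP: h1; rewrite e1 mulf_eq0 (negbTE d) orbF.
by move/eqP: h0; rewrite e0 mulf_eq0 (negbTE d) orbF oppr_eq0.
Qed.

Section Flow.
Variables (R : realType) (M : complex_manifold R 3) (Fr : frobenius_structure M).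
Variables (S : complex_manifold R 2) (f : S -> M).
Local Notation K := (C R).
Local Notation V := 'rV[K]_3.
Local Notation S2 := 'rV[K]_2.
Hypotheses (hf : holomorphic_map f)
  (imm : forall i j s, chart_dom i s -> chart_dom j (f s) -> injective (tangent_map f i j s))
  (tr : transverse_to_unity Fr f).
Variables (k k' : K).
Hypotheses (Hk : forall i x u v, chart_dom i x ->
    lie_mul (euler Fr) (mul Fr) i x u v = k *: mul Fr i x u v)
  (Hk' : forall i x u v, chart_dom i x ->
    lie_metric (euler Fr) (metric Fr) i x u v = k' * metric Fr i x u v).
Variables (i0 : chart S) (j0 : chart M) (U W : set S) (r : R) (phi : K -> S -> S).
Hypotheses (UO : U `<=` overlap f i0 j0) (r0 : 0 < r)
  (lfl : local_flow U (euler_shadow Fr f j0) W r phi).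

Let lf := chart_local_frobenius j0 Hk Hk'.
Let psi := local_map f i0 j0.
Let e := chart_unity Fr j0.
Let E := chart_euler Fr j0.

Definition flow_domain : set (K * S2) := (fst @^-1` [set z : K | nrm z < r]) `&` (snd @^-1` (coord i0 @` W)).
Definition chart_flow (q : K * S2) : S2 := coord i0 (phi q.1 (point_of i0 q.2)).
Definition flow_image : K * S2 -> V := psi \o chart_flow.
Definition flow_height : K * S2 -> K := proj_height psi e E \o chart_flow.

Lemma flow_dom s : W s -> overlap f i0 j0 s.
Proof. by move=> /(flow_sub lfl) /UO. Qed.

Lemma flow_lt (t : K) : (`|t| < (r%:C)%C) = (nrm (t : K) < r).
Proof. by rewrite nrmE; exact: toC_lt. Qed.

Lemma flow_overlap (t : K) s : nrm t < r -> W s -> overlap f i0 j0 (phi t s).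
Proof. by move=> ht Ws; apply/UO/(flow_stays lfl) => //; rewrite flow_lt. Qed.

Lemma flow_dom_open : open flow_domain.
Proof.
apply: openI; last first.
  apply: open_comp => [q _|]; first exact: cvg_snd.
  by apply: coord_image_open; [exact: (flow_open lfl) | move=> s /flow_dom[]].
apply: open_comp => [q _|]; first exact: cvg_fst.
rewrite openE => z hz; apply/nbhs_nrm; exists (r - nrm z); first by rewrite subr_gt0.
move=> z' hz'; have := nrmD (z' - z) z; rewrite subrK /=; move: hz hz' => /=; lra.
Qed.

(** The flow of X is jointly holomorphic in time and initial point. *)
Lemma chart_flow_diff q : flow_domain q -> differentiable chart_flow q.
Proof.
case: q => t y [/= ht [s Ws E']]; rewrite -E'.
have [si _] := flow_dom Ws.
apply: (flow_holomorphic lfl) => //; first by rewrite flow_lt.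
by have [] := flow_overlap ht Ws.
Qed.

Lemma chart_flow_dom q : flow_domain q -> (coord i0 @` overlap f i0 j0) (chart_flow q).
Proof.
case: q => t y [/= ht [s Ws E']]; rewrite -E'.
have [si _] := flow_dom Ws; rewrite /chart_flow /= coordK //.
by exists (phi t s) => //; exact: flow_overlap.
Qed.

Lemma flow_image_diff q : flow_domain q -> differentiable flow_image q.
Proof.
move=> Qq; apply: differentiable_comp; first exact: chart_flow_diff.
by apply: local_map_diff => //; exact: chart_flow_dom.
Qed.

Lemma flow_image_dom q : flow_domain q -> (coord j0 @` chart_dom j0) (flow_image q).
Proof. by move=> Qq; apply: local_map_dom; exact: chart_flow_dom. Qed.

Lemma flow_height_diff q : flow_domain q -> differentiable flow_height q.
Proof.
move=> Qq; apply: differentiable_comp; first exact: chart_flow_diff.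
have Oy := chart_flow_dom Qq.
exact: (proj_height_diff (@overlap_image_open _ _ _ _ hf i0 j0) (@local_map_diff _ _ _ _ hf i0 j0)
    (@local_map_dom _ _ _ _ i0 j0) (@unity_chart_diff _ _ Fr j0) (@euler_chart_diff _ _ Fr j0) Oy
    (jacobian_neq0 hf imm tr Oy)).
Qed.

(** The image in the ambient manifold of a flow line of X is an integral curve
    of E - h e. *)
Lemma flow_image_ode q : flow_domain q ->
  'D_((1, 0) : K * S2) flow_image q = E (flow_image q) - flow_height q *: e (flow_image q).
Proof.
move=> Qq; have Oy := chart_flow_dom Qq.
have dpsi := local_map_diff hf Oy.
rewrite (derive_comp _ (chart_flow_diff Qq) dpsi).
suff -> : 'D_((1, 0) : K * S2) chart_flow q = proj_field psi e E (chart_flow q).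
  exact: (proj_fieldE E dpsi (jacobian_neq0 hf imm tr Oy)).
move: Qq Oy {dpsi}; case: q => t y Qq Oy.
have [_ <-] := curve_comp (chart_flow_diff Qq) (time_curve y t).
case: Qq => /= ht [s Ws E']; have [si _] := flow_dom Ws.
have ht' : `|t| < (r%:C)%C by rewrite flow_lt.
have [sj _] := UO (flow_stays lfl ht' Ws).
have := flow_ode lfl ht' Ws sj; rewrite derive1E.
have -> : (fun t' => coord i0 (phi t' s)) = chart_flow \o (fun s0 : K => (s0, y) : K * S2).
  by apply/funext => t'; rewrite /chart_flow /= -E' coordK.
by move=> ->; rewrite /euler_shadow /chart_flow /= -E' coordK.
Qed.

Section Transport.
Variables (t : K) (s : S) (v : S2).
Hypotheses (ht : nrm (t : K) < r) (Ws : W s).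
Let y0 := coord i0 s.
Let u := 'D_(hor v) chart_flow (t, y0).

Lemma flow_domain_at z : nrm (z : K) < r -> flow_domain (z, y0).
Proof. by move=> hz; split => //=; exists s. Qed.

Lemma flow_image_at z : nrm (z : K) < r -> flow_image (z, y0) = coord j0 (f (phi z s)).
Proof.
move=> hz; have [si _] := flow_dom Ws.
rewrite /flow_image /= /chart_flow /= coordK //.
have [h _] := flow_overlap hz Ws.
exact: (local_map_coord f j0 h).
Qed.

Lemma variation_at_0 w : 'D_(hor w) flow_image (0, y0) = tangent_map f i0 j0 s w.
Proof.
have n0 : nrm (0 : K) < r by rewrite nrm0.
have Q0 := flow_domain_at n0.
have dp : is_diff y0 (fun y : S2 => ((0, y) : K * S2)) (fun y : S2 => ((0, y) : K * S2)).
  have H1 : is_diff y0 (fun _ : S2 => (0 : K)) (fun _ : S2 => (0 : K)) by exact: is_diff_cst.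
  have H2 : is_diff y0 (fun y : S2 => y) (fun y : S2 => y) by exact: is_diff_id.
  exact: is_diff_pair.
have [dd Ed] := dp.
have E1 : 'D_w (fun y : S2 => ((0, y) : K * S2)) y0 = hor w.
  have H : 'D_w (fun y : S2 => ((0, y) : K * S2)) y0 = 'd (fun y : S2 => ((0, y) : K * S2)) y0 w := deriveE _ dd.
  by rewrite H Ed.
have E2 := derive_comp w dd (flow_image_diff Q0).
rewrite E1 in E2; rewrite -E2 -(derive_local_map hf w (flow_dom Ws)).
apply: near_eq_derive.
have [si _] := flow_dom Ws.
have nW : nbhs s W by exact: (open_nbhs_nbhs (conj (flow_open lfl) Ws)).
apply: filterS2 (coord_nbhs si nW) (coord_near_image si) => y Wy [s' si' Es'].
rewrite Es' (coordK si') in Wy.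
rewrite Es' /flow_image /chart_flow /= (coordK si') (flow_init lfl Wy).
exact: erefl.
Qed.

Lemma variation_at w : 'D_(hor w) flow_image (t, y0) =
  tangent_map f i0 j0 (phi t s) ('D_(hor w) chart_flow (t, y0)).
Proof.
have Qt := flow_domain_at ht; have Oy := chart_flow_dom Qt.
rewrite (derive_comp _ (chart_flow_diff Qt) (local_map_diff hf Oy)).
have oo := flow_overlap ht Ws.
rewrite -(derive_local_map hf _ oo) /chart_flow /= coordK //.
by have [] := flow_dom Ws.
Qed.

(** If u vanished, then the area det3 (e, Z_v, Z_w) would vanish at time t for
    all w, and by [family_area] also at time 0. *)
Lemma transport_neq0 : v != 0 -> u != 0.
Proof.
apply: contraNneq => u0.
have n0 : nrm (0 : K) < r by rewrite nrm0.
have Z w : det3 (e (flow_image (0, y0))) (tangent_map f i0 j0 s v) (tangent_map f i0 j0 s w) = 0.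
  have := (family_area lf flow_dom_open flow_image_diff flow_height_diff flow_image_dom
    flow_image_ode flow_domain_at ht v w).1.
  rewrite /flow_variation /flow_curve !variation_at_0; apply.
  rewrite variation_at -/u u0.
  have -> : tangent_map f i0 j0 (phi t s) 0 = 0 by exact: linear0.
  by rewrite /det3 !mxE !mul0r !subrr !mulr0 subrr addr0.
have os := flow_dom Ws; have Oy := overlap_image os.
have J := jacobian_neq0 hf imm tr Oy; rewrite /jacobian in J.
have F0 : flow_image (0, y0) = psi y0.
  by rewrite (flow_image_at n0) (flow_init lfl Ws) /psi /y0 (local_map_coord f j0 os.1).
rewrite F0 in Z.
have tv : tangent_map f i0 j0 s v = v 0 q0 *: dir psi q0 y0 + v 0 q1 *: dir psi q1 y0.
  by rewrite -(derive_local_map hf _ os) (derive_dir _ (local_map_diff hf Oy)).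
have td j : tangent_map f i0 j0 s (delta_mx 0 j) = dir psi j y0 by rewrite -(derive_local_map hf _ os).
have h0 := Z (delta_mx 0 q0); have h1 := Z (delta_mx 0 q1).
rewrite td tv in h0; rewrite td tv in h1.
have [v0 v1] := det3_indep_pair J h0 h1.
by apply/eqP; rewrite (row2_sum v) v0 v1 !scale0r addr0.
Qed.

(** Regularity is carried from time 0 to time t by [family_semisimple], which
    yields a frame there; being tangent to a web direction is then the
    vanishing of the cubic, carried by [family_cubic]. *)
Lemma transport_web : web_at Fr f i0 j0 s v -> web_at Fr f i0 j0 (phi t s) u.
Proof.
move=> [F [l [a [b [idF _ tF]]]]].
have n0 : nrm (0 : K) < r by rewrite nrm0.
have os := flow_dom Ws.
have ot := flow_overlap ht Ws.
have at0 : flow_image (0, y0) = coord j0 (f s) by rewrite (flow_image_at n0) (flow_init lfl Ws).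
have att := flow_image_at ht.
have D0 : (coord j0 @` chart_dom j0) (coord j0 (f s)) by exists (f s) => //; exact: os.2.
have Dt : (coord j0 @` chart_dom j0) (coord j0 (f (phi t s))).
  by exists (f (phi t s)) => //; exact: ot.2.
have ua0 := algebra_at Fr os.2; have uat := algebra_at Fr ot.2.
have m0 : chart_mul Fr j0 (coord j0 (f s)) = mul Fr j0 (f s).
  by apply/funext => x; apply/funext => y; rewrite /chart_mul (coordK os.2).
have mt : chart_mul Fr j0 (coord j0 (f (phi t s))) = mul Fr j0 (f (phi t s)).
  by apply/funext => x; apply/funext => y; rewrite /chart_mul (coordK ot.2).
have B0 := trform_bilin lf D0; rewrite m0 in B0.
have Bt := trform_bilin lf Dt; rewrite mt in Bt.
have G0 := gram_neq0 B0 (frame_nondeg ua0 idF).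
have ss := family_semisimple lf flow_image_diff flow_image_dom flow_image_ode flow_domain_at ht.
rewrite /flow_curve at0 att m0 mt in ss.
have Gt : gram (trform (mul Fr j0 (f (phi t s)))) != 0.
  by apply: contraNneq G0 => /ss ->.
have [F1 idF1] := exists_frame uat (gram_nondeg Bt Gt).
have cub := family_cubic lf flow_dom_open flow_image_diff flow_height_diff flow_image_dom
    flow_image_ode flow_domain_at ht v.
rewrite /= /flow_variation /flow_curve variation_at variation_at_0 at0 att m0 mt in cub.
rewrite (chart_unityE Fr os.2) (chart_unityE Fr ot.2) -/u in cub.
have /(web_cubicP uat idF1)[l1 [a1 [b1 E1]]] :=
  cub.2 ((web_cubicP ua0 idF _).2 (ex_intro _ l (ex_intro _ a (ex_intro _ b tF)))).
exists F1, l1, a1, b1; split; [exact: idF1 | exact: (unit_frame_sum uat idF1) | exact: E1].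
Qed.
End Transport.
End Flow.

(** * The web symmetry *)

Section Ball.
Variables (R : realType) (n : nat) (M : complex_manifold R n).
Local Notation K := (C R).
Local Notation V := 'rV[K]_n.

(** The parameter is real while the space is normed over the complex numbers. *)
Lemma segment_point_continuous (y0 w : V) (x : R) :
  {for x, continuous (fun x => y0 + toC x *: w)}.
Proof.
move=> A /nbhs_nrm[d d0 H]; have w0 := nrm_ge0 w.
have w1 : 0 < nrm w + 1 by lra.
apply/nbhs_ballP; exists (d / (nrm w + 1)) => /=; first by rewrite divr_gt0.
move=> x' /=; rewrite /ball /= => hx'; apply: H.
have -> : y0 + toC x' *: w - (y0 + toC x *: w) = toC (x' - x) *: w.
  by rewrite toCD toCN scalerDl scaleNr; apply/rowP => i; rewrite !mxE; ring.
rewrite nrmZ nrm_toC distrC.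
apply: le_lt_trans (_ : `|x - x'| * (nrm w + 1) < d); last by rewrite -ltr_pdivlMr.
by rewrite ler_wpM2l //; lra.
Qed.

(** A ball is the union of the segments that join its centre to its points. *)
Lemma chart_ball_connected (i : chart M) (y0 : V) (d : R) : 0 < d ->
  (forall y, nrm (y - y0) < d -> (coord i @` chart_dom i) y) ->
  connected (point_of i @` [set y | nrm (y - y0) < d]).
Proof.
move=> d0 H.
pose b := [set y : V | nrm (y - y0) < d].
pose path (y : V) (x : R) := point_of i (y0 + toC x *: (y - y0)).
have inb y (x : R) : b y -> x \in `[0, 1] -> b (y0 + toC x *: (y - y0)).
  rewrite in_itv /= => by_ /andP[x0 x1].
  rewrite /b /= addrAC subrr add0r nrmZ nrm_toC ger0_norm //.
  by apply: le_lt_trans by_; rewrite ler_piMl //; exact: nrm_ge0.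
have -> : point_of i @` b = \bigcup_(y in b) (path y @` `[0, 1]).
  apply/seteqP; split=> [_ [y hy <-]|_ [y hy [x hx <-]]].
    exists y => //; exists 1; first by rewrite /= in_itv /= ler01 lexx.
    by rewrite /path toC1 scale1r addrC subrK.
  exists (y0 + toC x *: (y - y0)) => //; exact: inb.
apply: bigcup_connected.
  exists (point_of i y0) => y _; exists 0; first by rewrite /= in_itv /= ler01 lexx.
  by rewrite /path toC0 scale0r addr0.
move=> y hy; apply: connected_continuous_connected; first exact: segment_connected.
apply: continuous_in_subspaceT => x /set_mem hx.
have [s si Es] := H _ (inb y x hy hx).
apply: (@continuous_comp _ _ _ (fun x : R => y0 + toC x *: (y - y0)) (point_of i) x).
  exact: segment_point_continuous.
by have := point_of_continuous si; rewrite Es.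
Qed.
End Ball.

Section Symmetry.
Variables (R : realType) (M : complex_manifold R 3) (Fr : frobenius_structure M).
Variables (S : complex_manifold R 2) (f : S -> M).
Local Notation K := (C R).
Local Notation V := 'rV[K]_3.
Local Notation S2 := 'rV[K]_2.
Hypotheses (hf : holomorphic_map f)
  (imm : forall i j s, chart_dom i s -> chart_dom j (f s) -> injective (tangent_map f i j s))
  (tr : transverse_to_unity Fr f).
Variables (k k' : K).
Hypotheses (Hk : forall i x u v, chart_dom i x ->
    lie_mul (euler Fr) (mul Fr) i x u v = k *: mul Fr i x u v)
  (Hk' : forall i x u v, chart_dom i x ->
    lie_metric (euler Fr) (metric Fr) i x u v = k' * metric Fr i x u v).

Section Leaf.
Variables (i0 : chart S) (j0 : chart M) (U W : set S) (r : R) (phi : K -> S -> S).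
Hypotheses (UO : U `<=` overlap f i0 j0) (r0 : 0 < r)
  (lfl : local_flow U (euler_shadow Fr f j0) W r phi).
Variables (D : set K) (g : K -> S) (t tau : K).
Hypotheses (oD : open D) (gW : g @` D `<=` W) (ht : nrm t < r) (Dt : D tau).
Let s := g tau.
Let y0 := coord i0 s.
Let v := derive1 (coord i0 \o g) tau.
Let u := 'D_(hor v) (chart_flow i0 phi) (t, y0).

Lemma leaf_in x : D x -> W (g x).
Proof. by move=> Dx; apply: gW; exists x. Qed.

Lemma flowed_chart : chart_dom i0 (phi t s).
Proof. by have [] := flow_overlap UO lfl ht (leaf_in Dt). Qed.

(** The flow read in the chart i of the end point is the change of charts
    applied to the flow read in the chart i0. *)
Lemma chart_flow_change i : chart_dom i (phi t s) ->
  'D_(hor v) (fun q : K * S2 => coord i (phi q.1 (point_of i0 q.2))) (t, y0) =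
  change_chart i0 i (phi t s) u.
Proof.
move=> hi; have Ws := leaf_in Dt; have [si _] := UO (flow_sub lfl Ws).
have Qt := flow_domain_at (W := W) i0 Ws ht.
have dF := chart_flow_diff UO lfl Qt.
have E0 : chart_flow i0 phi (t, y0) = coord i0 (phi t s) by rewrite /chart_flow /= (coordK si).
have dT := transition_holomorphic flowed_chart hi.
have C : 'D_(hor v) (local_map (@id S) i0 i \o chart_flow i0 phi) (t, y0) =
    'D_u (local_map (@id S) i0 i) (chart_flow i0 phi (t, y0)).
  by apply: (derive_comp (hor v) dF); rewrite E0; exact: dT.
rewrite E0 in C.
have E2 : 'D_u (local_map (@id S) i0 i) (coord i0 (phi t s)) = change_chart i0 i (phi t s) u := deriveE u dT.
rewrite -E2 -C; apply: near_eq_derive.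
have nQ : nbhs (t, y0) (flow_domain i0 W r) := open_nbhs_nbhs (conj (flow_dom_open UO lfl) Qt).
apply: filterS nQ => q Qq.
case: Qq => hq [s' Ws' Es'].
have [si' _] := UO (flow_sub lfl Ws').
have ci : chart_dom i0 (phi q.1 s').
  by have [] := flow_overlap UO lfl hq Ws'.
by rewrite /chart_flow /local_map /= -Es' (coordK si') (coordK ci).
Qed.

Lemma flowed_leaf_derive i : derivable (coord i0 \o g) tau 1 -> chart_dom i (phi t s) ->
  is_derive tau 1 (coord i \o (phi t \o g)) (change_chart i0 i (phi t s) u).
Proof.
move=> dg hi; have Ws := leaf_in Dt; have [si _] := UO (flow_sub lfl Ws).
have dd : differentiable (coord i0 \o g) tau by apply/derivable1_diffP.
have dpair : is_diff tau (fun x : K => ((t, (coord i0 \o g) x) : K * S2))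
    (fun h : K => ((0, 'd (coord i0 \o g) tau h) : K * S2)).
  have H1 : is_diff tau (fun _ : K => t) (fun _ : K => (0 : K)) by exact: is_diff_cst.
  have H2 : is_diff tau (coord i0 \o g) ('d (coord i0 \o g) tau) by exact: differentiableP.
  exact: is_diff_pair.
have [dP EP] := dpair.
have curve : is_derive tau (1 : K) (fun x : K => ((t, (coord i0 \o g) x) : K * S2)) (hor v).
  split; first by apply/derivable1_diffP.
  have E1 : 'D_1 (fun x : K => ((t, (coord i0 \o g) x) : K * S2)) tau =
    'd (fun x : K => ((t, (coord i0 \o g) x) : K * S2)) tau (1 : K) := deriveE _ dP.
  rewrite E1 EP /hor /v derive1E.
  by have -> : 'D_1 (coord i0 \o g) tau = 'd (coord i0 \o g) tau (1 : K) := deriveE _ dd.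
have dF : differentiable (fun q : K * S2 => coord i (phi q.1 (point_of i0 q.2))) (t, y0).
  by apply: (flow_holomorphic lfl _ Ws si hi); rewrite flow_lt.
have [d1 E1] := curve_comp dF curve.
rewrite (chart_flow_change hi) in E1.
have N : \forall x \near tau, ((fun q : K * S2 => coord i (phi q.1 (point_of i0 q.2))) \o
    (fun x : K => ((t, (coord i0 \o g) x) : K * S2))) x = (coord i \o (phi t \o g)) x.
  apply: filterS (open_nbhs_nbhs (conj oD Dt)) => x Dx.
  have [sx _] := UO (flow_sub lfl (leaf_in Dx)).
  by rewrite /= (coordK sx).
split.
  apply/derivable1_diffP; apply: (near_eq_differentiable N); exact/derivable1_diffP.
by rewrite -E1; apply/esym/near_eq_derive.
Qed.

Lemma flowed_leaf_continuous : {for tau, continuous g} -> {for tau, continuous (phi t \o g)}.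
Proof.
move=> cg.
have c1 : {for tau, continuous (fun _ : K => t)} by exact: cst_continuous.
have ht' := ht; rewrite -flow_lt in ht'.
have c2 := flow_continuous lfl ht' (leaf_in Dt).
exact: (@continuous2_cvg _ _ _ _ (nbhs tau) (nbhs_filter tau) _ _ phi t (g tau) c2 c1 cg).
Qed.
End Leaf.

(** The leaf is transported in the charts i0 and j0, and the result is then
    moved to arbitrary charts of the end point. *)
Lemma euler_shadow_symmetry i0 j0 (U : set S) : U `<=` overlap f i0 j0 ->
  web_symmetry Fr f U (euler_shadow Fr f j0).
Proof.
move=> UO W r phi r0 lfl D g [[oD nD cD] leaf] gW t; rewrite flow_lt => ht.
split=> [|tau Dtau]; first by split.
have [_ cg der] := leaf tau Dtau.
have Ws := leaf_in gW Dtau; have os := UO _ (flow_sub lfl Ws).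
have [dg v0 wd] := der i0 os.1.
have web0 : web_at Fr f i0 j0 (g tau) (derive1 (coord i0 \o g) tau) := wd j0 os.2.
have web1 := transport_web hf imm tr Hk Hk' UO r0 lfl ht Ws web0.
have u0 := transport_neq0 hf imm tr Hk Hk' UO r0 lfl ht Ws v0.
have [ci cj] := flow_overlap UO lfl ht Ws.
split.
- exact: (web_at_semisimple cj web1).
- exact: (flowed_leaf_continuous lfl gW ht Dtau cg).
- move=> i hi; have [d1 E1] := flowed_leaf_derive UO lfl oD gW ht Dtau dg hi.
  rewrite derive1E E1; split; first exact: d1.
    apply: contraNneq u0 => c0.
    have := @change_chartK _ _ _ _ _ _ ('D_(hor (derive1 (coord i0 \o g) tau)) (chart_flow i0 phi) (t, coord i0 (g tau))) ci hi.
    by rewrite c0 => <-; apply/eqP; exact: linear0.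
  move=> j hj; exact: (web_at_change hf ci hi cj hj web1).
Qed.

(** Otherwise [E, e] = - k e would vanish everywhere. *)
Lemma euler_mul_weight : (exists i x, chart_dom i x /\
       lie_bracket (euler Fr) (unity Fr) i x <> 0) -> k != 0.
Proof.
move=> [i [x [hx H]]]; apply/eqP => k0; apply: H.
have lf := chart_local_frobenius i Hk Hk'.
have Ox : (coord i @` chart_dom i) (coord i x) by exists x.
have := bracket_euler_unity lf Ox; rewrite k0 scale0r subr0 (chart_unityE Fr hx) (chart_eulerE Fr hx).
by move=> E; apply/eqP; rewrite subr_eq0; apply/eqP.
Qed.

Lemma euler_shadow_neq0 i0 j0 (b : set S2) : k != 0 -> open b -> b !=set0 ->
  b `<=` coord i0 @` overlap f i0 j0 ->
  exists i s, [/\ (point_of i0 @` b) s, chart_dom i s & euler_shadow Fr f j0 i s <> 0].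
Proof.
move=> k0 ob [y0 by0] bO; apply: contrapT => H.
apply: (proj_field_neq0 (chart_local_frobenius j0 Hk Hk') k0 ob by0 (psi := local_map f i0 j0)).
- by move=> y /bO; exact: local_map_diff.
- by move=> y /bO; exact: local_map_dom.
- by move=> y /bO; exact: jacobian_neq0.
move=> y hy; apply: contrapT => Hy; apply: H.
have [s os Es] := bO y hy; have [si _] := os.
exists i0, s; split; [|exact: si|by rewrite /euler_shadow Es].
by exists y; [exact: hy | rewrite -Es (coordK si)].
Qed.
End Symmetry.

Theorem theorem3 (R : realType) (M : complex_manifold R 3)
    (Fr : frobenius_structure M)
    (M_connected : connected [set: M])
    (lie_E_e_neq0 : exists i x, chart_dom i x /\
       lie_bracket (euler Fr) (unity Fr) i x <> 0)
    (M_semisimple : exists Q : set M,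
       [/\ open Q, Q !=set0 & forall q, Q q -> semisimple_at Fr q])
    (S : complex_manifold R 2) (f : S -> M)
    (S_embedded : embedded_submanifold f)
    (S_transverse : transverse_to_unity Fr f) (p : S) :
  exists (U : set S) (X : chart S -> S -> 'rV[C R]_2),
    [/\ [/\ open U, connected U & U p],
        holomorphic_vector_field U X,
        (exists i s, [/\ U s, chart_dom i s & X i s <> 0]) &
        web_symmetry Fr f U X].
Proof.
have [hf _ imm _] := S_embedded.
have [k Hk] := euler_mul Fr; have [k' Hk'] := euler_metric Fr.
have k0 := euler_mul_weight Hk Hk' lie_E_e_neq0.
have [i0 pi0] := chart_cover p; have [j0 fpj0] := chart_cover (f p).
pose y0 := coord i0 p.
have nb : nbhs y0 (coord i0 @` overlap f i0 j0).
  apply: open_nbhs_nbhs; split; last by exists p.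
  exact: overlap_image_open.
have [d d0 Hd] := (nbhs_nrm _ _).1 nb.
pose b := [set y | nrm (y - y0) < d].
have bO : b `<=` coord i0 @` overlap f i0 j0 by move=> y /Hd.
have by0 : b y0 by rewrite /b /= subrr nrm0.
have ob : open b.
  rewrite openE => y hy; apply/nbhs_nrm; exists (d - nrm (y - y0)); first by rewrite subr_gt0.
  by move=> y' hy'; have := nrm_sub y' y y0; rewrite /b /=; move: hy' hy; rewrite /b /=; lra.
pose U := point_of i0 @` b.
have UO : U `<=` overlap f i0 j0.
  by move=> _ [y /bO[s os <-] <-]; have [si _] := os; rewrite (coordK si).
have oU : open U.
  rewrite openE => s Us; have [si _] := UO s Us.
  have bs : b (coord i0 s).
    by case: Us => y hy <-; have [s' [si' _] Es'] := bO y hy; rewrite -Es' (coordK si') Es'.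
  have nb' : nbhs (coord i0 s) b := open_nbhs_nbhs (conj ob bs).
  have cs := Defs.coord_continuous si.
  have nb2 : nbhs s (coord i0 @^-1` b) := cs b nb'.
  apply: filterS2 nb2 _; last exact: (chart_nbhs si).
  move=> s' bs' si'.
  by exists (coord i0 s'); [exact: bs' | rewrite (coordK si')].
exists U, (euler_shadow Fr f j0); split.
- split; [exact: oU | | by exists y0 => //; exact: coordK].
  by apply: chart_ball_connected => // y /Hd[s [si _] <-]; exists s.
- by apply: euler_shadow_holomorphic => // s /UO[].
- exact: (euler_shadow_neq0 hf imm S_transverse Hk Hk' k0 ob (ex_intro _ y0 by0) bO).
- exact: (euler_shadow_symmetry hf imm S_transverse Hk Hk' UO).
Qed.
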